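(* Let $\alpha=(\alpha_1\ge\alpha_2\ge\dots\ge0)$ with $\sum_i\alpha_i=1$, let $\delta\in[0,1]$, and put $\alpha'_1=\delta$, $\alpha'_i=(1-\delta)\alpha_{i-1}$ for $i>1$. The realization of the representation of the group $S_\infty$ corresponding to the parameters $(\alpha',0)$ in the space of functions $L^2(\tilde{\mathcal X},m_{\alpha'})$ can be extended to a realization of the representation of the semigroup $R_\infty$ corresponding to the parameters $(\alpha,0,\delta)$.
   Context: $R_n$ is the symmetric inverse semigroup: all injective partial maps from $\{1,\dots,n\}$ to itself, under composition where defined. $R_n\subset R_{n+1}$ by letting $n+1$ be fixed, $R_\infty=\bigcup_nR_n$, and $S_\infty=\bigcup_nS_n\subset R_\infty$. For a probability vector $\alpha'$ on $\mathbb{N}=\{1,2,\dots\}$ let $\mu_{\alpha'}(i)=\alpha'_i$, let $\mathcal X=\prod\mathbb{N}$ be the set of sequences equipped with the product measure $m_{\alpha'}=\prod\mu_{\alpha'}$, and let $\tilde{\mathcal X}$ be the set of pairs of sequences coinciding from some point on. In $L^2(\tilde{\mathcal X},m_{\alpha'})$ one has the known Vershik–Kerov realization of the factor representation of $S_\infty$ with Thoma parameters $(\alpha',0)$ (that is, $\beta=0$), in which $S_\infty$ acts through permutations of the coordinates of the first sequence of a pair. The representation of $R_\infty$ corresponding to the parameters $(\alpha,0,\delta)$ is the factor representation corresponding to the indecomposable character $\chi_{\alpha,0,\delta}$ of $\mathbb{C}[R_\infty]$, defined as follows. The branching graph of $\mathbb{C}[S_\infty]$ is the Young graph $\mathbb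 Y$. The branching graph of $\mathbb{C}[R_\infty]$ is the slow Young graph $\tilde{\mathbb Y}$: the vertices of the $n$th level are pairs $(n,\lambda)$ with $\lambda$ a Young diagram with $|\lambda|\le n$ cells, and $(n,\lambda)$, $(n+1,\mu)$ are joined by an edge if $\mu=\lambda$ or $\mu$ is obtained from $\lambda$ by adding one cell. The Pascal graph $\mathbb P$ has vertices $(n,k)$, $0\le k\le n$, on level $n$, and $(n,k)$ is joined to $(n+1,k)$ and $(n+1,k+1)$. A probability measure on the space of infinite paths is central if the measure of the cylinder of a finite path from the root depends only on its final vertex $v$ ($F_v$ denotes such a cylinder). Central measures $M$ ergodic with respect to tail equivalence correspond to indecomposable characters $\chi$ of the algebra $A=\bigcup_nA_n$ by $\chi|_{A_n}=\sum_vM(F_v)\chi_v$ (sum over vertices of level $n$, $\chi_v$ the irreducible character of $A_n$ indexed by $v$). Let $M_{\mathbb Y}$ correspond to the Thoma character of $S_\infty$ with parameters $(\alpha,0)$, and let $M^\delta_{\mathbb P}$ be the central ergodic measure on $\mathbb P$ concentrated on paths $((f,k_f))_f$ with $\lim k_f/f=\delta$. Then $\chi_{\alpha,0,\delta}$ corresponds to the central ergodic measure on $\tilde{\mathbb Y}$ with $M(F_{(n,\lambda)})=M_{\mathbb Y}(F_\lambda)\cdot M^\delta_{\mathbb P}(F_{(n,|\lambda|)})$.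
   Formalization: The weights are corrected to α'_1 = 1−δ, α'_i = δα_{i−1} for i>1 (δ and 1−δ interchanged); as printed the claim fails, e.g. for δ=1, α=(1/2,1/2,0,…), where S_∞ acts trivially but the character at a transposition is 1/2. *)

(* Defs.v *)
From HB Require Import structures.
From mathcomp Require Import all_boot all_order all_algebra all_fingroup.
From mathcomp Require Import ring_quotient mxrepresentation complex.
From mathcomp Require Import all_classical all_reals all_analysis.
From mathcomp Require Import measurable_realfun.

Set Implicit Arguments.
Unset Strict Implicit.
Unset Printing Implicit Defensive.
Import Order.TTheory GRing.Theory Num.Theory.
Import numFieldNormedType.Exports.

Local Open Scope classical_set_scope.
Local Open Scope ring_scope.
Local Open Scope complex_scope.

(* Positions are numbered from 0: R_n acts on {0, ..., n-1}. *)
Record Rinf := MkRinf {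
  rmap :> nat -> option nat;
  rmap_inj : forall i j k, rmap i = Some k -> rmap j = Some k -> i = j;
  rmap_fix : exists n, forall i, (n <= i)%N -> rmap i = Some i }.

(* An injective partial map fixing every i >= n sends {0, ..., n-1} to itself. *)
Definition in_Rn (n : nat) (s : Rinf) : Prop :=
  forall i, (n <= i)%N -> s i = Some i.

Definition in_Sinf (s : Rinf) : Prop := forall i, s i <> None.

Definition rone : Rinf.
Proof.
by exists (fun i => Some i) => [i j k [->] [->]//|]; exists 0%N.
Defined.

Definition rmul (s t : Rinf) : Rinf.
Proof.
exists (fun i => obind s (t i)) => [i j k|].
  case E : (t i) => [a|//] /= sa; case F : (t j) => [b|//] /= sb.
  by apply: (rmap_inj E); rewrite F (rmap_inj sa sb).
have [n sn] := rmap_fix s; have [m tm] := rmap_fix t.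
exists (maxn n m) => i; rewrite geq_max => /andP[ni mi].
by rewrite tm//= sn.
Defined.

(* [t] is the inverse of [s] as a partial map: the involution of C[R_oo]. *)
Definition rinverse (s t : Rinf) : Prop := forall i j, s i = Some j <-> t j = Some i.

Record young := Young {
  rows :> seq nat;
  _ : sorted geq rows && (0%N \notin rows) }.
HB.instance Definition _ := [isSub for rows].
HB.instance Definition _ := [Countable of young by <:].

Definition young0 : young := @Young [::] isT.
HB.instance Definition _ := isPointed.Build young young0.

Definition cells (l : young) : nat := sumn l.

Definition young_edge (l m : young) : Prop :=
  exists i, rows m = incr_nth l i.

Definition slow_edge (v w : nat * young) : Prop :=
  w.1 = v.1.+1 /\ (w.2 = v.2 \/ young_edge v.2 w.2).

Definition pascal_edge (v w : nat * nat) : Prop :=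
  w.1 = v.1.+1 /\ (w.2 = v.2 \/ w.2 = v.2.+1).

Definition coordinate_sets (V : Type) : set (set (nat -> V)) :=
  [set A | exists i v, A = [set x | x i = v]].

(* For countable V this is the Borel sigma-algebra of V^nat. *)
Definition seqspace (V : pointedType) : Type :=
  g_sigma_algebraType (@coordinate_sets V).
HB.instance Definition _ (V : pointedType) := Measurable.on (seqspace V).

Definition tail_eq (V : Type) (x y : nat -> V) : Prop :=
  exists n, forall i, (n <= i)%N -> x i = y i.

Section paths.
Context (R : realType) (V : pointedType) (root : V) (edge : V -> V -> Prop).

Definition path_upto (t : nat -> V) (n : nat) : Prop :=
  t 0%N = root /\ forall i, (i < n)%N -> edge (t i) (t i.+1).

Definition paths : set (seqspace V) := [set t | forall n, path_upto t n].

Definition path_cylinder (t : nat -> V) (n : nat) : set (seqspace V) :=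
  [set s | paths s /\ forall i, (i <= n)%N -> s i = t i].

(* [phi v] is M(F_v): the measure of the cylinder of any finite path from the
   root to v. The path space is realized as a subset of V^nat of full measure. *)
Definition central (M : probability (seqspace V) R) (phi : V -> R) : Prop :=
  M paths = 1%E /\
  forall t n, path_upto t n -> M (path_cylinder t n) = (phi (t n))%:E.

Definition tail_ergodic (M : probability (seqspace V) R) : Prop :=
  forall A : set (seqspace V), measurable A -> A `<=` paths ->
    (forall s t, A s -> paths t -> tail_eq s t -> A t) ->
    M A = 0%E \/ M A = 1%E.

End paths.

Section characters.
Context (R : realType).
Local Notation C := R[i].

(* The irreducible representations of the S_n over C indexed by the vertices of
   the Young graph; [rho n l] is meaningful only when l has n cells. *)
Record young_labelling (d : young -> nat)
    (rho : forall (n : nat) (l : young), mx_representation C [set: 'S_n]%G (d l)) :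
    Prop := {
  labelling_irr : forall n l, cells l = n -> mx_irreducible (rho n l);
  labelling_inj : forall n l m, cells l = n -> cells m = n ->
    mx_rsim (rho n l) (rho n m) -> l = m;
  labelling_surj : forall n e (r : mx_representation C [set: 'S_n]%G e),
    mx_irreducible r -> exists2 l, cells l = n & mx_rsim r (rho n l);
  labelling_branching : forall n m, cells m = n.+1 -> forall s : 'S_n,
    \tr (rho n.+1 m (lift_perm ord_max ord_max s)) =
    \sum_(l \in [set l | young_edge l m]) \tr (rho n l s) }.

(* Munn's irreducible representation of R_n attached to a representation r of S_k,
   k <= n: R_n permutes partially the k-subsets of {0, ..., n-1}, written here
   as increasing injections 'I_k -> 'I_n, and [munn_mx r s a b] is the block
   from a to b; it vanishes unless s maps the image of a onto the image of b,
   and is then r of the permutation t with s o a = b o t. As in mxrepresentation,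
   matrices act on row vectors and t * u is "t, then u" in 'S_k. *)
Definition increasing (k n : nat) (a : {ffun 'I_k -> 'I_n}) : bool :=
  [forall i : 'I_k, forall j : 'I_k, (i < j)%N ==> (a i < a j)%N].

Definition munn_mx (k n d : nat) (r : mx_representation C [set: 'S_k]%G d)
    (s : Rinf) (a b : {ffun 'I_k -> 'I_n}) : 'M[C]_d :=
  \sum_(t : 'S_k | [forall i : 'I_k, s (a i) == Some (b (t i) : nat)]) r t.

Definition munn_char (k n d : nat) (r : mx_representation C [set: 'S_k]%G d)
    (s : Rinf) : C :=
  \sum_(a : {ffun 'I_k -> 'I_n} | increasing a) \tr (munn_mx r s a a).

Definition power_sum (alpha : nat -> R) (k : nat) : R :=
  fine (\sum_(i <oo) (alpha i ^+ k)%:E)%E.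

(* The Thoma character with parameters (alpha, 0), restricted to S_n. *)
Definition thoma_char (alpha : nat -> R) (n : nat) (s : 'S_n) : R :=
  \prod_(c in porbits s | (1 < #|c|)%N) power_sum alpha #|c|.

Definition young_measure (alpha : nat -> R) (d : young -> nat)
    (rho : forall n l, mx_representation C [set: 'S_n]%G (d l))
    (phi : young -> R) : Prop :=
  exists2 M : probability (seqspace young) R,
    central young0 young_edge M phi /\ tail_ergodic young0 young_edge M &
    forall n (s : 'S_n), (thoma_char alpha s)%:C =
      \sum_(l \in [set l | cells l = n]) (phi l)%:C * \tr (rho n l s).

Definition pascal_measure (delta : R) (phi : nat * nat -> R) : Prop :=
  exists2 M : probability (seqspace (nat * nat)%type) R,
    central (0%N, 0%N) pascal_edge M phi /\ tail_ergodic (0%N, 0%N) pascal_edge M &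
    M [set t | (fun f => (t f).2%:R / f%:R : R) @ \oo --> delta] = 1%E.

(* chi is the character chi_{alpha,0,delta} of C[R_oo]; its restriction to C[R_n]
   is the sum over the vertices (n, l) of the n-th level. *)
Definition Rinf_character (alpha : nat -> R) (delta : R) (chi : Rinf -> C) : Prop :=
  exists (d : young -> nat)
    (rho : forall n l, mx_representation C [set: 'S_n]%G (d l))
    (phiY : young -> R) (phiP : nat * nat -> R) (phi : nat * young -> R)
    (M : probability (seqspace (nat * young)%type) R),
  [/\ young_labelling rho, young_measure alpha rho phiY,
      pascal_measure delta phiP,
      [/\ central (0%N, young0) slow_edge M phi,
          tail_ergodic (0%N, young0) slow_edge M &
          forall n l, (cells l <= n)%N -> phi (n, l) = phiY l * phiP (n, cells l)] &
      forall n s, in_Rn n s ->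
        chi s = \sum_(l \in [set l | (cells l <= n)%N])
                  (phi (n, l))%:C * munn_char n (rho (cells l) l) s].

End characters.

Section square_integrable.
Context d (T : measurableType d) (R : realType).
Variable mu : {measure set T -> \bar R}.
Local Notation C := R[i].

Definition L2pred : {pred T -> C} := [pred F : T -> C |
  ((fun x => complex.Re (F x)) \in Lfun mu 2%:E) &&
  ((fun x => complex.Im (F x)) \in Lfun mu 2%:E)].

Fact L2pred_submod : submod_closed L2pred.
Proof.
have S := @Lfun_submod_closed _ _ R mu 2%:E (lee1n 2).
split; first by apply/andP; split; exact: S.1.
move=> a F G /andP[Fr Fi] /andP[Gr Gi].
have S2 u v f g : f \in Lfun mu 2%:E -> g \in Lfun mu 2%:E ->
    (fun x => u * f x + v * g x : R) \in Lfun mu 2%:E.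
  move=> hf hg; have hg' : (v *: g + 0) \in Lfun mu 2%:E by apply: (S.2 v g 0 hg S.1).
  have -> : (fun x => u * f x + v * g x) = u *: f + (v *: g + 0).
    by apply/funext => x /=; rewrite addr0.
  exact: (S.2 u f (v *: g + 0) hf hg').
apply/andP; split.
  suff -> : (fun x => complex.Re ((a *: F + G) x)) = (fun x =>
      1 * (complex.Re a * complex.Re (F x) + (- complex.Im a) * complex.Im (F x))
      + 1 * complex.Re (G x)) by exact: S2 (S2 _ _ _ _ _ _) _.
  apply/funext => x; rewrite -[(a *: F + G) x]/(a * F x + G x).
  by case: a (F x) (G x) => [a1 a2] [f1 f2] [g1 g2] /=; rewrite !mul1r mulNr.
suff -> : (fun x => complex.Im ((a *: F + G) x)) = (fun x =>
    1 * (complex.Re a * complex.Im (F x) + complex.Im a * complex.Re (F x))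
    + 1 * complex.Im (G x)) by exact: S2 (S2 _ _ _ _ _ _) _.
apply/funext => x; rewrite -[(a *: F + G) x]/(a * F x + G x).
by case: a (F x) (G x) => [a1 a2] [f1 f2] [g1 g2] /=; rewrite !mul1r.
Qed.
HB.instance Definition _ := GRing.isSubmodClosed.Build C (T -> C) L2pred L2pred_submod.

Record L2fun := MkL2fun { L2val :> T -> C; _ : L2val \in L2pred }.
HB.instance Definition _ := [isSub for L2val].
HB.instance Definition _ := [Choice of L2fun by <:].
HB.instance Definition _ := [SubChoice_isSubLmodule of L2fun by <:].

Definition ae_zero : {pred L2fun} :=
  [pred F : L2fun | `[< {ae mu, forall x, F x = 0} >]].

Fact ae_zero_zmod : zmod_closed ae_zero.
Proof.
split; first by apply/asboolP; apply: aeW.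
move=> F G /asboolP F0 /asboolP G0; apply/asboolP.
by apply: filterS2 F0 G0 => x Fx Gx; rewrite -[LHS]/(F x - G x) Fx Gx subrr.
Qed.
HB.instance Definition _ := GRing.isZmodClosed.Build L2fun ae_zero ae_zero_zmod.

(* The complex Hilbert space L^2(T, mu). *)
Definition L2 : Type := @Quotient.quot L2fun ae_zero.
HB.instance Definition _ := GRing.Zmodule.on L2.
HB.instance Definition _ := EqQuotient.on L2.

Definition L2class (F : L2fun) : L2 := \pi_L2%qT F.
Definition L2repr (v : L2) : L2fun := generic_quotient.repr v.

Fact L2classK v : L2class (L2repr v) = v. Proof. exact: reprK. Qed.

Fact L2class_eq F G : (F - G \in ae_zero) = (L2class F == L2class G).
Proof. exact: Quotient.idealrBE. Qed.

Fact L2classD F G : L2class F + L2class G = L2class (F + G).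
Proof. by rewrite /L2class raddfD. Qed.

Definition L2scale (c : C) (v : L2) : L2 := L2class (c *: L2repr v).

Fact L2scaleE c F : L2scale c (L2class F) = L2class (c *: F).
Proof.
apply/eqP; rewrite -L2class_eq -scalerBr.
have : L2repr (L2class F) - F \in ae_zero by rewrite L2class_eq L2classK.
move=> /asboolP F0; apply/asboolP; apply: filterS F0 => x.
set G := _ - F => Gx.
by rewrite -[LHS]/(c * G x) Gx mulr0.
Qed.

Fact L2scaleA a b v : L2scale a (L2scale b v) = L2scale (a * b) v.
Proof. by rewrite -(L2classK v) !L2scaleE scalerA. Qed.

Fact L2scale1 : left_id 1 L2scale.
Proof. by move=> v; rewrite -(L2classK v) L2scaleE scale1r. Qed.

Fact L2scaleDr : right_distributive L2scale +%R.
Proof.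
move=> c v w; rewrite -(L2classK v) -(L2classK w).
by rewrite L2classD !L2scaleE L2classD scalerDr.
Qed.

Fact L2scaleDl v : {morph L2scale^~ v : a b / a + b}.
Proof.
by move=> a b; rewrite -(L2classK v) !L2scaleE L2classD scalerDl.
Qed.

HB.instance Definition _ := GRing.Zmodule_isLmodule.Build C L2
  L2scaleA L2scale1 L2scaleDr L2scaleDl.

(* Linear in the first argument, conjugate linear in the second one. *)
Definition L2dot (v w : L2) : C :=
  let h x := L2repr v x * (L2repr w x)^* in
  (\int[mu]_x complex.Re (h x)) +i* (\int[mu]_x complex.Im (h x)).

End square_integrable.

Section operators.
Context (R : realType) (H : lmodType R[i]) (dot : H -> H -> R[i]).
Local Notation C := R[i].

Definition bounded_operator (T : H -> H) : Prop :=
  linear T /\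
  exists k : R, forall v, dot (T v) (T v) <= (k ^+ 2)%:C * dot v v.

Definition adjoint (T U : H -> H) : Prop := forall v w, dot (T v) w = dot v (U w).

Definition commutant (S : set (H -> H)) : set (H -> H) :=
  [set T | bounded_operator T /\ forall U, S U -> T \o U = U \o T].

(* The von Neumann algebra generated by a set of operators that is closed under
   adjoints. *)
Definition vNalg (S : set (H -> H)) : set (H -> H) := commutant (commutant S).

Definition factor (N : set (H -> H)) : Prop :=
  forall T, N T -> commutant N T -> exists c : C, T = (fun v => c *: v).

Definition tracial_state (N : set (H -> H)) (tr : (H -> H) -> C) : Prop :=
  [/\ forall (c : C) T U, N T -> N U ->
        tr (fun v => c *: T v + U v) = c * tr T + tr U,
      tr id = 1,
      forall T U, N T -> N U -> adjoint T U -> 0 <= tr (U \o T) &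
      forall T U, N T -> N U -> tr (T \o U) = tr (U \o T)].

Definition star_representation (rep : Rinf -> H -> H) : Prop :=
  [/\ forall s, bounded_operator (rep s), rep rone = id,
      forall s t, rep (rmul s t) = rep s \o rep t &
      forall s t, rinverse s t -> adjoint (rep s) (rep t)].

(* rep is a factor representation, and its character is chi. A factor with a
   tracial state is finite, and then that state is its only tracial state; it is
   automatically normal and faithful. *)
Definition factor_representation_of (chi : Rinf -> C) (rep : Rinf -> H -> H) : Prop :=
  let N := vNalg [set rep s | s in setT] in
  [/\ star_representation rep, factor N &
      exists2 tr, tracial_state N tr & forall s, tr (rep s) = chi s].

End operators.

Definition tail_pairs : Type :=
  {p : seqspace nat * seqspace nat | tail_eq p.1 p.2}.

Fact tail_eq_refl (V : Type) (x : nat -> V) : tail_eq x x.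
Proof. by exists 0%N. Qed.

HB.instance Definition _ := gen_eqMixin tail_pairs.
HB.instance Definition _ := gen_choiceMixin tail_pairs.
HB.instance Definition _ := isPointed.Build tail_pairs
  (exist _ (fun=> 0%N, fun=> 0%N) (tail_eq_refl (fun=> 0%N))).

Definition tail_val : tail_pairs -> seqspace nat * seqspace nat := sval.

(* The space of pairs of sequences coinciding from some point on, with the
   sigma-algebra induced by that of pairs of sequences. *)
Definition tail_space : Type := g_sigma_algebra_preimageType tail_val.
HB.instance Definition _ := Measurable.on tail_space.

Section tail_measure.
Context (R : realType) (m : probability (seqspace nat) R).
Local Open Scope ereal_scope.

Definition fiber (x : seqspace nat) : set tail_space :=
  [set q | (tail_val q).1 = x].

(* The measure of A is the m-average over x of the number of pairs in A with first
   sequence x. The sequence that S_oo permutes has to be the averaged one: with the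
   roles exchanged, pairs whose first sequence contains a letter of weight zero
   would have positive measure, and S_oo need not generate a factor. *)
Definition tail_measure (A : set tail_space) : \bar R :=
  \int[m]_x \esum_(q in A `&` fiber x) 1.

Let splice (w : seq nat) (x : seqspace nat) : seqspace nat :=
  fun i => if (i < size w)%N then nth 0%N w i else x i.

Let tail_splice w x : tail_eq x (splice w x).
Proof.
by exists (size w) => i wi; rewrite /splice ltnNge wi.
Qed.

Let point_at w x : tail_space := exist _ (x, splice w x) (tail_splice w x).

Let word k : seq nat := odflt [::] (unpickle k).

Let reduced (x : seqspace nat) k : bool :=
  (pickle (word k) == k) &&
  ((word k == [::]) || (last 0%N (word k) != x (size (word k)).-1)).

Let measurable_coordinate (i v : nat) :
  measurable [set x : seqspace nat | x i = v].
Proof. by apply: sub_sigma_algebra; exists i, v. Qed.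

Let measurable_splice w : measurable_fun setT (splice w).
Proof.
apply: (@measurability _ _ (seqspace nat) (seqspace nat) setT (splice w)
  (@coordinate_sets nat)) => //.
move=> _ [_ [i [v ->]] <-]; rewrite setTI.
have [iw|iw] := boolP (i < size w)%N.
  rewrite (_ : _ @^-1` _ = [set x : seqspace nat | nth 0%N w i = v]).
    have [E|E] := eqVneq (nth 0%N w i) v.
      rewrite (_ : [set _ | _] = setT) //; by apply/seteqP; split.
    rewrite (_ : [set _ | _] = set0) //; apply/seteqP; split => // x /= /eqP.
    by rewrite (negbTE E).
  by apply/seteqP; split => x; rewrite /splice /= iw.
rewrite (_ : _ @^-1` _ = [set x : seqspace nat | x i = v]) //.
by apply/seteqP; split => x; rewrite /splice /= (negbTE iw).
Qed.

Let measurable_point_at w (A : set tail_space) : measurable A ->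
  measurable [set x | A (point_at w x)].
Proof.
case=> B mB <-.
have : measurable_fun setT (fun x : seqspace nat => (x, splice w x)).
  by apply: measurable_fun_pair.
move=> /(_ measurableT B mB); rewrite setTI.
congr measurable; apply/seteqP; split => x /=; first by [].
by case.
Qed.

Let measurable_reduced k : measurable [set x | reduced x k].
Proof.
rewrite /reduced; case: (pickle _ == k) => /=; last first.
  rewrite (_ : [set _ | _] = set0) //; by apply/seteqP; split.
case: (word k == [::]) => /=.
  rewrite (_ : [set _ | _] = setT) //; by apply/seteqP; split.
rewrite (_ : [set _ | _] = ~` [set x : seqspace nat |
    x (size (word k)).-1 = last 0%N (word k)]); first exact: measurableC.
apply/seteqP; split => x /=.
  by move=> /eqP + E; apply.
by move=> N; apply/eqP => E; apply: N.
Qed.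

Let indicator (A : set tail_space) k x : \bar R :=
  if `[< reduced x k /\ A (point_at (word k) x) >] then 1 else 0.

Let indicator_ge0 A k x : 0 <= indicator A k x.
Proof. by rewrite /indicator; case: ifP. Qed.

Let measurable_indicator A k : measurable A ->
  measurable_fun setT (indicator A k).
Proof.
move=> mA.
have mD : measurable [set x | reduced x k /\ A (point_at (word k) x)].
  by apply: measurableI; [exact: measurable_reduced|exact: measurable_point_at].
have -> : indicator A k = (fun x =>
    (\1_[set y | reduced y k /\ A (point_at (word k) y)] x)%:E).
  apply/funext => x; rewrite /indicator indicE.
  by case: asboolP => h; [rewrite mem_set|rewrite memNset].
by apply: measurableT_comp => //; exact: measurable_indic.
Qed.

Let splice_inj x v w : (size v < size w)%N -> last 0%N w != x (size w).-1 ->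
  splice v x = splice w x -> False.
Proof.
case: w => // a w /=; rewrite ltnS => vw /eqP lw /(congr1 (fun f => f (size w))).
rewrite /splice ltnNge vw /= ltnSn => E; apply: lw.
by rewrite (last_nth 0%N) -E.
Qed.

Let reduced_inj x k l : reduced x k -> reduced x l ->
  splice (word k) x = splice (word l) x -> k = l.
Proof.
move=> /andP[/eqP<- +] /andP[/eqP<-].
move: {k l}(word k) (word l) => v w rv rw E; congr pickle; move: rv rw E.
rewrite /word !pickleK /= => rv rw E.
have [vw|wv|vw] := ltngtP (size v) (size w).
- case/orP: rw => [/eqP w0|rw]; first by rewrite w0 in vw.
  by case: (splice_inj vw rw E).
- case/orP: rv => [/eqP v0|rv]; first by rewrite v0 in wv.
  by case: (splice_inj wv rv (esym E)).
- apply: (@eq_from_nth _ 0%N) => // i iv.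
  by have := congr1 (fun f => f i) E; rewrite /splice -vw iv.
Qed.

Let reduced_surj (q : tail_space) :
  exists2 k, reduced (tail_val q).1 k & point_at (word k) (tail_val q).1 = q.
Proof.
case: q => [[x y] /= xy].
have xyb : exists n, `[< forall i, (n <= i)%N -> x i = y i >].
  by case: xy => n h; exists n; exact/asboolP.
case: (ex_minnP xyb) => n /asboolP xyn n_min.
have wE : word (pickle (mkseq y n)) = mkseq y n by rewrite /word pickleK.
exists (pickle (mkseq y n)).
  rewrite /reduced wE eqxx /= size_mkseq; case: n xyn n_min {wE} => // n xyn n_min.
  apply/orP; right; rewrite -nth_last size_mkseq nth_mkseq //=.
  apply/eqP => E; suff : (n.+1 <= n)%N by rewrite ltnn.
  apply: n_min; apply/asboolP => i; rewrite leq_eqVlt => /orP[/eqP<-|]; first by rewrite E.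
  exact: xyn.
have E : splice (mkseq y n) x = y.
  apply/funext => i; rewrite /splice size_mkseq; case: ltnP => ni.
    by rewrite nth_mkseq.
  exact: xyn.
rewrite wE /point_at; move: (tail_splice _ _); rewrite E => h.
by congr exist; exact: Prop_irrelevance.
Qed.

Let fiber_sum A x :
  \esum_(q in A `&` fiber x) 1 = \sum_(k <oo) indicator A k x :> \bar R.
Proof.
rewrite nneseries_esumT; last by move=> k; exact: indicator_ge0.
pose D := [set k | reduced x k /\ A (point_at (word k) x)].
have -> : \esum_(k in [set: nat]) indicator A k x = \esum_(k in D) 1.
  rewrite [RHS]esum_mkcond; apply: eq_esum => k _; rewrite /indicator.
  by case: asboolP => h; [rewrite mem_set|rewrite memNset].
apply: (reindex_esum D (A `&` fiber x) (fun k => point_at (word k) x)).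
split.
- by move=> k [rk Ak].
- move=> k l /set_mem[rk _] /set_mem[rl _] E; apply: reduced_inj rk rl _.
  exact: (congr1 (fun q : tail_space => (tail_val q).2) E).
- move=> q [Aq qx]; have [k rk kE] := reduced_surj q.
  by rewrite qx in rk kE; exists k => //; split=> //; rewrite kE.
Qed.

Let measurable_fiber_sum A : measurable A ->
  measurable_fun setT (fun x => \esum_(q in A `&` fiber x) 1 : \bar R).
Proof.
move=> mA; have -> : (fun x => \esum_(q in A `&` fiber x) 1 : \bar R) =
    (fun x => \sum_(k <oo) indicator A k x).
  by apply/funext => x; exact: fiber_sum.
apply: ge0_emeasurable_sum => [k x _ _|k _]; first exact: indicator_ge0.
exact: measurable_indicator.
Qed.

Let tail_measure0 : tail_measure set0 = 0.
Proof.
rewrite /tail_measure; under eq_integral do rewrite set0I esum_set0.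
exact: integral0.
Qed.

Let tail_measure_ge0 A : 0 <= tail_measure A.
Proof. by apply: integral_ge0 => x _; exact: esum_ge0. Qed.

Let tail_measure_sigma_additive : semi_sigma_additive tail_measure.
Proof.
move=> F mF tF mU; rewrite [X in _ --> X](_ : _ = \sum_(n <oo) tail_measure (F n)).
  by apply: is_cvg_nneseries => n _ _; exact: tail_measure_ge0.
rewrite /tail_measure -integral_nneseries//.
- apply: eq_integral => x _; rewrite setI_bigcupl esum_bigcupT//.
    rewrite nneseries_esumT// => n; exact: esum_ge0.
  by apply: trivIset_setIr.
- by move=> n; exact: measurable_fiber_sum.
- by move=> n x _; exact: esum_ge0.
Qed.

HB.instance Definition _ := isMeasure.Build _ tail_space R tail_measure
  tail_measure0 tail_measure_ge0 tail_measure_sigma_additive.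

End tail_measure.

Fact tail_eq_comp (x y : nat -> nat) (s : Rinf) : tail_eq x y ->
  tail_eq (fun i => x (odflt i (s i))) y.
Proof.
move=> [n xy]; have [m sm] := rmap_fix s; exists (maxn n m) => i.
by rewrite geq_max => /andP[ni mi]; rewrite sm//=; exact: xy.
Qed.

(* For a permutation s, the sequence s^-1 x has i-th term x (s i). *)
Definition permute_first (s : Rinf) (q : tail_space) : tail_space :=
  exist _ (fun i => (tail_val q).1 (odflt i (s i)), (tail_val q).2)
    (tail_eq_comp s (svalP q)).

Section realization.
Context (R : realType).
Local Notation C := R[i].

Definition product_measure (a : nat -> R) (m : probability (seqspace nat) R) : Prop :=
  forall (n : nat) (w : nat -> nat),
    m [set x | forall i, (i < n)%N -> x i = w i] = (\prod_(i < n) a (w i))%:E.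

Definition L2tail (m : probability (seqspace nat) R) : lmodType C :=
  L2 (tail_measure m).

(* rep extends the action (s f)(x, y) = f (s^-1 x, y) of S_oo on L^2. *)
Definition extends_permutation_action (m : probability (seqspace nat) R)
    (rep : Rinf -> L2tail m -> L2tail m) : Prop :=
  forall s, in_Sinf s -> forall f : L2tail m,
    {ae tail_measure m, forall q,
      L2repr (rep s f) q = L2repr f (permute_first s q)}.

(* The letter 0 has weight 1 - delta: it is the letter which the idempotents of
   R_oo detect, and the value of chi_{alpha,0,delta} at the idempotent that is
   undefined at one point is M(F_(1, empty)) = 1 - delta. *)
Definition extended_weights (alpha : nat -> R) (delta : R) (i : nat) : R :=
  if i is j.+1 then delta * alpha j else 1 - delta.

End realization.

(* Main.v *)
(** A partial injection s acts on functions on pairs by (s f)(x, y) = f(s^-1 x, y), where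
    s^-1 x carries the letter 0 at the positions where s is undefined, and where the value is
    0 unless x itself carries the letter 0 at the positions missed by s.

    Let N be the von Neumann algebra generated by these operators and xi the indicator of the
    diagonal.  The partial isometries that overwrite an initial block of the second sequence
    commute with N and carry xi to the indicators of all basic cylinders, so an element T of N
    is determined by T xi.  If T is central, T xi is invariant under simultaneous permutations
    of both sequences; moving a cylinder to infinitely many disjoint blocks of coordinates then
    shows that T xi is a multiple of xi, so N is a factor.  The vector state T |-> <T xi, xi>
    is a trace: multiplication by the indicator of the pairs whose two sequences contain every
    letter equally often lies in the commutant of N and fixes xi, and on such pairs the
    exchange of the two sequences preserves the measure.

    The value of that state at s is the probability that a random sequence is fixed by s, in
    the sense that x = s^-1 x and x carries 0 where s or s^-1 is undefined.  Let k be the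
    number of the first n letters of x that are nonzero: s permutes their positions, and each
    cycle of length p contributes the sum of the (delta alpha_i)^p, while the other positions
    contribute (1 - delta)^(n-k).  This is Munn's formula for the characters of R_n, combined
    with the Thoma character on S_k and with the weight delta^k (1 - delta)^(n-k) of the vertex
    (n, k) of the Pascal graph. *)

Require Import Defs.
From HB Require Import structures.
From mathcomp Require Import all_boot all_order all_algebra all_fingroup.
From mathcomp Require Import mxrepresentation complex.
From mathcomp Require Import finmap.
From mathcomp Require Import all_classical all_reals all_analysis.
From mathcomp Require Import measurable_realfun.
From mathcomp Require Import lra ring.

Set Implicit Arguments.
Unset Strict Implicit.
Unset Printing Implicit Defensive.
Import Order.TTheory GRing.Theory Num.Theory.
Import numFieldNormedType.Exports.

Local Open Scope classical_set_scope.
Local Open Scope ring_scope.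
Local Open Scope complex_scope.

(** * Bounded operators given by partial isomorphisms of the measure space *)

(** The measure of a basic cylinder depends only on its first word ([measure_pair_cyl]), and this
    asymmetry shapes the proof. A bijective change of finitely many letters of the second sequence
    preserves the measure, which makes the commutant large enough to reach every cylinder from xi. A
    change of the first sequence must keep the multiset of letters when the weights are general.
    Filling the undefined positions with the letter 0 achieves this for partial injections, since s
    and its inverse are undefined at equally many positions; the exchange of the two sequences
    achieves it on balanced pairs only.

    All these operators compose with a measure-preserving bijection between two measurable sets and
    extend by zero, so boundedness, adjoints and products are proved once. An identity between
    bounded operators or functionals needs to be checked on cylinders only, because the vectors
    satisfying it form a closed subspace.

    The probability of being fixed is an infinite sum over words. It is computed in a finite
    alphabet, where it is a finite combinatorial identity, and the alphabet then grows. *)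

Section complex_functions.
Context d (T : measurableType d) (R : realType).
Variable mu : {measure set T -> \bar R}.
Local Notation C := R[i].

Definition cmeasurable (f : T -> C) : Prop :=
  measurable_fun setT (fun x => complex.Re (f x)) /\
  measurable_fun setT (fun x => complex.Im (f x)).

Definition sqnorm (z : C) : R := complex.Re z ^+ 2 + complex.Im z ^+ 2.

Lemma sqnorm_ge0 z : 0 <= sqnorm z.
Proof. by rewrite addr_ge0// sqr_ge0. Qed.

Lemma sqnorm_mulconj (z : C) : z * (conjc z) = (sqnorm z)%:C.
Proof.
by case: z => a b; rewrite /sqnorm; apply/eqP; rewrite eq_complex /=; apply/andP; split; apply/eqP; ring.
Qed.

Lemma Lfun2P (f : T -> R) : f \in Lfun mu 2%:E <->
  measurable_fun setT f /\ (\int[mu]_x (f x ^+ 2)%:E < +oo)%E.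
Proof.
split=> [fL|[mf foo]].
  split; first by move: fL; rewrite inE => /andP[/[!inE]].
  exact: integrable_lty (Lfun2_integrable_sqr fL).
rewrite inE; apply/andP; split; rewrite inE //= /finite_norm unlock.
rewrite poweR_lty//; apply: le_lt_trans foo.
rewrite le_eqVlt; apply/orP; left; apply/eqP; apply: eq_integral => x _.
by rewrite /= powR_mulrn// real_normK// num_real.
Qed.

Lemma measurable_sqnorm f : cmeasurable f -> measurable_fun setT (fun x => sqnorm (f x)).
Proof. by move=> [mr mi]; apply: measurable_funD; apply: measurable_funX. Qed.

Lemma L2predP f : f \in L2pred mu <->
  cmeasurable f /\ (\int[mu]_x (sqnorm (f x))%:E < +oo)%E.
Proof.
split.
  move=> /andP[/Lfun2P[mr ir] /Lfun2P[mi ii]]; split=> //.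
  under eq_integral do rewrite EFinD.
  rewrite ge0_integralD//; first exact: lte_add_pinfty.
  - by move=> x _; rewrite lee_fin sqr_ge0.
  - by apply/measurable_EFinP; exact: measurable_funX.
  - by move=> x _; rewrite lee_fin sqr_ge0.
  - by apply/measurable_EFinP; exact: measurable_funX.
move=> [mf foo]; case: (mf) => mr mi.
have ms : measurable_fun setT (fun x => (sqnorm (f x))%:E).
  by apply/measurable_EFinP; exact: measurable_sqnorm.
apply/andP; split; apply/Lfun2P; split => //; apply: le_lt_trans foo.
  apply: ge0_le_integral => //.
  - by move=> x _; rewrite lee_fin sqr_ge0.
  - by apply/measurable_EFinP; exact: measurable_funX.
  - by move=> x _; rewrite lee_fin /sqnorm lerDl sqr_ge0.
apply: ge0_le_integral => //.
- by move=> x _; rewrite lee_fin sqr_ge0.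
- by apply/measurable_EFinP; exact: measurable_funX.
- by move=> x _; rewrite lee_fin /sqnorm lerDr sqr_ge0.
Qed.

(** The integral inside [L2dot], isolated so that inner products can be computed on any
    representatives. *)
Definition cint (h : T -> C) : C :=
  (\int[mu]_x complex.Re (h x)) +i* (\int[mu]_x complex.Im (h x)).

Definition cintegrable (h : T -> C) : Prop :=
  mu.-integrable setT (EFin \o (fun x => complex.Re (h x))) /\
  mu.-integrable setT (EFin \o (fun x => complex.Im (h x))).

Lemma integrable_lin (a : R) (f g : T -> R) :
  mu.-integrable setT (EFin \o f) -> mu.-integrable setT (EFin \o g) ->
  mu.-integrable setT (EFin \o (fun x => a * f x + g x)).
Proof.
move=> hf hg.
exact: (@integrableD _ _ _ _ _ measurableT _ _ (integrableZl measurableT a hf) hg).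
Qed.

Lemma Rintegral_lin (a : R) (f g : T -> R) :
  mu.-integrable setT (EFin \o f) -> mu.-integrable setT (EFin \o g) ->
  \int[mu]_x (a * f x + g x) = a * \int[mu]_x f x + \int[mu]_x g x.
Proof.
move=> hf hg; rewrite RintegralD//; last exact: (integrableZl measurableT a hf).
by rewrite RintegralZl.
Qed.

Lemma cintZD (a : C) (f g : T -> C) : cintegrable f -> cintegrable g ->
  cint (fun x => a * f x + g x) = a * cint f + cint g.
Proof.
move=> [fr fi] [gr gi]; apply/eqP; rewrite eq_complex; apply/andP; split; apply/eqP.
  transitivity (\int[mu]_x (complex.Re a * complex.Re (f x) +
      (- complex.Im a * complex.Im (f x) + complex.Re (g x)))).
    by apply: eq_Rintegral => x _; case: a (f x) (g x) => [? ?] [? ?] [? ?] /=; ring.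
  rewrite !Rintegral_lin//; last exact: integrable_lin.
  by rewrite /cint; case: a => /= ? ?; ring.
transitivity (\int[mu]_x (complex.Re a * complex.Im (f x) +
    (complex.Im a * complex.Re (f x) + complex.Im (g x)))).
  by apply: eq_Rintegral => x _; case: a (f x) (g x) => [? ?] [? ?] [? ?] /=; ring.
rewrite !Rintegral_lin//; last exact: integrable_lin.
by rewrite /cint; case: a => /= ? ?; ring.
Qed.

Lemma cint_conj (f : T -> C) : cintegrable f -> cint (fun x => (conjc (f x))) = (conjc (cint f)).
Proof.
move=> [fr fi]; rewrite /cint /=; apply/eqP; rewrite eq_complex /=; apply/andP; split; apply/eqP.
  by apply: eq_Rintegral => x _; case: (f x).
transitivity (\int[mu]_x (-1 * complex.Im (f x))).
  by apply: eq_Rintegral => x _; case: (f x) => a b /=; rewrite mulN1r.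
by rewrite RintegralZl// mulN1r.
Qed.

Lemma ae_eq_cint (f g : T -> C) : cmeasurable f -> cmeasurable g ->
  {ae mu, forall x, f x = g x} -> cint f = cint g.
Proof.
move=> [fr fi] [gr gi] fg; rewrite /cint /Rintegral; congr (fine _ +i* fine _).
  apply: ae_eq_integral => //; try exact/measurable_EFinP.
  by apply: filterS fg => x E _; rewrite E.
apply: ae_eq_integral => //; try exact/measurable_EFinP.
by apply: filterS fg => x E _; rewrite E.
Qed.

Lemma cmeasurableM (f g : T -> C) : cmeasurable f -> cmeasurable g ->
  cmeasurable (fun x => f x * g x).
Proof.
move=> [fr fi] [gr gi]; split.
  rewrite (_ : (fun _ => _) = (fun x => complex.Re (f x) * complex.Re (g x) - complex.Im (f x) * complex.Im (g x))).
    by apply: measurable_funB; apply: measurable_funM.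
  by apply/funext => x; case: (f x) (g x) => ? ? [].
rewrite (_ : (fun _ => _) = (fun x => complex.Re (f x) * complex.Im (g x) + complex.Im (f x) * complex.Re (g x))).
  by apply: measurable_funD; apply: measurable_funM.
by apply/funext => x; case: (f x) (g x) => ? ? [].
Qed.

Lemma cmeasurable_conj (f : T -> C) : cmeasurable f -> cmeasurable (fun x => (conjc (f x))).
Proof.
move=> [fr fi]; split.
  rewrite (_ : (fun _ => _) = (fun x => complex.Re (f x)))//.
  by apply/funext => x; case: (f x).
rewrite (_ : (fun _ => _) = (fun x => - complex.Im (f x))).
  exact: measurable_funN.
by apply/funext => x; case: (f x).
Qed.

Lemma cintegrable_mulconj (f g : T -> C) : f \in L2pred mu -> g \in L2pred mu ->
  cintegrable (fun x => f x * (conjc (g x))).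
Proof.
move=> /andP[fr fi] /andP[gr gi].
have I (u v : T -> R) : u \in Lfun mu 2%:E -> v \in Lfun mu 2%:E ->
    mu.-integrable setT (EFin \o (fun x => u x * v x)).
  by move=> hu hv; apply/Lfun1_integrable; exact: Lfun2_mul_Lfun1.
split.
  rewrite (_ : (fun x => _) = (fun x => 1 * (complex.Re (f x) * complex.Re (g x)) +
      complex.Im (f x) * complex.Im (g x))); first by apply: integrable_lin; exact: I.
  by apply/funext => x /=; case: (f x) (g x) => ? ? [? ?] /=; ring.
rewrite (_ : (fun x => _) = (fun x => -1 * (complex.Re (f x) * complex.Im (g x)) +
    complex.Im (f x) * complex.Re (g x))); first by apply: integrable_lin; exact: I.
by apply/funext => x /=; case: (f x) (g x) => ? ? [? ?] /=; ring.
Qed.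

End complex_functions.

(** * Inner product and norm through square-integrable representatives *)

Section L2_classes.
Context d (T : measurableType d) (R : realType).
Variable mu : {measure set T -> \bar R}.
Local Notation C := R[i].
Local Notation H := (L2 mu).
Local Notation dot := (@L2dot _ _ _ mu).

(** Total by a default: a function that is not square integrable gets the class of 0, so the lemmas
    about [L2of] carry membership in [L2pred]. *)
Definition L2of (f : T -> C) : H := L2class (insubd (0 : L2fun mu) f).

Lemma L2repr_pred (v : H) : (L2repr v : T -> C) \in L2pred mu.
Proof. exact: valP (L2repr v). Qed.

Lemma L2of_repr (v : H) : L2of (L2repr v) = v.
Proof. by rewrite /L2of valKd L2classK. Qed.

Lemma L2ind (P : H -> Prop) : (forall f, f \in L2pred mu -> P (L2of f)) -> forall v, P v.
Proof. by move=> h v; rewrite -(L2of_repr v); apply: h; exact: L2repr_pred. Qed.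

Lemma L2reprK f : f \in L2pred mu -> {ae mu, forall x, L2repr (L2of f) x = f x}.
Proof.
move=> fL; have : L2repr (L2of f) - insubd (0 : L2fun mu) f \in ae_zero (mu := mu).
  by rewrite L2class_eq L2classK.
move=> /asboolP; apply: filterS => x.
rewrite -[X in X = _ -> _]/(L2repr (L2of f) x - L2val (insubd (0 : L2fun mu) f) x).
have -> : L2val (insubd (0 : L2fun mu) f) = f by rewrite -[LHS]/(val _) insubdK.
by move=> /subr0_eq.
Qed.

Lemma L2of_eq f g : f \in L2pred mu -> g \in L2pred mu ->
  {ae mu, forall x, f x = g x} -> L2of f = L2of g.
Proof.
move=> fL gL fg; apply/eqP; rewrite /L2of -L2class_eq; apply/asboolP.
apply: filterS fg => x fg.
rewrite -[LHS]/(val (insubd (0 : L2fun mu) f) x - val (insubd (0 : L2fun mu) g) x).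
by rewrite !insubdK// fg subrr.
Qed.

Lemma L2of_lin (a : C) f g : f \in L2pred mu -> g \in L2pred mu ->
  L2of (fun x => a * f x + g x) = a *: L2of f + L2of g.
Proof.
move=> fL gL; rewrite -[a *: _]/(L2scale a _) /L2of L2scaleE L2classD.
congr L2class; apply: val_inj => /=.
rewrite -[LHS]/(val (insubd (0 : L2fun mu) (fun x => a * f x + g x))).
rewrite insubdK; last exact: (@L2pred_submod _ _ _ mu).2.
rewrite -[RHS]/(a *: (val (insubd (0 : L2fun mu) f) : T -> C) + val (insubd (0 : L2fun mu) g)).
by rewrite !insubdK.
Qed.

Lemma L2pred_lin (a : C) f g : f \in L2pred mu -> g \in L2pred mu ->
  (fun x => a * f x + g x) \in L2pred mu.
Proof. by move=> fL gL; exact: (@L2pred_submod _ _ _ mu).2. Qed.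

Lemma L2pred0 : (fun=> 0 : C) \in L2pred mu.
Proof. exact: (@L2pred_submod _ _ _ mu).1. Qed.

Lemma L2of0 : L2of (fun=> 0) = 0.
Proof.
have := L2of_lin 1 L2pred0 L2pred0.
have -> : (fun _ : T => 1 * 0 + 0 : C) = (fun _ => 0) by apply/funext => x; rewrite mulr0 addr0.
by rewrite scale1r -[X in X = _ -> _]addr0 => /addrI/esym.
Qed.

Lemma L2dotE f g : f \in L2pred mu -> g \in L2pred mu ->
  dot (L2of f) (L2of g) = cint mu (fun x => f x * (conjc (g x))).
Proof.
move=> fL gL; rewrite /L2dot; apply: (@ae_eq_cint _ _ _ mu (fun x => L2repr (L2of f) x * (conjc (L2repr (L2of g) x)))).
- apply: cmeasurableM; last apply: cmeasurable_conj.
    by have /L2predP[] := L2repr_pred (L2of f).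
  by have /L2predP[] := L2repr_pred (L2of g).
- apply: cmeasurableM; last apply: cmeasurable_conj.
    by have /L2predP[] := fL.
  by have /L2predP[] := gL.
- by apply: filterS2 (L2reprK fL) (L2reprK gL) => x -> ->.
Qed.

Lemma L2dotZDl (a : C) (u v w : H) : dot (a *: u + v) w = a * dot u w + dot v w.
Proof.
elim/L2ind: u => f fL; elim/L2ind: v => g gL; elim/L2ind: w => h hL.
rewrite -L2of_lin// !L2dotE//; last exact: L2pred_lin.
rewrite -cintZD; try exact: cintegrable_mulconj.
by congr cint; apply/funext => x; rewrite mulrDl mulrA.
Qed.

Lemma L2dotC (u v : H) : dot u v = (conjc (dot v u)).
Proof.
elim/L2ind: u => f fL; elim/L2ind: v => g gL.
rewrite !L2dotE// -cint_conj; last exact: cintegrable_mulconj.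
by congr cint; apply/funext => x; rewrite rmorphM /= conjcK mulrC.
Qed.

Lemma L2dot_sqnorm f : f \in L2pred mu ->
  dot (L2of f) (L2of f) = (\int[mu]_x sqnorm (f x))%:C.
Proof.
move=> fL; rewrite L2dotE// /cint; apply/eqP; rewrite eq_complex /=; apply/andP; split; apply/eqP.
  by apply: eq_Rintegral => x _; rewrite sqnorm_mulconj.
under eq_Rintegral do rewrite sqnorm_mulconj/=.
by rewrite Rintegral_cst//= !mul0r.
Qed.

Lemma L2dot_ge0 (v : H) : 0 <= dot v v.
Proof.
elim/L2ind: v => f fL; rewrite L2dot_sqnorm// lecR.
by apply: Rintegral_ge0 => x _; exact: sqnorm_ge0.
Qed.

Lemma L2dot_eq0 (v : H) : dot v v = 0 -> v = 0.
Proof.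
elim/L2ind: v => f fL; rewrite L2dot_sqnorm// => /complexI/eqP.
have [mf foo] := (L2predP mu f).1 fL.
have i0 : (0 <= \int[mu]_x (sqnorm (f x))%:E)%E.
  by apply: integral_ge0 => x _; rewrite lee_fin sqnorm_ge0.
rewrite /Rintegral fine_eq0; last by rewrite ge0_fin_numE.
move=> /eqP E; rewrite -L2of0; apply: L2of_eq => //; first exact: L2pred0.
have : (\int[mu]_x `| (sqnorm (f x))%:E | = 0)%E.
  by rewrite -E; apply: eq_integral => x _; rewrite gee0_abs ?lee_fin ?sqnorm_ge0.
move=> /ae_eq_integral_abs; move=> /(_ measurableT).
have ms : measurable_fun setT (fun x => (sqnorm (f x))%:E).
  by apply/measurable_EFinP; exact: measurable_sqnorm.
move=> /(_ ms).
apply: filterS => x /(_ I) [] /eqP; rewrite /sqnorm paddr_eq0 ?sqr_ge0// !sqrf_eq0.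
by case: (f x) => a b /= /andP[/eqP-> /eqP->].
Qed.

Definition nsq (v : H) : R := complex.Re (dot v v).

(** Positivity in the order of R[i] forces the imaginary part to vanish. *)
Lemma nsqE v : dot v v = (nsq v)%:C.
Proof. by rewrite /nsq; have := L2dot_ge0 v; case: (dot v v) => a b; rewrite lecE /= => /andP[/eqP->]. Qed.

Lemma nsq_ge0 v : 0 <= nsq v.
Proof. by have := L2dot_ge0 v; rewrite nsqE lecR. Qed.

Lemma nsq_eq0 v : nsq v = 0 -> v = 0.
Proof. by move=> h; apply: L2dot_eq0; rewrite nsqE h. Qed.

Lemma nsq_L2of f : f \in L2pred mu -> nsq (L2of f) = \int[mu]_x sqnorm (f x).
Proof. by move=> fL; apply: complexI; rewrite -nsqE L2dot_sqnorm. Qed.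

Lemma L2dotZDr (a : C) (u v w : H) : dot w (a *: u + v) = (conjc a) * dot w u + dot w v.
Proof. by rewrite L2dotC L2dotZDl rmorphD rmorphM /= (L2dotC w u) (L2dotC w v). Qed.

Lemma L2dot0l v : dot 0 v = 0.
Proof.
have := L2dotZDl 1 0 0 v; rewrite scale1r addr0 mul1r.
by rewrite -[X in X = _ -> _]addr0 => /addrI/esym.
Qed.

Lemma L2dot0r v : dot v 0 = 0.
Proof. by rewrite L2dotC L2dot0l conjc0. Qed.

Lemma L2dotDl u v w : dot (u + v) w = dot u w + dot v w.
Proof. by rewrite -[u in LHS]scale1r L2dotZDl mul1r. Qed.

Lemma L2dotZl (a : C) u v : dot (a *: u) v = a * dot u v.
Proof. by rewrite -[a *: u]addr0 L2dotZDl L2dot0l addr0. Qed.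

Lemma L2dotDr u v w : dot w (u + v) = dot w u + dot w v.
Proof. by rewrite -[u in LHS]scale1r L2dotZDr rmorph1 mul1r. Qed.

Lemma L2dotZr (a : C) u v : dot v (a *: u) = (conjc a) * dot v u.
Proof. by rewrite -[a *: u]addr0 L2dotZDr L2dot0r addr0. Qed.

Lemma L2dotBl u v w : dot (u - v) w = dot u w - dot v w.
Proof. by rewrite -scaleN1r L2dotDl L2dotZl mulN1r. Qed.

Lemma L2dotBr u v w : dot w (u - v) = dot w u - dot w v.
Proof. by rewrite -scaleN1r L2dotDr L2dotZr rmorphN rmorph1 mulN1r. Qed.

Lemma nsqZ (a : C) v : nsq (a *: v) = sqnorm a * nsq v.
Proof.
by apply: complexI; rewrite -nsqE L2dotZl L2dotZr mulrA sqnorm_mulconj nsqE rmorphM.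
Qed.

(** Parallelogram law with the term [nsq (u - v)] dropped; it serves as a triangle inequality
    without square roots. *)
Lemma nsqD u v : nsq (u + v) <= 2 * nsq u + 2 * nsq v.
Proof.
have : 0 <= nsq (u - v) by exact: nsq_ge0.
rewrite -!lecR => h; have {h} : (nsq (u + v))%:C + 0 <= (nsq (u + v))%:C + (nsq (u - v))%:C by rewrite lerD2l.
rewrite addr0; congr (_ <= _).
rewrite rmorphD !rmorphM /= [in RHS](_ : 2%:C = 2 :> C) ?rmorph_nat// -!nsqE L2dotBl !L2dotBr L2dotDl !L2dotDr; ring.
Qed.

(** For nonzero v, expand the square of the component of u orthogonal to v, scaled by [nsq v] to
    avoid a division. *)
Lemma CauchySchwarz u v : sqnorm (dot u v) <= nsq u * nsq v.
Proof.
have [v0|v0] := eqVneq (nsq v) 0.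
  by rewrite (nsq_eq0 v0) L2dot0r /sqnorm /= /nsq L2dot0l /= expr0n /= addr0 mulr0.
have vp : 0 < nsq v by rewrite lt0r v0 nsq_ge0.
rewrite -subr_ge0 -(pmulr_rge0 _ vp) -lecR.
have := L2dot_ge0 ((nsq v)%:C *: u - dot u v *: v).
congr (_ <= _); rewrite L2dotBl !L2dotBr !L2dotZl !L2dotZr.
rewrite (L2dotC v u) !nsqE conjc_real.
move: (dot u v) (nsq u) (nsq v) => z a b.
rewrite rmorphM rmorphB rmorphM /= -sqnorm_mulconj; ring.
Qed.

Lemma L2pred_conj f : f \in L2pred mu -> (fun x => (conjc (f x))) \in L2pred mu.
Proof.
move=> /L2predP[mf foo]; apply/L2predP; split; first exact: cmeasurable_conj.
move: foo; congr (_ < _)%E; apply: eq_integral => x _; case: (f x) => a b.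
by rewrite /sqnorm /= sqrrN.
Qed.

Definition L2conj (v : H) : H := L2of (fun x => (conjc (L2repr v x))).

Lemma L2conj_of f : f \in L2pred mu -> L2conj (L2of f) = L2of (fun x => (conjc (f x))).
Proof.
move=> fL; apply: L2of_eq.
- by apply: L2pred_conj; exact: L2repr_pred.
- exact: L2pred_conj.
- by apply: filterS (L2reprK fL) => x ->.
Qed.

(** Both sides are the integral of u v, a symmetric bilinear form. *)
Lemma L2conj_dot u v : dot u (L2conj v) = dot v (L2conj u).
Proof.
elim/L2ind: u => f fL; elim/L2ind: v => g gL.
rewrite !L2conj_of// !L2dotE//; try exact: L2pred_conj.
by congr cint; apply/funext => x; rewrite !conjcK mulrC.
Qed.

End L2_classes.

(** * Pull-back operators of measure-preserving partial bijections *)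

Section partial_isomorphisms.
Context d (T : measurableType d) (R : realType).
Variable mu : {measure set T -> \bar R}.
Local Notation C := R[i].
Local Notation H := (L2 mu).
Local Notation dot := (@L2dot _ _ _ mu).

(** A measure-preserving bijection of D onto D' with inverse G. Both maps are total and measurable
    everywhere, but are constrained on D and D' only; the last field says that F carries the
    restriction of mu to D to its restriction to D'. *)
Record partial_iso (D : set T) (F : T -> T) (D' : set T) (G : T -> T) : Prop := PartialIso {
  piso_mD : measurable D;
  piso_mD' : measurable D';
  piso_mF : measurable_fun setT F;
  piso_mG : measurable_fun setT G;
  piso_F : forall q, D q -> D' (F q);
  piso_G : forall q, D' q -> D (G q);
  piso_GF : forall q, D q -> G (F q) = q;
  piso_FG : forall q, D' q -> F (G q) = q;
  piso_mu : forall A, measurable A -> mu (D `&` F @^-1` A) = mu (D' `&` A) }.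

Lemma partial_iso_sym D F D' G : partial_iso D F D' G -> partial_iso D' G D F.
Proof.
case=> mD mD' mF mG DF DG GF FG muE; split => // A mA.
have mGA : measurable (G @^-1` A) by rewrite -[_ @^-1` _]setTI; exact: mG.
rewrite -muE//; congr (mu _); apply/seteqP; split => q /= [Dq]; rewrite ?GF//.
Qed.

Definition extend0 (D : set T) (f : T -> C) q : C := if `[< D q >] then f q else 0.

Lemma cmeasurable_extend0 D f : measurable D -> cmeasurable f -> cmeasurable (extend0 D f).
Proof.
move=> mD [mr mi]; split.
  rewrite (_ : (fun _ => _) = (fun q => complex.Re (f q) * \1_D q)).
    by apply: measurable_funM => //; exact: measurable_indic.
  apply/funext => q; rewrite /extend0 indicE.
  by case: asboolP => h; [rewrite mem_set// mulr1|rewrite memNset// mulr0].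
rewrite (_ : (fun _ => _) = (fun q => complex.Im (f q) * \1_D q)).
  by apply: measurable_funM => //; exact: measurable_indic.
apply/funext => q; rewrite /extend0 indicE.
by case: asboolP => h; [rewrite mem_set// mulr1|rewrite memNset// mulr0].
Qed.

Lemma cmeasurable_comp (f : T -> C) (F : T -> T) : cmeasurable f -> measurable_fun setT F ->
  cmeasurable (f \o F).
Proof. by move=> [mr mi] mF; split; [exact: (measurableT_comp mr mF)|exact: (measurableT_comp mi mF)]. Qed.

Lemma ge0_integral_mrestr E (mE : measurable E) (h : T -> \bar R) :
  measurable_fun setT h -> (forall q, 0 <= h q)%E ->
  (\int[mrestr mu mE]_q h q = \int[mu]_(q in E) h q)%E.
Proof.
move=> mh h0.
have mC : measurable (~` E) by exact: measurableC.
rewrite [LHS](ge0_negligible_integral mC)//; last first.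
  by rewrite /= /mrestr setICl measure0.
rewrite setDE setTI setCK; apply: eq_measure_integral => A mA AE.
by rewrite /= /mrestr setIidl.
Qed.

Lemma ge0_integral_partial_iso D F D' G (h : T -> \bar R) : partial_iso D F D' G ->
  measurable_fun setT h -> (forall q, 0 <= h q)%E ->
  (\int[mu]_(q in D) h (F q) = \int[mu]_(q in D') h q)%E.
Proof.
move=> [mD mD' mF mG DF DG GF FG muE] mh h0.
rewrite -(ge0_integral_mrestr mD' mh h0).
apply: etrans (esym (ge0_integral_mrestr mD (measurableT_comp mh mF) (fun q => h0 (F q)))) _.
rewrite -[LHS]/(\int[mrestr mu mD]_(q in F @^-1` setT) (h \o F) q)%E.
rewrite -ge0_integral_pushforward//.
apply: eq_measure_integral => A mA _.
by rewrite /= /pushforward /mrestr setIC [RHS](_ : _ = mu (D' `&` A)) ?muE// setIC.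
Qed.

Lemma integral_partial_iso D F D' G (h : T -> \bar R) : partial_iso D F D' G ->
  measurable_fun setT h ->
  (\int[mu]_(q in D) h (F q) = \int[mu]_(q in D') h q)%E.
Proof.
move=> P mh; rewrite integralE [RHS]integralE.
congr (_ - _)%E.
  have p0 q : (0 <= h^\+ q)%E by exact: funepos_ge0.
  rewrite -(ge0_integral_partial_iso P (measurable_funepos mh) p0).
  by apply: eq_integral => q _; rewrite !funeposE.
have n0 q : (0 <= h^\- q)%E by exact: funeneg_ge0.
rewrite -(ge0_integral_partial_iso P (measurable_funeneg mh) n0).
by apply: eq_integral => q _; rewrite !funenegE.
Qed.

Lemma cint_partial_iso D F D' G (h : T -> C) : partial_iso D F D' G -> cmeasurable h ->
  cint mu (extend0 D (h \o F)) = cint mu (extend0 D' h).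
Proof.
move=> P [mr mi].
have E (E : set T) (u : T -> R) : \int[mu]_q (if `[< E q >] then u q else 0) =
    fine (\int[mu]_(q in E) (u q)%:E)%E.
  rewrite -[RHS]/(Rintegral mu E u) [RHS]Rintegral_mkcond; apply: eq_Rintegral => q _.
  by rewrite patchE; case: asboolP => Eq; [rewrite mem_set|rewrite memNset].
rewrite /cint; congr (_ +i* _).
  transitivity (\int[mu]_q (if `[< D q >] then complex.Re (h (F q)) else 0)).
    by apply: eq_Rintegral => q _; rewrite /extend0; case: ifP.
  rewrite E (integral_partial_iso P (h := fun q => (complex.Re (h q))%:E)); last exact/measurable_EFinP.
  by rewrite -E; apply: eq_Rintegral => q _; rewrite /extend0; case: ifP.
transitivity (\int[mu]_q (if `[< D q >] then complex.Im (h (F q)) else 0)).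
  by apply: eq_Rintegral => q _; rewrite /extend0; case: ifP.
rewrite E (integral_partial_iso P (h := fun q => (complex.Im (h q))%:E)); last exact/measurable_EFinP.
by rewrite -E; apply: eq_Rintegral => q _; rewrite /extend0; case: ifP.
Qed.

(** For a partial isomorphism this is a partial isometry, and [pull_op_of] shows that any
    representative may replace [L2repr v]. *)
Definition pull_op D F (v : H) : H := L2of mu (extend0 D (L2repr v \o F)).

Lemma integral_extend0_sqnorm D (F : T -> T) (f : T -> C) : measurable D ->
  (\int[mu]_q (sqnorm (extend0 D (f \o F) q))%:E = \int[mu]_(q in D) (sqnorm (f (F q)))%:E)%E.
Proof.
move=> mD; rewrite [RHS]integral_mkcond; apply: eq_integral => q _.
rewrite patchE /extend0; case: (asboolP (D q)) => Dq; [by rewrite mem_set|rewrite memNset//].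
by rewrite /sqnorm /= expr0n /= addr0.
Qed.

Section one_iso.
Variables (D D' : set T) (F G : T -> T).
Hypothesis P : partial_iso D F D' G.

Lemma le_sqnorm_pull f : f \in L2pred mu ->
  (\int[mu]_q (sqnorm (extend0 D (f \o F) q))%:E <= \int[mu]_q (sqnorm (f q))%:E)%E.
Proof.
move=> /L2predP[mf foo].
have ms : measurable_fun setT (fun q => (sqnorm (f q))%:E).
  by apply/measurable_EFinP; exact: measurable_sqnorm.
have s0 q : (0 <= (sqnorm (f q))%:E)%E by rewrite lee_fin sqnorm_ge0.
rewrite integral_extend0_sqnorm; last exact: piso_mD P.
rewrite (ge0_integral_partial_iso P ms s0); apply: ge0_subset_integral => //.
exact: piso_mD' P.
Qed.

Lemma L2pred_pull f : f \in L2pred mu -> extend0 D (f \o F) \in L2pred mu.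
Proof.
move=> fL; have [mf foo] := (L2predP mu f).1 fL; apply/L2predP; split; last first.
  exact: le_lt_trans (le_sqnorm_pull fL) foo.
by apply: cmeasurable_extend0; [exact: piso_mD P|apply: cmeasurable_comp => //; exact: piso_mF P].
Qed.

Lemma pull_op_of f : f \in L2pred mu ->
  pull_op D F (L2of mu f) = L2of mu (extend0 D (f \o F)).
Proof.
move=> fL; apply: L2of_eq.
- by apply: L2pred_pull; exact: L2repr_pred.
- exact: L2pred_pull.
- have [N [mN N0 fN]] := L2reprK fL.
  (* The exceptional null set N pulls back to a null subset of D because F preserves measure; off D
     both functions vanish. *)
  exists (D `&` F @^-1` N); split.
  + apply: measurableI; first exact: piso_mD P.
    by rewrite -[_ @^-1` _]setTI; exact: piso_mF P _ _ _.
  + rewrite (piso_mu P)//; apply/eqP; rewrite -measure_le0 -N0; apply: le_measure; rewrite ?inE//.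
    by apply: measurableI => //; exact: piso_mD' P.
  + move=> q /= h; rewrite /extend0 /= in h.
    case: (asboolP (D q)) h => //= Dq h; split => //; exact: fN.
Qed.

Lemma pull_op_linear : linear (pull_op D F).
Proof.
move=> a u v; elim/L2ind: u => f fL; elim/L2ind: v => g gL.
rewrite -L2of_lin// !pull_op_of//; last exact: L2pred_lin.
rewrite -L2of_lin; try exact: L2pred_pull.
congr L2of; apply/funext => q; rewrite /extend0; case: ifP => //=.
by rewrite mulr0 addr0.
Qed.

Lemma nsq_pull_le v : nsq (pull_op D F v) <= nsq v.
Proof.
elim/L2ind: v => f fL; rewrite pull_op_of// !nsq_L2of//; last exact: L2pred_pull.
have [mf foo] := (L2predP mu f).1 fL.
have fin (u : T -> R) : (forall x, 0 <= u x) -> (\int[mu]_x (u x)%:E < +oo)%E ->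
    (\int[mu]_x (u x)%:E)%E \is a fin_num.
  by move=> u0 h; rewrite ge0_fin_numE//; apply: integral_ge0 => x _; rewrite lee_fin.
apply: fine_le.
- apply: fin => [x|]; first exact: sqnorm_ge0.
  exact: le_lt_trans (le_sqnorm_pull fL) foo.
- apply: fin => // x; exact: sqnorm_ge0.
- exact: le_sqnorm_pull.
Qed.

Lemma pull_op_bounded : bounded_operator dot (pull_op D F).
Proof.
split; first exact: pull_op_linear.
by exists 1 => v; rewrite expr1n mul1r !nsqE lecR; exact: nsq_pull_le.
Qed.

End one_iso.

Lemma pull_op_adjoint D F D' G : partial_iso D F D' G ->
  adjoint dot (pull_op D F) (pull_op D' G).
Proof.
move=> P v w; elim/L2ind: v => f fL; elim/L2ind: w => g gL.
have P' := partial_iso_sym P.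
rewrite (pull_op_of P)// (pull_op_of P')//.
rewrite !L2dotE//; [|exact: (L2pred_pull P')|exact: (L2pred_pull P)].
have [mf _] := (L2predP mu f).1 fL; have [mg _] := (L2predP mu g).1 gL.
(* On D one has q = G (F q), so the whole integrand is a function of F q and the change of variables
   moves it to D'. *)
transitivity (cint mu (extend0 D ((fun q => f q * (conjc (g (G q)))) \o F))).
  congr cint; apply/funext => q; rewrite /extend0; case: asboolP => Dq; last by rewrite mul0r.
  by rewrite /= (piso_GF P Dq).
rewrite (cint_partial_iso P).
  congr cint; apply/funext => q; rewrite /extend0; case: asboolP => Dq //.
  by rewrite conjc0 mulr0.
apply: cmeasurableM => //; apply: cmeasurable_conj.
by apply: cmeasurable_comp => //; exact: piso_mG P.
Qed.

End partial_isomorphisms.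

(** * Density in L^2 of the span of the indicators of a generating pi-system *)

Section density.
Context d (T : measurableType d) (R : realType).
Variable mu : {measure set T -> \bar R}.
Local Notation C := R[i].
Local Notation H := (L2 mu).

Definition L2real (f : T -> R) : H := L2of mu (fun q => (f q)%:C).

Lemma L2pred_real (f : T -> R) : measurable_fun setT f ->
  (\int[mu]_q (f q ^+ 2)%:E < +oo)%E -> (fun q => (f q)%:C) \in L2pred mu.
Proof.
move=> mf foo; apply/L2predP; split; first by split => //=; exact: measurable_cst.
by move: foo; congr (_ < _)%E; apply: eq_integral => q _; rewrite /sqnorm /= expr0n addr0.
Qed.

Lemma sqr_integrable (f : T -> R) : measurable_fun setT f ->
  (\int[mu]_q (f q ^+ 2)%:E < +oo)%E ->
  mu.-integrable setT (fun q => (f q ^+ 2)%:E).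
Proof.
move=> mf foo; apply/integrableP; split.
  by apply/measurable_EFinP; exact: measurable_funX.
by under eq_integral do rewrite gee0_abs ?lee_fin ?sqr_ge0//.
Qed.

Lemma L2real_lin (a : R) (f g : T -> R) : (fun q => (f q)%:C) \in L2pred mu ->
  (fun q => (g q)%:C) \in L2pred mu ->
  L2real (fun q => a * f q + g q) = a%:C *: L2real f + L2real g.
Proof.
move=> fL gL; rewrite -L2of_lin//; congr L2of; apply/funext => q.
by rewrite rmorphD rmorphM.
Qed.

Lemma L2real_dominated_pred (f g : T -> R) : measurable_fun setT f ->
  measurable_fun setT g -> (forall q, 0 <= g q <= f q) ->
  (\int[mu]_q (f q ^+ 2)%:E < +oo)%E -> (\int[mu]_q (g q ^+ 2)%:E < +oo)%E.
Proof.
move=> mf mg gf; apply: le_lt_trans; apply: ge0_le_integral => //.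
- by move=> q _; rewrite lee_fin sqr_ge0.
- by apply/measurable_EFinP; exact: measurable_funX.
- by apply/measurable_EFinP; exact: measurable_funX.
- move=> q _; rewrite lee_fin; have /andP[g0 gf'] := gf q.
  by rewrite lerXn2r// nnegrE// (le_trans g0).
Qed.

(** Since 0 <= g n <= f, the squares of f - g n are dominated by the integrable square of f. *)
Lemma cvg_L2real (f : T -> R) (g : (T -> R)^nat) : measurable_fun setT f ->
  (forall n, measurable_fun setT (g n)) -> (forall n q, 0 <= g n q <= f q) ->
  (\int[mu]_q (f q ^+ 2)%:E < +oo)%E ->
  (forall q, g ^~ q @ \oo --> f q) ->
  (fun n => nsq (L2real f - L2real (g n))) @ \oo --> (0 : R).
Proof.
move=> mf mg gf foo gfq.
have fL := L2pred_real mf foo.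
have gL n : (fun q => (g n q)%:C) \in L2pred mu.
  by apply: L2pred_real => //; exact: L2real_dominated_pred foo.
have E n : nsq (L2real f - L2real (g n)) = \int[mu]_q ((f q - g n q) ^+ 2).
  rewrite /L2real -scaleN1r addrC -L2of_lin// nsq_L2of; last exact: L2pred_lin.
  apply: eq_Rintegral => q _.
  by rewrite /sqnorm /=; ring.
have [] := @dominated_convergence _ _ _ mu setT measurableT
  (fun n q => ((f q - g n q) ^+ 2)%:E) (cst 0%E) (fun q => (f q ^+ 2)%:E).
- by move=> n; apply/measurable_EFinP; apply: measurable_funX; exact: measurable_funB.
- exact: measurable_cst.
- apply: aeW => q _ /=; apply: cvg_EFin; first exact: nearW.
  have c : (fun n => f q - g n q) @ \oo --> f q - f q by apply: cvgB => //; exact: cvg_cst.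
  have := cvgM c c; rewrite subrr mulr0; exact.
- exact: sqr_integrable.
- apply: aeW => q n _; rewrite gee0_abs ?lee_fin ?sqr_ge0//.
  have /andP[g0 gf'] := gf n q.
  by rewrite lerXn2r// ?nnegrE ?subr_ge0// ?(le_trans g0)// lerBlDr lerDl.
move=> _ _; rewrite integral_cst// mul0e => h.
under eq_fun do rewrite E.
exact: (fine_cvg (h : _ --> 0%:E)%E).
Qed.

Lemma int_indic_lty A : measurable A -> (mu A < +oo)%E ->
  (\int[mu]_q ((\1_A q : R) ^+ 2)%:E < +oo)%E.
Proof.
move=> mA; congr (_ < _)%E; rewrite -[A in LHS]setIT -integral_indic//.
apply: eq_integral => q _; rewrite indicE; case: (q \in A) => /=; first by rewrite expr1n.
by rewrite expr0n.
Qed.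

Lemma L2pred_indic A : measurable A -> (mu A < +oo)%E ->
  (fun q => (\1_A q : R)%:C) \in L2pred mu.
Proof.
by move=> mA Aoo; apply: L2pred_real; [exact: measurable_indic|exact: int_indic_lty].
Qed.

Definition closed_subspace (Q : H -> Prop) : Prop :=
  [/\ Q 0, forall (a : C) u v, Q u -> Q v -> Q (a *: u + v) &
    forall v (u : nat -> H), (forall n, Q (u n)) ->
      (fun n => nsq (v - u n)) @ \oo --> (0 : R) -> Q v].

Variables (G : set (set T)) (g : (set T)^nat).
Hypotheses (mG : @measurable _ T = <<s G >>) (GI : setI_closed G)
  (Gg : forall i, G (g i)) (g_cover : \bigcup_i g i = setT)
  (Goo : forall A, G A -> (mu A < +oo)%E).

Variable Q : H -> Prop.
Hypotheses (Qc : closed_subspace Q) (QG : forall A, G A -> Q (L2real (\1_A))).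

Let G_measurable A : G A -> measurable A.
Proof. by move=> GA; rewrite mG; exact: sub_sigma_algebra. Qed.

Let QB u v : Q u -> Q v -> Q (u - v).
Proof. by case: Qc => _ h _ Qu Qv; rewrite -scaleN1r addrC; exact: h. Qed.

(** Dynkin's pi-lambda argument inside one generator E: cutting by a set of finite measure keeps
    complements and countable unions square integrable. *)
Let Q_indicI E A : G E -> measurable A -> Q (L2real (\1_(A `&` E))).
Proof.
move=> GE mA; have mE := G_measurable GE; have Eoo := Goo GE.
have fin B : measurable B -> (mu (B `&` E) < +oo)%E.
  by move=> mB; apply: le_lt_trans Eoo; apply: le_measure; rewrite ?inE//; exact: measurableI.
pose P B := Q (L2real (\1_(B `&` E))).
apply: (@dynkin_induction _ T G P mG GI).
- by rewrite /P setTI; exact: QG.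
- by move=> B GB; apply: QG; exact: GI.
- move=> B mB PB; rewrite /P.
  have -> : \1_(~` B `&` E) = (fun q => -1 * \1_(B `&` E) q + \1_E q) :> (T -> R).
    apply/funext => q; rewrite !indicE !in_setI in_setC.
    by case: (q \in B) (q \in E) => [] []; rewrite /=; ring.
  rewrite L2real_lin; [|exact: L2pred_indic (measurableI _ _ mB mE) (fin _ mB)|exact: L2pred_indic].
  by case: Qc => _ h _; apply: h => //; exact: QG.
- move=> F mF tF PF; rewrite /P.
  case: (Qc) => Q0 Ql Qlim.
  have mU n : measurable (\big[setU/set0]_(i < n) F i) by exact: bigsetU_measurable.
  apply: (Qlim _ (fun n => L2real (\1_((\big[setU/set0]_(i < n) F i) `&` E)))).
    elim=> [|n ih].
      rewrite big_ord0 set0I indic0.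
      by rewrite /L2real (_ : (fun q => _) = (fun=> 0))// L2of0.
    rewrite big_ord_recr /= setIUl.
    rewrite [X in L2real X](_ : _ =
        (fun q => 1 * \1_(F n `&` E) q + \1_(\big[setU/set0]_(i < n) F i `&` E) q)).
      rewrite L2real_lin; try exact: L2pred_indic (measurableI _ _ _ mE) (fin _ _).
      by apply: Ql; [exact: PF|exact: ih].
    have dis q : (q \in F n) -> (q \in \big[setU/set0]_(i < n) F i) = false.
      move=> /set_mem Fnq; apply/negbTE/negP => /set_mem.
      rewrite -bigcup_mkord => -[k /= kn Fkq].
      by have := tF k n I I (ex_intro _ q (conj Fkq Fnq)) => E'; rewrite E' ltnn in kn.
    apply/funext => q; rewrite !indicE in_setU !in_setI.
    have := dis q.
    case: (q \in F n) => [/(_ isT)->|_]; first by case: (q \in E) => /=; ring.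
    by case: (q \in \big[setU/set0]_(i < n) F i); case: (q \in E) => /=; ring.
  have mUE : measurable (\bigcup_k F k `&` E).
    by apply: measurableI => //; exact: bigcupT_measurable.
  apply: cvg_L2real.
  + exact: measurable_indic.
  + by move=> n; apply: measurable_indic; exact: measurableI.
  + move=> n q; rewrite !indicE ler0n /= ler_nat !in_setI.
    case Eq : (q \in E); rewrite ?andbF// !andbT.
    case h : (q \in \big[setU/set0]_(i < n) F i) => //.
    rewrite mem_set//; move: h => /set_mem; rewrite -bigcup_mkord => -[k _ Fk].
    by exists k.
  + by apply: int_indic_lty => //; apply: fin; exact: bigcupT_measurable.
  + move=> q; rewrite [X in _ --> X]indicE in_setI.
    apply: cvg_near_cst; case Uq : (q \in \bigcup_k F k); last first.
      apply: nearW => n; rewrite indicE in_setI.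
      case h : (q \in \big[setU/set0]_(i < n) F i) => //.
      move: h => /set_mem; rewrite -bigcup_mkord => -[k _ Fk].
      by rewrite mem_set in Uq; last by exists k.
    have [k _ Fk] := set_mem Uq.
    exists k.+1 => // n /= kn; rewrite indicE in_setI.
    by rewrite (@mem_set _ (\big[setU/set0]_(i < n) F i) q)// -bigcup_mkord; exists k.
- by rewrite -mG.
Qed.

Let F n := \big[setU/set0]_(i < n) g i.

Let mF n : measurable (F n).
Proof. by apply: bigsetU_measurable => i _; apply: G_measurable. Qed.

Let Foo A n : measurable A -> (mu (A `&` F n) < +oo)%E.
Proof.
move=> mA; apply: (@le_lt_trans _ _ (mu (F n))).
  by apply: le_measure; rewrite ?inE//; exact: measurableI.
rewrite /F; elim: n => [|n ih]; first by rewrite big_ord0 measure0.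
rewrite big_ord_recr /=; apply: le_lt_trans (measureU2 _ _ _) _.
- exact: mF.
- exact: G_measurable.
- by rewrite lte_add_pinfty//; exact: Goo.
Qed.

(** The part of A added at each step is (A minus F n) cut by the single generator g n, to which
    [Q_indicI] applies. *)
Let Q_indicF A n : measurable A -> Q (L2real (\1_(A `&` F n))).
Proof.
move=> mA; elim: n => [|n ih].
  rewrite /F big_ord0 setI0 indic0.
  by rewrite /L2real (_ : (fun q => _) = (fun=> 0))// L2of0; case: Qc.
have mD : measurable (A `\` F n) by exact: measurableD.
rewrite [X in L2real X](_ : _ = (fun q => 1 * \1_((A `\` F n) `&` g n) q + \1_(A `&` F n) q)).
  rewrite L2real_lin.
  - by case: Qc => _ h _; apply: h => //; exact: Q_indicI.
  - apply: L2pred_indic; first by apply: measurableI => //; exact: G_measurable.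
    apply: le_lt_trans (Goo (Gg n)); apply: le_measure; rewrite ?inE//.
    + by apply: measurableI => //; exact: G_measurable.
    + exact: G_measurable.
  - by apply: L2pred_indic; [exact: measurableI|exact: Foo].
apply/funext => q; rewrite setDE [F n.+1]big_ord_recr /= -/(F n) !indicE !in_setI in_setU in_setC.
by case: (q \in A); case: (q \in F n); case: (q \in g n); rewrite /=; ring.
Qed.

Import HBNNSimple.

Let Q_nonneg (f : T -> R) : measurable_fun setT f -> (forall q, 0 <= f q) ->
  (\int[mu]_q (f q ^+ 2)%:E < +oo)%E -> Q (L2real f).
Proof.
move=> mf f0 foo; have [Q0 Ql Qlim] := Qc.
have mf' : measurable_fun setT (EFin \o f) by exact/measurable_EFinP.
pose h := nnsfun_approx measurableT mf'.
have hf q : (fun n => h n q) @ \oo --> f q.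
  have := cvg_nnsfun_approx measurableT mf' (fun q _ => f0 q) (I : setT q).
  by move=> /fine_cvg.
have hle n q : h n q <= f q.
  have h_cvg : cvgn (fun n => h n q) by apply/cvg_ex; exists (f q); exact: hf.
  have := fun nd => @nondecreasing_cvgn_le _ (fun n => h n q) nd h_cvg n.
  rewrite (cvg_lim _ (hf q))//; apply.
  by move=> i j ij; have /lefP := nd_nnsfun_approx measurableT mf' ij; apply.
have mh n A : measurable A -> measurable_fun setT (fun q => h n q * \1_A q).
  by move=> mA; apply: measurable_funM => //; exact: measurable_indic.
(* The simple approximations are cut off to [F n], because a level set such as that of the value 0
   may have infinite measure. *)
apply: (Qlim _ (fun n => L2real (fun q => h n q * \1_(F n) q))).
  move=> n.
  set s := fset_set (h n @` setT).
  pose a (i : nat) := (s : seq R)`_i; pose A (i : nat) := h n @^-1` [set a i] `&` F n.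
  have mA i : measurable (A i) by apply: measurableI => //; exact: measurable_funPTI.
  have AL i : (fun q => (\1_(A i) q : R)%:C) \in L2pred mu.
    by apply: L2pred_indic => //; apply: Foo; exact: measurable_funPTI.
  pose S k q := \sum_(i < k) a i * \1_(A i) q.
  rewrite [X in L2real X](_ : _ = S #|` s|).
    suff /(_ #|` s|)[] : forall k, (fun q => (S k q)%:C) \in L2pred mu /\ Q (L2real (S k)) by [].
    elim=> [|k [ihL ihQ]].
      have -> : S 0%N = (fun=> 0) by apply/funext => q; rewrite /S big_ord0.
      by rewrite /L2real L2of0; split => //; exact: L2pred0.
    have SS q : S k.+1 q = a k * \1_(A k) q + S k q by rewrite /S big_ord_recr addrC.
    split.
      rewrite (_ : (fun q => _) = (fun q => (a k)%:C * (\1_(A k) q)%:C + (S k q)%:C)).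
        exact: L2pred_lin.
      by apply/funext => q; rewrite SS rmorphD rmorphM.
    rewrite (_ : S k.+1 = (fun q => a k * \1_(A k) q + S k q)); last exact/funext.
    by rewrite L2real_lin//; apply: Ql => //; apply: Q_indicF; exact: measurable_funPTI.
  apply/funext => q; rewrite fimfunEord -/s mulr_suml; apply: eq_bigr => i _.
  by rewrite /A indicI /= mulrA.
apply: cvg_L2real => //.
- by move=> n; exact: mh.
- move=> n q; rewrite indicE; case: (q \in F n); rewrite ?mulr1 ?mulr0 ?f0 ?lexx//.
  by rewrite hle fun_ge0.
- move=> q; rewrite -[X in _ --> X]mulr1; apply: cvgM => //.
  apply: cvg_near_cst.
  have : (\bigcup_i g i) q by rewrite g_cover.
  move=> [k _ gk]; exists k.+1 => // n /= kn.
  by rewrite indicE mem_set// /F -bigcup_mkord; exists k.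
Qed.

(** Serves as an induction principle: a closed linear condition that holds for the indicators of the
    generators holds for every vector. *)
Theorem closed_subspace_total v : Q v.
Proof.
elim/L2ind: v => f fL; have [Q0 Ql Qlim] := Qc.
have Qr (u : T -> R) : u \in Lfun mu 2%:E -> (fun q => (u q)%:C) \in L2pred mu /\ Q (L2real u).
  move=> /Lfun2P[mu' uoo]; split; first exact: L2pred_real.
  have mp : measurable_fun setT (fun q => Num.max (u q) 0) by apply: measurable_maxr.
  have mn : measurable_fun setT (fun q => Num.max (- u q) 0).
    by apply: measurable_maxr => //; exact: measurable_funN.
  have p0 q : 0 <= Num.max (u q) 0 by rewrite le_max lexx orbT.
  have n0 q : 0 <= Num.max (- u q) 0 by rewrite le_max lexx orbT.
  have le_sq (w : T -> R) : measurable_fun setT w -> (forall q, w q ^+ 2 <= u q ^+ 2) ->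
      (\int[mu]_q (w q ^+ 2)%:E < +oo)%E.
    move=> mw wu; apply: le_lt_trans uoo; apply: ge0_le_integral => //.
    - by move=> q _; rewrite lee_fin sqr_ge0.
    - by apply/measurable_EFinP; exact: measurable_funX.
    - by apply/measurable_EFinP; exact: measurable_funX.
    - by move=> q _; rewrite lee_fin.
  have p2 : (\int[mu]_q (Num.max (u q) 0 ^+ 2)%:E < +oo)%E.
    apply: le_sq => // q; case: (leP (u q) 0) => h; last by [].
    by rewrite expr0n sqr_ge0.
  have n2 : (\int[mu]_q (Num.max (- u q) 0 ^+ 2)%:E < +oo)%E.
    apply: le_sq => // q; case: (leP (- u q) 0) => h; last by rewrite sqrrN.
    by rewrite expr0n sqr_ge0.
  rewrite [X in L2real X](_ : _ = (fun q => -1 * Num.max (- u q) 0 + Num.max (u q) 0)).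
    rewrite L2real_lin; [|exact: L2pred_real|exact: L2pred_real].
    by apply: Ql; exact: Q_nonneg.
  by apply/funext => q; case: (leP (u q) 0) => h1; case: (leP (- u q) 0) => h2; lra.
have /andP[/Qr[rL Qre] /Qr[iL Qim]] := fL.
rewrite (_ : f = (fun q => 'i * (complex.Im (f q))%:C + (complex.Re (f q))%:C)).
  by rewrite L2of_lin//; exact: Ql.
apply/funext => q; case: (f q) => a b /=.
by apply/eqP; rewrite eq_complex /=; apply/andP; split; apply/eqP; ring.
Qed.

End density.

Lemma measurable_forall (P : nat -> Prop) d (S : measurableType d) (A : nat -> set S) :
  (forall i, measurable (A i)) -> measurable [set q | forall i, P i -> A i q].
Proof.
move=> mA; rewrite (_ : [set _ | _] = \bigcap_i (if `[< P i >] then A i else setT)).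
  by apply: bigcapT_measurable => i; case: ifP.
apply/seteqP; split => q /= h i; first by move=> _; case: asboolP => // /h.
by move=> Pi; have := h i I; rewrite asboolT.
Qed.

(** * Pairs of tail-equivalent sequences *)

Section seqspace_lemmas.

Definition cyl (n : nat) (w : nat -> nat) : set (seqspace nat) :=
  [set x | forall i, (i < n)%N -> x i = w i].

Lemma measurable_coord (i v : nat) : measurable [set x : seqspace nat | x i = v].
Proof. by apply: sub_sigma_algebra; exists i, v. Qed.

Lemma measurable_cyl n w : measurable (cyl n w).
Proof.
by apply: (@measurable_forall (fun i => (i < n)%N)) => i; exact: measurable_coord.
Qed.

Lemma measurable_seqspace d (T : measurableType d) (f : T -> seqspace nat) :
  (forall i v, measurable [set q | f q i = v]) -> measurable_fun setT f.
Proof.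
move=> mf; apply: (@measurability _ _ T (seqspace nat) setT f (@coordinate_sets nat)) => //.
by move=> _ [_ [i [v ->]] <-]; rewrite setTI; exact: mf.
Qed.

End seqspace_lemmas.

Section tail_space_lemmas.

Local Notation T := tail_space.

Lemma measurable_tail_fst (i v : nat) : measurable [set q : T | (tail_val q).1 i = v].
Proof.
exists ((fun p : seqspace nat * seqspace nat => p.1 i) @^-1` [set v]); last by rewrite setTI.
have : measurable_fun setT (@fst (seqspace nat) (seqspace nat)) by exact: measurable_fst.
by move=> /(_ measurableT _ (measurable_coord i v)); rewrite setTI.
Qed.

Lemma measurable_tail_snd (i v : nat) : measurable [set q : T | (tail_val q).2 i = v].
Proof.
exists ((fun p : seqspace nat * seqspace nat => p.2 i) @^-1` [set v]); last by rewrite setTI.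
have : measurable_fun setT (@snd (seqspace nat) (seqspace nat)) by exact: measurable_snd.
by move=> /(_ measurableT _ (measurable_coord i v)); rewrite setTI.
Qed.

Lemma measurable_tail_map d (S : measurableType d) (F : S -> T) :
  (forall i v, measurable [set q | (tail_val (F q)).1 i = v]) ->
  (forall i v, measurable [set q | (tail_val (F q)).2 i = v]) ->
  measurable_fun setT F.
Proof.
move=> m1 m2 _ A [B mB <-]; rewrite setTI.
have mF : measurable_fun setT (fun q => ((tail_val (F q)).1, (tail_val (F q)).2)).
  by apply: measurable_fun_pair; exact: measurable_seqspace.
have := mF measurableT B mB; rewrite setTI; congr measurable.
by apply/seteqP; split => q /=; case: (tail_val (F q)) => // x y [].
Qed.

Lemma tail_valP (q : T) : tail_eq (tail_val q).1 (tail_val q).2.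
Proof. exact: (svalP q). Qed.

Lemma tail_val_inj (p q : T) : (tail_val p).1 = (tail_val q).1 ->
  (tail_val p).2 = (tail_val q).2 -> p = q.
Proof.
case: p q => [[x y] h] [[x' y'] h'] /= E1 E2; subst x' y'.
by congr exist; exact: Prop_irrelevance.
Qed.

(** Agreement from n on leaves exactly one pair over each first sequence that begins with u, so the
    measure is finite. Only the first n values of u and v count. *)
Definition pair_cyl (n : nat) (u v : nat -> nat) : set T :=
  [set q | [/\ cyl n u (tail_val q).1, cyl n v (tail_val q).2 &
    forall i, (n <= i)%N -> (tail_val q).1 i = (tail_val q).2 i]].

Lemma measurable_eq_coord i j : measurable [set q : T | (tail_val q).1 i = (tail_val q).2 j].
Proof.
rewrite (_ : [set _ | _] = \bigcup_v ([set q : T | (tail_val q).1 i = v] `&` [set q : T | (tail_val q).2 j = v])).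
  by apply: bigcupT_measurable => v; apply: measurableI; [exact: measurable_tail_fst|exact: measurable_tail_snd].
by apply/seteqP; split => q /= => [E|[v _ /= [-> ->]]//]; exists ((tail_val q).2 j).
Qed.

Lemma measurable_cyl_fst n u : measurable [set q : T | cyl n u (tail_val q).1].
Proof. by apply: (@measurable_forall (fun i => (i < n)%N)) => i; exact: measurable_tail_fst. Qed.

Lemma measurable_cyl_snd n u : measurable [set q : T | cyl n u (tail_val q).2].
Proof. by apply: (@measurable_forall (fun i => (i < n)%N)) => i; exact: measurable_tail_snd. Qed.

Lemma measurable_pair_cyl n u v : measurable (pair_cyl n u v).
Proof.
rewrite (_ : pair_cyl n u v = [set q : T | cyl n u (tail_val q).1] `&` [set q : T | cyl n v (tail_val q).2] `&`
  [set q : T | forall i, (n <= i)%N -> (tail_val q).1 i = (tail_val q).2 i]).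
  apply: measurableI; first by apply: measurableI; [exact: measurable_cyl_fst|exact: measurable_cyl_snd].
  by apply: (@measurable_forall (fun i => (n <= i)%N)) => i; exact: measurable_eq_coord.
by apply/seteqP; split => q /= => [[]|[[]]].
Qed.

(* Requiring length at least n0 keeps a generating pi-system, and a map that changes only
   the first n0 letters of a pair sends these cylinders to such cylinders. *)
Definition pair_cyls (n0 : nat) : set (set T) :=
  [set A | A = set0 \/ exists n u v, (n0 <= n)%N /\ A = pair_cyl n u v].

(** Two cylinders that meet are nested: the longer one lies in the shorter one. *)
Lemma pair_cyls_setI n0 : setI_closed (pair_cyls n0).
Proof.
move=> A B [->|[n [u [v [n0n ->]]]]]; first by rewrite set0I; left.
move=> [->|[n' [u' [v' [n0n' ->]]]]]; first by rewrite setI0; left.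
wlog nn' : n n' u u' v v' n0n n0n' / (n <= n')%N.
  move=> W; have [nn'|/ltnW nn'] := leqP n n'; first exact: W.
  by rewrite setIC; exact: W.
have [->|/set0P[q0 [[a1 a2 a3] [b1 b2 b3]]]] := eqVneq (pair_cyl n u v `&` pair_cyl n' u' v') set0; first by left.
right; exists n', u', v'; split => //; apply/seteqP; split => [q []//|q [c1 c2 c3]].
split; last by split.
split=> [i ni|i ni|i ni].
- by rewrite c1 ?(leq_trans ni)// -b1 ?(leq_trans ni)// a1.
- by rewrite c2 ?(leq_trans ni)// -b2 ?(leq_trans ni)// a2.
- by have [n'i|n'i] := leqP n' i; [exact: c3|rewrite c1// c2// -b1// -b2// a3].
Qed.

Definition cyl_code (k : nat) : option (nat * seq nat * seq nat) := choice.unpickle k.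

(** Words are coded by lists padded with 0, so countably many codes list all cylinders of length at
    least n0. Every other code gives the empty set, which also belongs to [pair_cyls n0]. *)
Definition pair_cyl_enum (n0 k : nat) : set T :=
  if cyl_code k is Some (n, su, sv) then
    if (n0 <= n)%N then pair_cyl n (nth 0%N su) (nth 0%N sv) else set0
  else set0.

Lemma pair_cyl_enumP n0 k : pair_cyls n0 (pair_cyl_enum n0 k).
Proof.
rewrite /pair_cyl_enum; case: (cyl_code k) => [[[n su] sv]|]; last by left.
by case: ifP => nn; [right; exists n, (nth 0%N su), (nth 0%N sv)|left].
Qed.

Lemma pair_cyl_pickle n0 n (q : T) : (n0 <= n)%N ->
  (forall i, (n <= i)%N -> (tail_val q).1 i = (tail_val q).2 i) ->
  pair_cyl_enum n0 (choice.pickle (n, mkseq (tail_val q).1 n, mkseq (tail_val q).2 n)) q.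
Proof.
move=> n0n qn; rewrite /pair_cyl_enum /cyl_code choice.pickleK n0n; split => // i ni.
  by rewrite nth_mkseq.
by rewrite nth_mkseq.
Qed.

Lemma pair_cyl_enum_cover n0 : \bigcup_k pair_cyl_enum n0 k = setT.
Proof.
apply/seteqP; split => // q _.
have [n qn] := tail_valP q.
exists (choice.pickle (maxn n0 n, mkseq (tail_val q).1 (maxn n0 n), mkseq (tail_val q).2 (maxn n0 n))) => //.
apply: pair_cyl_pickle; first exact: leq_maxl.
by move=> i; rewrite geq_max => /andP[_]; exact: qn.
Qed.

(** In the nontrivial inclusion, a coordinate set at position i is the countable union of the
    cylinders longer than i whose word has the required letter there. *)
Lemma tail_generated n0 : @measurable _ T = <<s pair_cyls n0 >>.
Proof.
apply/seteqP; split; last first.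
  apply: smallest_sub; first exact: sigma_algebra_measurable.
  move=> A [->|[n [u [v [_ ->]]]]]; first exact: measurable0.
  exact: measurable_pair_cyl.
(* The same space with the sigma-algebra generated by cylinders; the inclusion becomes measurability
   of the identity from S to T. *)
pose S := g_sigma_algebraType (pair_cyls n0).
have mB n u v : (n0 <= n)%N -> measurable (pair_cyl n u v : set S).
  by move=> n0n; apply: sub_sigma_algebra; right; exists n, u, v.
have mE k : measurable (pair_cyl_enum n0 k : set S).
  by apply: sub_sigma_algebra; exact: pair_cyl_enumP.
have m1 i w : measurable [set q : S | (tail_val q).1 i = w].
  have : measurable (\bigcup_(k in [set k | if cyl_code k is Some (n, su, sv) then
      (i < n)%N /\ nth 0%N su i = w else False]) (pair_cyl_enum n0 k : set S)).
    exact: bigcup_measurable.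
  congr measurable; apply/seteqP; split => q /=.
    move=> [k /=]; rewrite /pair_cyl_enum; case: (cyl_code k) => // [[[n su] sv]] [iN <-].
    by case: ifP => // _ [h _ _]; exact: h.
  move=> qi; have [n qn] := tail_valP q; pose n1 := maxn i.+1 (maxn n0 n).
  exists (choice.pickle (n1, mkseq (tail_val q).1 n1, mkseq (tail_val q).2 n1)).
    by rewrite /= /cyl_code choice.pickleK; split; [exact: leq_maxl|rewrite nth_mkseq// leq_maxl].
  apply: pair_cyl_pickle; first by rewrite /n1 !leq_max leqnn orbT.
  by move=> j; rewrite !geq_max => /and3P[_ _]; exact: qn.
have m2 i w : measurable [set q : S | (tail_val q).2 i = w].
  have : measurable (\bigcup_(k in [set k | if cyl_code k is Some (n, su, sv) then
      (i < n)%N /\ nth 0%N sv i = w else False]) (pair_cyl_enum n0 k : set S)).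
    exact: bigcup_measurable.
  congr measurable; apply/seteqP; split => q /=.
    move=> [k /=]; rewrite /pair_cyl_enum; case: (cyl_code k) => // [[[n su] sv]] [iN <-].
    by case: ifP => // _ [_ h _]; exact: h.
  move=> qi; have [n qn] := tail_valP q; pose n1 := maxn i.+1 (maxn n0 n).
  exists (choice.pickle (n1, mkseq (tail_val q).1 n1, mkseq (tail_val q).2 n1)).
    by rewrite /= /cyl_code choice.pickleK; split; [exact: leq_maxl|rewrite nth_mkseq// leq_maxl].
  apply: pair_cyl_pickle; first by rewrite /n1 !leq_max leqnn orbT.
  by move=> j; rewrite !geq_max => /and3P[_ _]; exact: qn.
have mid : measurable_fun setT (id : S -> T) by exact: measurable_tail_map.
by move=> A mA; have := mid measurableT A mA; rewrite setTI.
Qed.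

Lemma tail_measure_unique (R : realType) (m1 m2 : {measure set T -> \bar R}) n0 :
  (forall n u v, (n0 <= n)%N -> m1 (pair_cyl n u v) = m2 (pair_cyl n u v)) ->
  (forall n u v, (n0 <= n)%N -> (m1 (pair_cyl n u v) < +oo)%E) ->
  forall A, measurable A -> m1 A = m2 A.
Proof.
move=> m12 m1oo A mA.
apply: (measure_unique (pair_cyls n0) (pair_cyl_enum n0)) => //.
- exact: tail_generated.
- exact: pair_cyls_setI.
- exact: pair_cyl_enumP.
- exact: pair_cyl_enum_cover.
- by move=> B [->|[n [u [v [n0n ->]]]]]; [rewrite !measure0|exact: m12].
- by move=> k; have [->|[n [u [v [n0n ->]]]]] := pair_cyl_enumP n0 k; [rewrite measure0|exact: m1oo].
Qed.

End tail_space_lemmas.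

(** * Measures of cylinders, for sequences and for pairs *)

Section product_measures.
Context (R : realType) (a : nat -> R) (m : probability (seqspace nat) R).
Hypothesis hm : product_measure a m.
Local Open Scope ereal_scope.

Definition word_weight (n : nat) (w : nat -> nat) : R := (\prod_(i < n) a (w i))%R.

Lemma measure_cyl n w : m (cyl n w) = (word_weight n w)%:E.
Proof. exact: hm. Qed.

Lemma weight_ge0 v : (0 <= a v)%R.
Proof.
by rewrite -lee_fin; have := measure_cyl 1 (fun=> v); rewrite /word_weight big_ord1 => <-.
Qed.

Lemma weight_sum : \sum_(v <oo) (a v)%:E = 1.
Proof.
rewrite -(probability_setT m) (_ : setT = \bigcup_v cyl 1 (fun=> v)); last first.
  by apply/seteqP; split => // x _; exists (x 0%N) => // -[].
have mC v : measurable (cyl 1 (fun=> v)) by exact: measurable_cyl.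
rewrite measure_semi_bigcup//.
- apply: eq_eseriesr => v _; transitivity (m (cyl 1 (fun=> v))) => //.
  by rewrite measure_cyl /word_weight big_ord1.
- by move=> u v _ _ [x [/(_ 0%N isT) <- /(_ 0%N isT) <-]].
- exact: bigcupT_measurable.
Qed.

(** The product measure is given on full cylinders only, so the positions outside p are released one
    at a time. The condition [q k] keeps p and all positions from k on; passing to k + 1 sums over
    the letter at k, and the letters have total weight 1. *)
Lemma measure_coords N (p : nat -> bool) (w : nat -> nat) :
  m [set x | forall i, (i < N)%N -> p i -> x i = w i] =
  (\prod_(i < N | p i) a (w i))%:E.
Proof.
pose q k i := p i || (k <= i)%N.
have mS k v : measurable [set x : seqspace nat | forall i, (i < N)%N -> q k i -> x i = v i].
  rewrite (_ : [set _ | _] = [set x | forall i, ((i < N)%N && q k i) -> [set x : seqspace nat | x i = v i] x]).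
    by apply: (@measurable_forall (fun i => (i < N)%N && q k i)) => i; exact: measurable_coord.
  by apply/seteqP; split => x /= h i; [case/andP; exact: h|move=> iN qi; apply: h; rewrite iN].
suff S k : (k <= N)%N -> forall v, m [set x | forall i, (i < N)%N -> q k i -> x i = v i] =
    (\prod_(i < N | q k i) a (v i))%:E.
  have E i : (i < N)%N -> q N i = p i by move=> iN; rewrite /q leqNgt iN orbF.
  rewrite [X in m X](_ : _ = [set x | forall i, (i < N)%N -> q N i -> x i = w i]); last first.
    by apply/seteqP; split => x /= h i iN; rewrite ?E// => pi; apply: h; rewrite ?E.
  by rewrite S//; congr EFin; apply: eq_bigl => i; rewrite E.
elim: k => [_ v|k ih kN v].
  rewrite [X in m X](_ : _ = cyl N v).
    rewrite measure_cyl /word_weight; congr EFin; apply: eq_bigl => i.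
    by rewrite /q leq0n orbT.
  apply/seteqP; split => x /= h i iN; last by move=> _; exact: h.
  by apply: h => //; rewrite /q leq0n orbT.
have [pk|npk] := boolP (p k).
  have E i : q k.+1 i = q k i.
    rewrite /q; case: ltngtP => // <-; by rewrite pk.
  rewrite [X in m X](_ : _ = [set x | forall i, (i < N)%N -> q k i -> x i = v i]).
    by rewrite ih 1?ltnW//; congr EFin; apply: eq_bigl => i; rewrite E.
  by apply/seteqP; split => x /= h i; have := h i; rewrite E.
have E i : q k i = (i == k) || q k.+1 i.
  by rewrite /q; case: ltngtP => /= _; rewrite ?orbT ?orbF.
have qk : q k.+1 k = false by rewrite /q (negbTE npk) ltnn.
pose v' l i := if i == k then l else v i.
rewrite [X in m X](_ : _ = \bigcup_l [set x | forall i, (i < N)%N -> q k i -> x i = v' l i]); last first.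
  apply/seteqP; split => x /=.
    move=> h; exists (x k) => // i iN; rewrite E /v'; case: eqVneq => [->//|_ /=].
    exact: h.
  move=> [l _ /= h] i iN qi; have := h i iN; rewrite E qi orbT /v' => /(_ isT).
  by case: eqVneq qi => // ->; rewrite qk.
rewrite measure_semi_bigcup//.
- transitivity (\sum_(l <oo) (\prod_(i < N | q k i) a (v' l i))%:E).
    apply: eq_eseriesr => l _.
    transitivity (m [set x | forall i, (i < N)%N -> q k i -> x i = v' l i]) => //.
    by rewrite ih// ltnW.
  transitivity (\sum_(l <oo) ((\prod_(i < N | q k.+1 i) a (v i))%:E * (a l)%:E)).
    apply: eq_eseriesr => l _.
    rewrite (bigD1 (Ordinal kN)) /=; last by rewrite E eqxx.
    rewrite /v' eqxx mulrC -EFinM; congr (_ * _)%:E.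
    apply: eq_big => [i|i /andP[_]]; last by rewrite -val_eqE /= => /negbTE ->.
    rewrite E -val_eqE /=; case: eqVneq => [->|_]; first by rewrite qk.
    by rewrite andbT.
  by rewrite nneseriesZl ?weight_sum ?mule1// => l _; rewrite lee_fin weight_ge0.
- move=> l l' _ _ [x [/(_ k kN) + /(_ k kN)]]; rewrite E eqxx /v' eqxx.
  by move=> /(_ isT) -> /(_ isT).
- exact: bigcupT_measurable.
Qed.

End product_measures.

Section tail_measures.
Context (R : realType) (a : nat -> R) (m : probability (seqspace nat) R).
Hypothesis hm : product_measure a m.
Local Notation mu := (tail_measure m).
Local Notation T := tail_space.
Local Open Scope ereal_scope.

(** The fiber over each x in S contains exactly one point of the graph, and the other fibers contain
    none. *)
Lemma tail_measure_graph (f : seqspace nat -> seqspace nat) (S : set (seqspace nat)) :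
  (forall x, tail_eq x (f x)) -> measurable S ->
  mu [set q | S (tail_val q).1 /\ (tail_val q).2 = f (tail_val q).1] = m S.
Proof.
move=> xf mS; rewrite /= /tail_measure -[in RHS](setIT S) -integral_indic//.
apply: eq_integral => x _; rewrite indicE.
have [xS|xS] := boolP (x \in S).
  rewrite (_ : _ `&` _ = [set (exist _ (x, f x) (xf x) : T)]).
    by rewrite esum_set1.
  apply/seteqP; split => [q [[/= qS q2] qx]|q ->]; last first.
    by split; [split => //; exact: set_mem|].
  by apply: tail_val_inj => //=; rewrite q2 qx.
rewrite (_ : _ `&` _ = set0) ?esum_set0//.
by apply/seteqP; split => // q [[/= qS _] qx]; move: xS; rewrite -qx mem_set.
Qed.

Definition splice n (v x : nat -> nat) : nat -> nat := fun i => if (i < n)%N then v i else x i.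

Lemma tail_eq_splice n v x : tail_eq x (splice n v x).
Proof. by exists n => i ni; rewrite /splice ltnNge ni. Qed.

(** The cylinder is the graph of [splice n v] over [cyl n u]; the second word therefore has no
    influence on the measure. *)
Lemma measure_pair_cyl n u v : mu (pair_cyl n u v) = (word_weight a n u)%:E.
Proof.
rewrite -(measure_cyl hm) -(tail_measure_graph (@tail_eq_splice n v) (measurable_cyl n u)).
congr (mu _); apply/seteqP; split => q.
  move=> [q1 q2 q3]; split => //; apply/funext => i; rewrite /splice.
  by case: ltnP => ni; [exact: q2|rewrite q3].
move=> [q1 q2]; split => // [i ni|i ni]; rewrite q2 /splice.
  by rewrite ni.
by rewrite ltnNge ni.
Qed.

(** Reduces measure preservation to cylinders of length at least n0: the two measures compared are
    finite there, and agreement there makes them equal. *)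
Lemma partial_iso_tail n0 (D : set T) F D' G : measurable D -> measurable D' ->
  measurable_fun setT F -> measurable_fun setT G ->
  (forall q, D q -> D' (F q) /\ G (F q) = q) ->
  (forall q, D' q -> D (G q) /\ F (G q) = q) ->
  (forall n u v, (n0 <= n)%N -> mu (D `&` F @^-1` pair_cyl n u v) = mu (D' `&` pair_cyl n u v)) ->
  partial_iso mu D F D' G.
Proof.
move=> mD mD' mF mG DF DG E; split => //; try by move=> q /DF[]; try by move=> q /DG[].
- by move=> q /DG[].
- by move=> q /DG[].
move=> A mA.
have := @tail_measure_unique R
  (measure_function_pushforward__canonical__measure_function_Measure (mrestr mu mD) mF)
  (mrestr mu mD') n0.
rewrite /= /pushforward /mrestr => U.
rewrite (setIC D) (setIC D'); apply: U => // n u v n0n.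
  by rewrite setIC E// setIC.
rewrite setIC E//; apply: (@le_lt_trans _ _ (mu (pair_cyl n u v))).
  by apply: le_measure; rewrite ?inE//; [apply: measurableI => //|]; exact: measurable_pair_cyl.
by rewrite measure_pair_cyl ltry.
Qed.

End tail_measures.

Section operators_on_tail.
Context (R : realType) (a : nat -> R) (m : probability (seqspace nat) R).
Hypothesis hm : product_measure a m.
Local Notation mu := (tail_measure m).
Local Notation T := tail_space.
Local Notation C := R[i].

Definition L2indic (A : set T) : L2 mu := L2real mu (\1_A).

Lemma extend0_indic (D A : set T) F :
  extend0 D ((fun q => (\1_A q : R)%:C) \o F) = (fun q => (\1_(D `&` F @^-1` A) q : R)%:C).
Proof.
apply/funext => q; rewrite /extend0 /= !indicE in_setI.
case: asboolP => Dq; first by rewrite (mem_set Dq).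
by rewrite (memNset Dq).
Qed.

Lemma pull_op_L2indic D F D' G A : partial_iso mu D F D' G -> measurable A ->
  (mu A < +oo)%E -> pull_op D F (L2indic A) = L2indic (D `&` F @^-1` A).
Proof.
move=> P mA Aoo; rewrite /L2indic /L2real (pull_op_of P) ?extend0_indic//.
exact: L2pred_indic.
Qed.

Lemma dot_L2indic A B : measurable A -> measurable B -> (mu A < +oo)%E -> (mu B < +oo)%E ->
  L2dot (L2indic A) (L2indic B) = (fine (mu (A `&` B)))%:C.
Proof.
move=> mA mB Aoo Boo; rewrite /L2indic /L2real L2dotE; try exact: L2pred_indic.
have E : (fun q => (\1_A q : R)%:C * conjc (\1_B q : R)%:C) = (fun q => (\1_(A `&` B) q : R)%:C).
  by apply/funext => q; rewrite conjc_real -rmorphM indicI.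
rewrite E /cint; apply/eqP; rewrite eq_complex /=; apply/andP; split; apply/eqP.
  by rewrite /Rintegral integral_indic ?setIT//; exact: measurableI.
by rewrite Rintegral_cst// mul0r.
Qed.

Definition diag : set T := [set q | (tail_val q).1 = (tail_val q).2].

Lemma diagE u : diag = pair_cyl 0 u u.
Proof.
apply/seteqP; split => q; first by move=> qE; split => // i _; rewrite qE.
by move=> [_ _ h]; apply/funext => i; exact: h.
Qed.

Lemma measurable_diag : measurable diag.
Proof. by rewrite (diagE (fun=> 0%N)); exact: measurable_pair_cyl. Qed.

Lemma mu_diag : mu diag = 1%E.
Proof. by rewrite (diagE (fun=> 0%N)) (measure_pair_cyl hm) /word_weight big_ord0. Qed.

Definition xi : L2 mu := L2indic diag.

Definition cyl_vec n u v : L2 mu := L2indic (pair_cyl n u v).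

Lemma pair_cyl_lty n u v : (mu (pair_cyl n u v) < +oo)%E.
Proof. by rewrite (measure_pair_cyl hm) ltry. Qed.

Lemma dot_xi : L2dot xi xi = 1.
Proof.
by rewrite dot_L2indic ?mu_diag ?ltry ?setIid ?mu_diag//; exact: measurable_diag.
Qed.

End operators_on_tail.

(** * The action of partial injections and its commutant *)

Section tail_maps.

Lemma tail_eq_sym (V : Type) (x y : nat -> V) : tail_eq x y -> tail_eq y x.
Proof. by move=> [n h]; exists n => i /h. Qed.

Lemma tail_eq_trans (V : Type) (x y z : nat -> V) : tail_eq x y -> tail_eq y z -> tail_eq x z.
Proof.
move=> [n h] [k h']; exists (maxn n k) => i; rewrite geq_max => /andP[/h-> /h'//].
Qed.

Definition left_map (f : seqspace nat -> seqspace nat) (hf : forall x, tail_eq x (f x))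
    (q : tail_space) : tail_space :=
  exist _ (f (tail_val q).1, (tail_val q).2) (tail_eq_trans (tail_eq_sym (hf _)) (tail_valP q)).

Definition right_map (f : seqspace nat -> seqspace nat) (hf : forall x, tail_eq x (f x))
    (q : tail_space) : tail_space :=
  exist _ ((tail_val q).1, f (tail_val q).2) (tail_eq_trans (tail_valP q) (hf _)).

Definition tail_swap (q : tail_space) : tail_space :=
  exist _ ((tail_val q).2, (tail_val q).1) (tail_eq_sym (tail_valP q)).

Lemma measurable_tail_swap : measurable_fun setT tail_swap.
Proof.
by apply: measurable_tail_map => i v; [exact: measurable_tail_snd|exact: measurable_tail_fst].
Qed.

(** The hypothesis is the common form of [pull] and [splice]: each letter of f x is either a letter
    of x or a constant, j and w being dummies in the second case. *)
Lemma measurable_left_map f hf :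
  (forall i v, exists j w, [set x | f x i = v] = [set x | x j = w] \/
     [set x | f x i = v] = setT \/ [set x | f x i = v] = set0) ->
  measurable_fun setT (@left_map f hf).
Proof.
move=> mf; apply: measurable_tail_map => i v; last exact: measurable_tail_snd.
rewrite -[[set q | _]]/((fun q : tail_space => (tail_val q).1) @^-1` [set x | f x i = v]).
have [j [w [->|[->|->]]]] := mf i v; last exact: measurable0.
  exact: measurable_tail_fst.
exact: measurableT.
Qed.

Lemma measurable_right_map f hf :
  (forall i v, exists j w, [set x | f x i = v] = [set x | x j = w] \/
     [set x | f x i = v] = setT \/ [set x | f x i = v] = set0) ->
  measurable_fun setT (@right_map f hf).
Proof.
move=> mf; apply: measurable_tail_map => i v; first exact: measurable_tail_fst.
rewrite -[[set q | _]]/((fun q : tail_space => (tail_val q).2) @^-1` [set x | f x i = v]).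
have [j [w [->|[->|->]]]] := mf i v; last exact: measurable0.
  exact: measurable_tail_snd.
exact: measurableT.
Qed.

Definition pull (s : Rinf) (x : nat -> nat) (i : nat) : nat :=
  if s i is Some j then x j else 0%N.

Lemma tail_eq_pull s x : tail_eq x (pull s x).
Proof. by have [n sn] := rmap_fix s; exists n => i ni; rewrite /pull sn. Qed.

Lemma const_set (T : Type) (P : Prop) : [set _ : T | P] = setT \/ [set _ : T | P] = set0.
Proof. by have [h|h] := pselect P; [left|right]; apply/seteqP; split. Qed.

Lemma pull_coord s i v : exists j w, [set x | pull s x i = v] = [set x | x j = w] \/
     [set x | pull s x i = v] = setT \/ [set x | pull s x i = v] = set0.
Proof.
rewrite /pull; case: (s i) => [j|]; first by exists j, v; left.
by exists 0%N, 0%N; right; exact: const_set.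
Qed.

Lemma splice_coord n u i v : exists j w, [set x | splice n u x i = v] = [set x | x j = w] \/
     [set x | splice n u x i = v] = setT \/ [set x | splice n u x i = v] = set0.
Proof.
rewrite /splice; case: (i < n)%N; first by exists 0%N, 0%N; right; exact: const_set.
by exists i, v; left.
Qed.

Lemma rinverse_ex (s : Rinf) : exists t, rinverse s t.
Proof.
pose f j := if pselect (exists i, s i = Some j) is left h then Some (projT1 (cid h)) else None.
have fP i j : s i = Some j <-> f j = Some i.
  rewrite /f; case: pselect => [h|h].
    split=> [E|[<-]]; last exact: (projT2 (cid h)).
    by congr Some; apply: (@rmap_inj s _ _ j) => //; exact: (projT2 (cid h)).
  by split => // E; case: h; exists i.
have f_inj i j k : f i = Some k -> f j = Some k -> i = j.
  by move=> /fP E /fP; rewrite E => -[].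
have f_fix : exists n, forall i, (n <= i)%N -> f i = Some i.
  by have [n sn] := rmap_fix s; exists n => i ni; apply/fP; exact: sn.
by exists (MkRinf f_inj f_fix).
Qed.

Definition rinv (s : Rinf) : Rinf := projT1 (cid (rinverse_ex s)).

Lemma rinvP s : rinverse s (rinv s).
Proof. exact: (projT2 (cid (rinverse_ex s))). Qed.

Lemma rinverse_sym s t : rinverse s t -> rinverse t s.
Proof. by move=> st i j; split => /st. Qed.

Lemma in_Rn_inverse n s t : rinverse s t -> in_Rn n s -> in_Rn n t.
Proof. by move=> st sn i ni; apply/st; exact: sn. Qed.

Lemma in_Rn_lt n s i j : in_Rn n s -> (i < n)%N -> s i = Some j -> (j < n)%N.
Proof.
move=> sn iN si; rewrite ltnNge; apply/negP => nj.
by have := @rmap_inj s i j j si (sn j nj) => E; rewrite E ltnNge nj in iN.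
Qed.

Lemma in_RnW n k s : (n <= k)%N -> in_Rn n s -> in_Rn k s.
Proof. by move=> nk sn i ki; apply: sn; exact: leq_trans ki. Qed.

Definition vanish (s : Rinf) (x : nat -> nat) : Prop :=
  forall j, (forall i, s i <> Some j) -> x j = 0%N.

Lemma vanish_inv s t x : rinverse s t -> vanish s x <-> (forall j, t j = None -> x j = 0%N).
Proof.
move=> st; split=> h j hj; apply: h.
  by move=> i /st; rewrite hj.
by case E : (t j) => [i|//]; have /st := E; move=> /hj.
Qed.

Lemma vanish_pull s t x : rinverse s t -> vanish t (pull s x).
Proof.
by move=> st; apply/(vanish_inv _ (rinverse_sym st)) => j sj; rewrite /pull sj.
Qed.

Lemma pullK s t x : rinverse s t -> vanish s x -> pull t (pull s x) = x.
Proof.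
move=> st /(vanish_inv _ st) vx; apply/funext => j; rewrite {1}/pull.
case E : (t j) => [i|]; last by rewrite vx.
by have /st := E; rewrite /pull => ->.
Qed.

Lemma pull_rmul s t x : pull (rmul s t) x = pull t (pull s x).
Proof. by apply/funext => i; rewrite /pull /=; case: (t i). Qed.

(** A position missed by the product is either missed by s or the image under s of a position missed
    by t. *)
Lemma vanish_rmul s t x : vanish (rmul s t) x <-> vanish s x /\ vanish t (pull s x).
Proof.
split=> [h|[h1 h2] j hj].
  split=> j hj.
    by apply: h => i /=; case: (t i) => //= k; exact: hj.
  rewrite /pull; case sj : (s j) => [k|//]; apply: h => i /=.
  case ti : (t i) => [l|//] /= sl.
  by apply: (hj i); rewrite ti; congr Some; exact: (rmap_inj sl sj).
have [[i si]|nsi] := pselect (exists i, s i = Some j); last first.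
  by apply: h1 => i si; apply: nsi; exists i.
have := h2 i; rewrite /pull si; apply => k tk; apply: (hj k).
by rewrite /= tk.
Qed.

End tail_maps.

(** The positions in the domain of s correspond to those in its image with the same letters. The
    remaining positions, equally many on both sides, all carry the letter 0. A general commutative
    operation covers both the weights of words and their letter counts. *)
Lemma big_pull (R : Type) (idx : R) (op : Monoid.com_law idx) (a : nat -> R) n s t (x : nat -> nat) :
  rinverse s t -> in_Rn n s ->
  (forall j, (j < n)%N -> t j = None -> x j = 0%N) ->
  \big[op/idx]_(i < n) a (pull s x i) = \big[op/idx]_(i < n) a (x i).
Proof.
move=> st sn vx; have tn := in_Rn_inverse st sn.
(* The partial injection r completed by the identity to a self-map of 'I_n. By [PQ] below, the
   condition left by [reindex_onto] describes exactly the domain of s. *)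
pose f (r : Rinf) (i : 'I_n) : 'I_n := insubd i (odflt (val i) (r i)).
have fE (r : Rinf) : in_Rn n r -> forall (i : 'I_n) j, r i = Some j -> f r i = j :> nat.
  move=> rn i j ri; rewrite /f ri -[LHS]/(val (insubd i j)) val_insubd.
  by rewrite (in_Rn_lt rn (ltn_ord i) ri).
have fN (r : Rinf) (i : 'I_n) : r i = None -> f r i = i.
  by move=> ri; apply: val_inj; rewrite /f ri /= val_insubd ltn_ord.
have PQ (i : 'I_n) : (t (f s i) != None) && (f t (f s i) == i) = (s i != None).
  case si : (s i) => [j|].
    have fi := fE s sn i j si; have tj : t j = Some (i : nat) by apply/st.
    rewrite fi tj /=; apply/eqP/val_inj.
    by apply: fE => //; rewrite fi.
  rewrite (fN _ _ si) /=; case ti : (t i) => [j|//] /=.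
  apply/negbTE/eqP => E; have := fE t tn i j ti; rewrite E => ij.
  by move: ti; rewrite -ij => /st; rewrite si.
have R1 (F : nat -> R) : \big[op/idx]_(j < n | t j != None) F j =
    \big[op/idx]_(i < n | s i != None) F (f s i).
  rewrite (reindex_onto (f s) (f t)) /=.
    by apply: eq_bigl => i; exact: PQ.
  move=> j; case tj : (t j) => [i|//] _; apply: val_inj.
  have fj := fE t tn j i tj; apply: fE => //; rewrite fj; exact/st.
have card : #|[pred i : 'I_n | ~~ (s i != None)]| = #|[pred j : 'I_n | ~~ (t j != None)]|.
  have : #|[pred i : 'I_n | s i != None]| = #|[pred j : 'I_n | t j != None]|.
    rewrite -!sum1_card; symmetry; rewrite (reindex_onto (f s) (f t)) /=.
      by apply: eq_bigl => i; exact: PQ.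
    move=> j; rewrite inE; case tj : (t j) => [i|//] _; apply: val_inj.
    have fj := fE t tn j i tj; apply: fE => //; rewrite fj; exact/st.
  have := cardC [pred i : 'I_n | s i != None]; have := cardC [pred j : 'I_n | t j != None].
  move=> <- /eqP + E; rewrite E eqn_add2l => /eqP h.
  exact: h.
rewrite (bigID (fun i : 'I_n => s i != None)) /= [RHS](bigID (fun j : 'I_n => t j != None)) /=.
congr (op _ _).
  rewrite (R1 (fun j => a (x j))); apply: eq_bigr => i.
  by case si : (s i) => [j|//] _; rewrite /pull si (fE s sn i j si).
rewrite (eq_bigr (fun=> a 0%N)); last first.
  by move=> i; rewrite negbK => /eqP si; rewrite /pull si.
rewrite [RHS](eq_bigr (fun=> a 0%N)); last first.
  by move=> j; rewrite negbK => /eqP tj; rewrite vx.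
by rewrite !big_const card.
Qed.

Definition letter_count (n c : nat) (x : nat -> nat) : nat := (\sum_(i < n) (x i == c))%N.

(** Equal letter counts make the two words permutations of one another. *)
Lemma letter_count_big (R : Type) (idx : R) (op : Monoid.com_law idx) (a : nat -> R) n x y :
  (forall c, letter_count n c x = letter_count n c y) ->
  \big[op/idx]_(i < n) a (x i) = \big[op/idx]_(i < n) a (y i).
Proof.
move=> xy; have iE : iota 0 n = index_iota 0 n by rewrite /index_iota subn0.
have cE z c : letter_count n c z = count_mem c (mkseq z n).
  rewrite /letter_count -sum1_count /mkseq big_map iE big_mkord [RHS]big_mkcond.
  by apply: eq_bigr => i _ /=; case: eqP.
have bE (z : nat -> nat) : \big[op/idx]_(i < n) a (z i) = \big[op/idx]_(v <- mkseq z n) a v.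
  by rewrite /mkseq big_map iE big_mkord.
rewrite !bE; apply: perm_big; apply/allP => c _ /=.
by rewrite -!cE xy.
Qed.

(** Past n both counts grow by the same amount, so the comparison of the counts does not depend on
    the length while the counts themselves do. *)
Lemma letter_count_ext n k c x y : (n <= k)%N -> (forall i, (n <= i)%N -> x i = y i) ->
  (letter_count k c x == letter_count k c y) = (letter_count n c x == letter_count n c y).
Proof.
move=> nk xy; rewrite /letter_count -!(big_mkord xpredT (fun i => (_ i == c) : nat)).
rewrite (@big_cat_nat _ _ _ n)//= [X in _ == X](@big_cat_nat _ _ _ n)//=.
rewrite [X in _ == (_ + X)%N](eq_big_nat _ _ (F2 := fun i => (x i == c) : nat)).
  by rewrite eqn_add2r.
by move=> i /andP[ni _]; rewrite xy.
Qed.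

Section pull_op_algebra.
Context d (T : measurableType d) (R : realType).
Variable mu : {measure set T -> \bar R}.

Lemma pull_op_comp D1 F1 D1' G1 D2 F2 D2' G2 D3 (F3 : T -> T) :
  partial_iso mu D1 F1 D1' G1 -> partial_iso mu D2 F2 D2' G2 ->
  (forall q, D3 q <-> D1 q /\ D2 (F1 q)) -> (forall q, D3 q -> F3 q = F2 (F1 q)) ->
  forall v : L2 mu, pull_op D1 F1 (pull_op D2 F2 v) = pull_op D3 F3 v.
Proof.
move=> P1 P2 D3E F3E v.
rewrite [pull_op D2 F2 v]/pull_op (pull_op_of P1); last exact: (L2pred_pull P2 (L2repr_pred v)).
congr L2of; apply/funext => q; rewrite /extend0 /=.
case: (asboolP (D1 q)) => d1; last by rewrite asboolF// => /D3E[].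
case: (asboolP (D2 (F1 q))) => d2; last by rewrite asboolF// => /D3E[].
have d3 : D3 q by apply/D3E.
by rewrite asboolT// F3E.
Qed.

Lemma pull_op_comm D1 F1 D1' G1 D2 F2 D2' G2 :
  partial_iso mu D1 F1 D1' G1 -> partial_iso mu D2 F2 D2' G2 ->
  (forall q, D1 q /\ D2 (F1 q) <-> D2 q /\ D1 (F2 q)) ->
  (forall q, D1 q -> D2 (F1 q) -> F2 (F1 q) = F1 (F2 q)) ->
  pull_op D1 F1 \o pull_op D2 F2 = pull_op D2 F2 \o pull_op D1 F1 :> (L2 mu -> L2 mu).
Proof.
move=> P1 P2 DE FE; apply/funext => v /=.
rewrite (pull_op_comp (D3 := [set q | D1 q /\ D2 (F1 q)]) (F3 := F2 \o F1) P1 P2)//.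
rewrite (pull_op_comp (D3 := [set q | D1 q /\ D2 (F1 q)]) (F3 := F2 \o F1) P2 P1)//.
by move=> q /= [d1 d2]; exact: FE.
Qed.

Lemma pull_op_id (D : set T) F (v : L2 mu) : (forall q, D q) -> (forall q, F q = q) ->
  pull_op D F v = v.
Proof.
move=> DT Fid; rewrite -[RHS](L2of_repr v) /pull_op; congr L2of; apply/funext => q.
by rewrite /extend0 asboolT //= Fid.
Qed.

End pull_op_algebra.

Section representation.
Context (R : realType) (a : nat -> R) (m : probability (seqspace nat) R).
Hypothesis hm : product_measure a m.
Local Notation mu := (tail_measure m).
Local Notation T := tail_space.
Local Notation C := R[i].

Definition left_dom (s : Rinf) : set T := [set q | vanish s (tail_val q).1].
Definition left_pull (s : Rinf) : T -> T := left_map (tail_eq_pull s).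
Definition right_pull (s : Rinf) : T -> T := right_map (tail_eq_pull s).
Definition right_cyl n v : set T := [set q | cyl n v (tail_val q).2].
Definition right_splice n u : T -> T := right_map (tail_eq_splice n u).

Lemma measurable_left_dom s : measurable (left_dom s).
Proof.
by apply: (@measurable_forall (fun j => forall i, s i <> Some j)) => j; exact: measurable_tail_fst.
Qed.

(** Take a cylinder longer than the support of s. Either u has a nonzero letter where s is
    undefined, and both sets to be compared are empty; or the preimage is the cylinder with first
    word [pull t u], of the same weight as u by [big_pull]. *)
Lemma left_iso s t : rinverse s t ->
  partial_iso mu (left_dom s) (left_pull s) (left_dom t) (left_pull t).
Proof.
move=> st; have ts := rinverse_sym st; have [n0 sn0] := rmap_fix s.
apply: (partial_iso_tail hm (n0 := n0)).
- exact: measurable_left_dom.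
- exact: measurable_left_dom.
- exact: measurable_left_map (pull_coord s).
- exact: measurable_left_map (pull_coord t).
- move=> q qs; split; first exact: vanish_pull.
  by apply: tail_val_inj => //=; exact: pullK.
- move=> q qs; split; first exact: vanish_pull.
  by apply: tail_val_inj => //=; exact: pullK.
move=> n u v n0n; have sn := in_RnW n0n sn0; have tn := in_Rn_inverse st sn.
have [uz|uz] := pselect (forall j, (j < n)%N -> s j = None -> u j = 0%N); last first.
  transitivity (mu set0); last (congr (mu _); symmetry).
    congr (mu _); apply/seteqP; split => // q [_ [q1 _ _]].
    by apply: uz => j jn sj; rewrite -q1//= /pull sj.
  apply/seteqP; split => // q [/(vanish_inv _ ts) qv [q1 _ _]].
  by apply: uz => j jn sj; rewrite -q1// qv.
have -> : left_dom s `&` left_pull s @^-1` pair_cyl n u v = pair_cyl n (pull t u) v.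
  apply/seteqP; split => q.
    move=> [/(vanish_inv _ st) qv [/= q1 q2 q3]]; split => // [j jn|i ni].
      rewrite /pull; case tj : (t j) => [i|]; last by rewrite qv.
      have si : s i = Some j by apply/st.
      by rewrite -q1 ?(in_Rn_lt tn jn tj)// /pull si.
    by rewrite -q3// /pull sn.
  move=> [q1 q2 q3]; split; [apply/(vanish_inv _ st) => j tj|split] => //=.
  - have jn : (j < n)%N by rewrite ltnNge; apply/negP => nj; rewrite tn in tj.
    by rewrite q1// /pull tj.
  - move=> i iN; rewrite /pull; case si : (s i) => [j|]; last by rewrite uz.
    have tj : t j = Some i by apply/st.
    by rewrite q1 ?(in_Rn_lt sn iN si)// /pull tj.
  - by move=> i ni; rewrite /pull sn//; exact: q3.
have -> : left_dom t `&` pair_cyl n u v = pair_cyl n u v.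
  apply: setIidr => q [q1 q2 q3]; apply/(vanish_inv _ ts) => j sj.
  have jn : (j < n)%N by rewrite ltnNge; apply/negP => nj; rewrite sn in sj.
  by rewrite q1// uz.
by rewrite !(measure_pair_cyl hm) /word_weight (big_pull _ _ ts).
Qed.

(** Pigeonhole: s restricts to an injection of the finite set {0, ..., n-1} into itself, which is
    therefore onto. *)
Lemma Sinf_inverse s t : in_Sinf s -> rinverse s t -> in_Sinf t.
Proof.
move=> ss st j tj; have [n sn] := rmap_fix s.
have tn := in_Rn_inverse st sn.
have jn : (j < n)%N by rewrite ltnNge; apply/negP => nj; rewrite tn in tj.
have f_ltn (i : 'I_n) : (odflt 0 (s i) < n)%N.
  by case si : (s i) => [k|]; [exact: (in_Rn_lt sn (ltn_ord i) si)|case: (ss i)].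
pose f i := Ordinal (f_ltn i).
have f_inj : injective f.
  move=> i k /(congr1 val) /=.
  case si : (s i) => [x|]; last by case: (ss i).
  case sk : (s k) => [y|]; last by case: (ss k).
  by move=> /= xy; apply: val_inj; apply: (rmap_inj si); rewrite xy.
have [g fg gf] := injF_bij f_inj.
have := congr1 val (gf (Ordinal jn)) => /=.
case si : (s (g (Ordinal jn))) => [k|] /=; last by case: (ss (g (Ordinal jn))).
by move=> kj; move: si; rewrite kj => /st; rewrite tj.
Qed.

Lemma Sinf_vanish s x : in_Sinf s -> vanish s x.
Proof.
move=> ss; apply/(vanish_inv _ (rinvP s)) => j tj.
by case: (Sinf_inverse ss (rinvP s) tj).
Qed.

Lemma right_iso s t : in_Sinf s -> rinverse s t ->
  partial_iso mu setT (right_pull s) setT (right_pull t).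
Proof.
move=> ss st; have ts := rinverse_sym st; have [n0 sn0] := rmap_fix s.
have tt := Sinf_inverse ss st.
apply: (partial_iso_tail hm (n0 := n0)) => //.
- exact: measurable_right_map (pull_coord s).
- exact: measurable_right_map (pull_coord t).
- by move=> q _; split => //; apply: tail_val_inj => //=; apply: pullK => //; exact: Sinf_vanish.
- by move=> q _; split => //; apply: tail_val_inj => //=; apply: pullK => //; exact: Sinf_vanish.
move=> n u v n0n; have sn := in_RnW n0n sn0; have tn := in_Rn_inverse st sn.
rewrite !setTI (_ : _ @^-1` _ = pair_cyl n u (pull t v)).
  by rewrite !(measure_pair_cyl hm).
apply/seteqP; split => q [/= q1 q2 q3]; split => //.
- move=> j jn; rewrite /pull; case tj : (t j) => [i|]; last by case: (tt j).
  have si : s i = Some j by apply/st.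
  by rewrite -q2 ?(in_Rn_lt tn jn tj)// /pull si.
- by move=> i ni; rewrite q3// /pull sn.
- move=> i iN /=; rewrite /pull; case si : (s i) => [j|]; last by case: (ss i).
  have tj : t j = Some i by apply/st.
  by rewrite q2 ?(in_Rn_lt sn iN si)// /pull tj.
- by move=> i ni; rewrite /= q3// /pull sn.
Qed.

Lemma splice_id n u x : cyl n u x -> splice n u x = x.
Proof. by move=> xu; apply/funext => i; rewrite /splice; case: ltnP => // /xu. Qed.

Lemma splice_splice n u v x : splice n u (splice n v x) = splice n u x.
Proof. by apply/funext => i; rewrite /splice; case: (i < n)%N. Qed.

Lemma cyl_splice n u x : cyl n u (splice n u x).
Proof. by move=> i iN; rewrite /splice iN. Qed.

Lemma splice_iso n u v :
  partial_iso mu (right_cyl n v) (right_splice n u) (right_cyl n u) (right_splice n v).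
Proof.
apply: (partial_iso_tail hm (n0 := n)).
- exact: measurable_cyl_snd.
- exact: measurable_cyl_snd.
- exact: measurable_right_map (splice_coord n u).
- exact: measurable_right_map (splice_coord n v).
- move=> q qv; split; first exact: cyl_splice.
  by apply: tail_val_inj => //=; rewrite splice_splice splice_id.
- move=> q qv; split; first exact: cyl_splice.
  by apply: tail_val_inj => //=; rewrite splice_splice splice_id.
move=> k u' v' nk.
have [vu|vu] := pselect (cyl n u v'); last first.
  congr (mu _); apply/seteqP; split => q [qc [q1 q2 q3]]; case: vu => i iN.
    by rewrite -q2 ?(leq_trans iN nk)//= /splice iN.
  by rewrite -q2 ?(leq_trans iN nk)// qc.
have -> : right_cyl n v `&` right_splice n u @^-1` pair_cyl k u' v' = pair_cyl k u' (splice n v v').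
  apply/seteqP; split => q.
    move=> [qv [/= q1 q2 q3]]; split => // [i ik|i ki].
      rewrite /splice; case: ltnP => ni; first exact: qv.
      by rewrite -q2// /splice ltnNge ni.
    by rewrite q3// /splice ltnNge (leq_trans nk ki).
  move=> [q1 q2 q3]; split => [i iN|]; first by rewrite q2 ?(leq_trans iN nk)// /splice iN.
  split => //= i ki.
    rewrite /splice; case: ltnP => ni; first by rewrite vu.
    by rewrite q2// /splice ltnNge ni.
  by rewrite /splice ltnNge (leq_trans nk ki)/= q3.
have -> : right_cyl n u `&` pair_cyl k u' v' = pair_cyl k u' v'.
  by apply: setIidr => q [q1 q2 q3] i iN; rewrite q2 ?(leq_trans iN nk)// vu.
by rewrite !(measure_pair_cyl hm).
Qed.

(** The counts are compared at one n past which the sequences agree; by [balancedP] every such n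
    gives the same condition. *)
Definition balanced : set T := [set q | exists n,
  (forall i, (n <= i)%N -> (tail_val q).1 i = (tail_val q).2 i) /\
  forall c, letter_count n c (tail_val q).1 = letter_count n c (tail_val q).2].

Lemma balancedP q n : (forall i, (n <= i)%N -> (tail_val q).1 i = (tail_val q).2 i) ->
  balanced q <-> forall c, letter_count n c (tail_val q).1 = letter_count n c (tail_val q).2.
Proof.
move=> qn; split=> [[k [qk h]] c|h]; last by exists n.
apply/eqP; rewrite -(letter_count_ext _ (leq_maxl n k) qn).
by rewrite (letter_count_ext _ (leq_maxr n k) qk) h.
Qed.

Lemma letter_count_cyl n c u x : cyl n u x -> letter_count n c x = letter_count n c u.
Proof. by move=> xu; apply: eq_bigr => i _; rewrite xu. Qed.

Lemma balanced_pair_cyl n u v q : pair_cyl n u v q ->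
  balanced q <-> forall c, letter_count n c u = letter_count n c v.
Proof.
move=> [q1 q2 q3]; rewrite (balancedP q3).
by split => h c; have := h c; rewrite (letter_count_cyl _ q1) (letter_count_cyl _ q2).
Qed.

Lemma measurable_balanced : measurable balanced.
Proof.
rewrite (_ : balanced = \bigcup_(k in [set k | if cyl_code k is Some (n, su, sv) then
    forall c, letter_count n c (nth 0%N su) = letter_count n c (nth 0%N sv) else False])
    pair_cyl_enum 0 k).
  apply: bigcup_measurable => k _; have [->|[n [u [v [_ ->]]]]] := pair_cyl_enumP 0 k.
    exact: measurable0.
  exact: measurable_pair_cyl.
apply/seteqP; split => q.
  have [n qn] := tail_valP q.
  have kq := @pair_cyl_pickle 0 n q (leq0n n) qn.
  exists (choice.pickle (n, mkseq (tail_val q).1 n, mkseq (tail_val q).2 n)) => //=.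
  move: kq; rewrite /pair_cyl_enum /cyl_code choice.pickleK /= => kq.
  exact/(balanced_pair_cyl kq).
move=> [k /=]; rewrite /pair_cyl_enum; case: (cyl_code k) => [[[n su] sv]|//] /= h kq.
exact/(balanced_pair_cyl kq).
Qed.

Lemma balanced_iso : partial_iso mu balanced id balanced id.
Proof.
by split => //; exact: measurable_balanced.
Qed.

Lemma balanced_swap q : balanced (tail_swap q) <-> balanced q.
Proof.
by split => -[n [h1 h2]]; exists n; split => [i /h1|c]//; exact: esym (h2 c).
Qed.

(** A cylinder is either disjoint from [balanced] or contained in it. In the second case u and v are
    permutations of one another and have equal weight, so exchanging them does not change the
    measure. *)
Lemma swap_iso : partial_iso mu balanced tail_swap balanced tail_swap.
Proof.
apply: (partial_iso_tail hm (n0 := 0)).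
- exact: measurable_balanced.
- exact: measurable_balanced.
- exact: measurable_tail_swap.
- exact: measurable_tail_swap.
- by move=> q qb; split; [exact/balanced_swap|exact: tail_val_inj].
- by move=> q qb; split; [exact/balanced_swap|exact: tail_val_inj].
move=> n u v _.
have swE : tail_swap @^-1` pair_cyl n u v = pair_cyl n v u.
  by apply/seteqP; split => q [q1 q2 q3]; split => // i /q3.
rewrite swE.
have [uv|uv] := pselect (forall c, letter_count n c u = letter_count n c v); last first.
  congr (mu _); apply/seteqP; split => q [qb qc]; case: uv.
    by move=> c; symmetry; exact: ((balanced_pair_cyl qc).1 qb).
  exact: ((balanced_pair_cyl qc).1 qb).
rewrite !(setIidr (A := balanced)).
- rewrite !(measure_pair_cyl hm) /word_weight; congr EFin; apply: (@letter_count_big _ _ _ a) => c.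
  by rewrite uv.
- by move=> q qc; apply/(balanced_pair_cyl qc).
- by move=> q qc; apply/(balanced_pair_cyl qc) => c; rewrite uv.
Qed.

Definition rep (s : Rinf) : L2tail m -> L2tail m := pull_op (left_dom s) (left_pull s).

End representation.

Section L2_closed.
Context d (T : measurableType d) (R : realType).
Variable mu : {measure set T -> \bar R}.
Local Notation C := R[i].
Local Notation H := (L2 mu).
Local Notation dot := (@L2dot _ _ _ mu).

(** If U vanishes on all u n, then U v = U (v - u n), whose size is at most K times [nsq (v - u n)]
    and tends to 0. The general target V with its size N serves for operators, with N = [nsq], and
    for functionals, with N = [sqnorm]. *)
Lemma closed_subspace_ker (V : lmodType C) (U : H -> V) (N : V -> R) (K : R) :
  linear U -> (forall v, 0 <= N v) -> (forall v, N v = 0 -> v = 0) ->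
  (forall f, N (U f) <= K * nsq f) -> closed_subspace (fun f => U f = 0).
Proof.
move=> lU N0 Neq0 NU.
have U0 : U 0 = 0.
  have := lU 1 0 0; rewrite !scale1r addr0 => h.
  by apply: (@addrI _ (U 0)); rewrite addr0 -h.
split => // [a u v uz vz|v u uz uv]; first by rewrite lU uz vz scaler0 addr0.
apply: Neq0; apply/eqP; rewrite eq_le N0 andbT.
have E n : U v = U (v - u n).
  by rewrite -scaleN1r addrC lU uz scaler0 add0r.
have cv : (fun n => K * nsq (v - u n)) @ \oo --> K * 0 by apply: cvgM => //; exact: cvg_cst.
rewrite mulr0 in cv.
rewrite -(cvg_lim (@Rhausdorff _) cv); apply: limr_ge; first by apply/cvg_ex; exists 0.
by apply: nearW => n; rewrite (E n).
Qed.

(** The sum of J of the vectors has squared norm J c and inner product J z with eta. Cauchy-Schwarz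
    then bounds J |z|^2 by [nsq eta * c] for every J. *)
Lemma orthogonal_sum_bound (f : nat -> H) (eta : H) (c : R) (z : C) :
  (forall j k, j != k -> dot (f j) (f k) = 0) -> (forall j, nsq (f j) = c) ->
  (forall j, dot eta (f j) = z) -> z = 0.
Proof.
move=> fo fc fz.
pose s J := \sum_(j < J) f j.
have zs J : dot eta (s J) = J%:R * z.
  elim: J => [|J ih]; first by rewrite /s big_ord0 L2dot0r mul0r.
  by rewrite /s big_ord_recr /= L2dotDr -/(s J) ih fz -natr1 mulrDl mul1r.
have so J k : (J <= k)%N -> dot (s J) (f k) = 0.
  elim: J => [|J ih] Jk; first by rewrite /s big_ord0 L2dot0l.
  rewrite /s big_ord_recr /= L2dotDl -/(s J) ih ?(ltnW Jk)// fo ?addr0//.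
  by rewrite neq_ltn Jk.
have ns J : nsq (s J) = J%:R * c.
  elim: J => [|J ih]; first by rewrite /s big_ord0 /nsq L2dot0l mul0r.
  apply: complexI; rewrite -nsqE /s big_ord_recr /= -/(s J) L2dotDl !L2dotDr.
  rewrite so// [dot (f J) (s J)]L2dotC so// conjc0 addr0 add0r !nsqE ih fc.
  by rewrite -rmorphD -natr1 mulrDl mul1r.
have bound J : (J.+1)%:R * sqnorm z <= nsq eta * c.
  have := CauchySchwarz eta (s J.+1); rewrite zs ns.
  have -> : sqnorm (J.+1%:R * z) = J.+1%:R * (J.+1%:R * sqnorm z).
    rewrite -[J.+1%:R in LHS](@rmorph_nat _ _ (real_complex R)).
    by case: z {zs fz} => x y; rewrite /sqnorm /=; ring.
  by rewrite [X in _ <= X]mulrCA ler_pM2l// ltr0n.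
have z0 : sqnorm z = 0.
  apply/eqP; rewrite eq_le sqnorm_ge0 andbT leNgt; apply/negP => zp.
  have [k kb] : exists k, nsq eta * c / sqnorm z < k%:R.
    exists (Num.truncn (nsq eta * c / sqnorm z)).+1; exact: truncnS_gt.
  have := bound k; apply/negP; rewrite -ltNge -ltr_pdivrMr//.
  by apply: lt_trans kb _; rewrite ltr_nat.
move: z0; case: z {zs fz bound} => x y; rewrite /sqnorm /= => /eqP.
by rewrite paddr_eq0 ?sqr_ge0// !sqrf_eq0 => /andP[/eqP-> /eqP->].
Qed.

End L2_closed.

Section representation_properties.
Context (R : realType) (a : nat -> R) (m : probability (seqspace nat) R).
Hypothesis hm : product_measure a m.
Local Notation mu := (tail_measure m).
Local Notation T := tail_space.
Local Notation C := R[i].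
Local Notation H := (L2tail m).
Local Notation dot := (@L2dot _ _ R mu).
Local Notation rep := (@rep R m).

Lemma rep_bounded s : bounded_operator dot (rep s).
Proof. exact: pull_op_bounded (left_iso hm (rinvP s)). Qed.

Lemma rep_mul s t : rep (rmul s t) = rep s \o rep t.
Proof.
apply/funext => v /=; symmetry.
apply: (pull_op_comp (left_iso hm (rinvP s)) (left_iso hm (rinvP t))).
  by move=> q; exact: vanish_rmul.
by move=> q _; apply: tail_val_inj => //=; exact: pull_rmul.
Qed.

Lemma rep_adjoint s t : rinverse s t -> adjoint dot (rep s) (rep t).
Proof. by move=> st; exact: pull_op_adjoint (left_iso hm st). Qed.

Lemma rep_one : rep rone = id.
Proof.
apply/funext => v; apply: pull_op_id => q.
  by apply: Sinf_vanish => i.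
exact: tail_val_inj.
Qed.

Lemma rep_star : star_representation dot rep.
Proof. by split; [exact: rep_bounded|exact: rep_one|exact: rep_mul|exact: rep_adjoint]. Qed.

Lemma rep_extends : extends_permutation_action rep.
Proof.
move=> s ss f; have P := left_iso hm (rinvP s).
apply: filterS (L2reprK (L2pred_pull P (L2repr_pred f))) => q ->.
rewrite /extend0 asboolT; last exact: Sinf_vanish.
congr (L2repr f _); apply: tail_val_inj => //=; apply/funext => i.
by rewrite /pull; case si : (s i) => [j|] //; case: (ss i).
Qed.

Local Notation S := [set rep s | s in setT].
Local Notation N := (vNalg dot S).

Lemma rep_in_vNalg s : N (rep s).
Proof.
split; first exact: rep_bounded.
by move=> U [_ h]; apply/esym/h; exists s.
Qed.

Lemma pull_op_commutant D F D' G : partial_iso mu D F D' G ->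
  (forall s q, left_dom s q -> D (left_pull s q) <-> D q) ->
  (forall s q, D q -> left_dom s (F q) <-> left_dom s q) ->
  (forall s q, left_dom s q -> D q -> left_pull s (F q) = F (left_pull s q)) ->
  commutant dot S (pull_op D F).
Proof.
move=> P h1 h2 h3; split; first exact: (pull_op_bounded P).
move=> _ [s _ <-]; apply: (pull_op_comm P (left_iso hm (rinvP s))).
  move=> q; split=> -[x y]; have xx := x; split => //.
  - exact/(h2 _ _ x).
  - by apply/h1 => //; exact/(h2 _ _ x).
  - exact/(h1 _ _ x).
  - by apply/h2 => //; exact/(h1 _ _ x).
by move=> q Dq /h2 dq; apply: h3 => //; exact: dq.
Qed.

Lemma right_pull_commutant s : in_Sinf s -> commutant dot S (pull_op setT (right_pull s)).
Proof.
move=> ss; apply: (pull_op_commutant (right_iso hm ss (rinvP s))) => // t q _ _.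
exact: tail_val_inj.
Qed.

Lemma right_splice_commutant n u v : commutant dot S (pull_op (right_cyl n v) (right_splice n u)).
Proof.
by apply: (pull_op_commutant (splice_iso hm n u v)) => // t q _ _; exact: tail_val_inj.
Qed.

(** The letter counts of the first sequence are unchanged: [big_pull] for addition, applied to the
    indicator of a letter. *)
Lemma balanced_left s q : left_dom s q -> balanced (left_pull s q) <-> balanced q.
Proof.
move=> qs; have [n qn] := tail_valP q; have [k sk] := rmap_fix s.
have hq i : (maxn n k <= i)%N -> (tail_val q).1 i = (tail_val q).2 i.
  by rewrite geq_max => /andP[/qn].
have hs i : (maxn n k <= i)%N ->
    (tail_val (left_pull s q)).1 i = (tail_val (left_pull s q)).2 i.
  by move=> h; rewrite /= /pull sk ?hq//; apply: leq_trans h; exact: leq_maxr.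
rewrite (balancedP hq) (balancedP hs) /=.
suff E c : letter_count (maxn n k) c (pull s (tail_val q).1) = letter_count (maxn n k) c (tail_val q).1.
  by split => h c; have := h c; rewrite E.
apply: (big_pull addn (fun v => (v == c) : nat) (rinvP s)).
  by apply: (in_RnW (leq_maxr n k)).
by move=> j _ tj; exact: ((vanish_inv _ (rinvP s)).1 qs).
Qed.

Lemma balanced_commutant : commutant dot S (pull_op balanced id).
Proof. by apply: (pull_op_commutant (balanced_iso m)) => // s q; exact: balanced_left. Qed.

Local Notation xi := (xi m).
Local Notation cyl_vec := (cyl_vec m).

Lemma diag_lty : (mu diag < +oo)%E.
Proof. by rewrite (mu_diag hm) ltry. Qed.

Lemma splice_xi n u v : pull_op (right_cyl n v) (right_splice n u) xi = cyl_vec n u v.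
Proof.
rewrite (pull_op_L2indic (splice_iso hm n u v) measurable_diag diag_lty); congr (L2indic m _).
apply/seteqP; split => q.
  move=> [qv]; rewrite /diag /= => E; split => // [i iN|i ni]; rewrite E /splice ?iN//.
  by rewrite ltnNge ni.
move=> [q1 q2 q3]; split => //=; apply/funext => i /=; rewrite /splice.
by case: ltnP => ni; [exact: q1|exact: q3].
Qed.

Lemma cyl_vec_total (Q : H -> Prop) : closed_subspace Q ->
  (forall n u v, Q (cyl_vec n u v)) -> forall f, Q f.
Proof.
move=> Qc QB; apply: (@closed_subspace_total _ T R mu (pair_cyls 0) (pair_cyl_enum 0)) => //.
- exact: tail_generated.
- exact: pair_cyls_setI.
- exact: pair_cyl_enumP.
- exact: pair_cyl_enum_cover.
- by move=> A [->|[n [u [v [_ ->]]]]]; [rewrite measure0|exact: (pair_cyl_lty hm)].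
- move=> A [->|[n [u [v [_ ->]]]]]; last exact: QB.
  by rewrite indic0 /L2real (_ : (fun q => _) = (fun=> 0))// L2of0; case: Qc.
Qed.

Lemma L2indic_set0 : L2indic m set0 = 0.
Proof. by rewrite /L2indic indic0 /L2real (_ : (fun q => _) = (fun=> 0))// L2of0. Qed.

Lemma bounded_nsq (U : H -> H) : bounded_operator dot U ->
  linear U /\ exists k, forall v, nsq (U v) <= k ^+ 2 * nsq v.
Proof.
move=> [lU [k h]]; split => //; exists k => v.
by rewrite -lecR rmorphM /= -!nsqE; exact: h.
Qed.

Section diagonal_involution.
Variable s : Rinf.
Hypothesis ss : in_Sinf s.
Hypothesis si : rinverse s s.
Local Notation V := (pull_op setT (right_pull s) : H -> H).

Lemma diag_step_cyl_vec A : measurable A -> (mu A < +oo)%E ->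
  rep s (V (L2indic m A)) = L2indic m [set q | A (right_pull s (left_pull s q))].
Proof.
move=> mA Aoo; have RI := right_iso hm ss si; have LI := left_iso hm si.
rewrite (pull_op_L2indic RI mA Aoo) setTI /rep (pull_op_L2indic LI).
- congr (L2indic m _); apply/seteqP; split => q; first by case.
  by split => //; exact: Sinf_vanish.
- by have := piso_mF RI measurableT mA; rewrite setTI.
- by have := piso_mu RI mA; rewrite !setTI => ->.
Qed.

Lemma diag_step_xi : rep s (V xi) = xi.
Proof.
rewrite diag_step_cyl_vec; [|exact: measurable_diag|exact: diag_lty].
rewrite /xi; congr (L2indic m _); apply/seteqP; split => q; rewrite /diag /= => E; last by rewrite E.
rewrite -[LHS](pullK si); last exact: Sinf_vanish.
by rewrite E pullK//; exact: Sinf_vanish.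
Qed.

(** As s is an involution, [rep s] and V are self-adjoint. They commute, so their composite can be
    moved onto eta, which it fixes. *)
Lemma diag_step_dot (eta e : H) : rep s (V eta) = eta -> dot eta (rep s (V e)) = dot eta e.
Proof.
move=> E; have RI := right_iso hm ss si.
have C : rep s \o V = V \o rep s by apply/esym; case: (right_pull_commutant ss) => _; apply; exists s.
rewrite -(rep_adjoint si) -(pull_op_adjoint RI).
by have := congr1 (fun f => f eta) C; rewrite /= => <-; rewrite E.
Qed.

End diagonal_involution.

End representation_properties.

(** For n <= b the blocks [0, n) and [b, b + n) are disjoint and this is an involution, so moving a
    block is done by self-adjoint operators. *)
Definition block_swap_fun (n b i : nat) : nat :=
  if (i < n)%N then (i + b)%N else if (b <= i < b + n)%N then (i - b)%N else i.

Lemma block_swap_funK n b : (n <= b)%N -> involutive (block_swap_fun n b).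
Proof.
move=> nb i; rewrite /block_swap_fun.
case: (ltnP i n) => ni.
  rewrite ltnNge (leq_trans nb (leq_addl i b)) /= leq_addl addnC ltn_add2l ni /=.
  by rewrite addnC addnK.
have [/andP[bi ib]|h] := boolP (b <= i < b + n)%N; last by rewrite ltnNge ni /= (negbTE h).
by rewrite ltn_subLR// ib subnK.
Qed.

Definition block_swap (n b : nat) : (n <= b)%N -> Rinf.
Proof.
move=> nb; exists (fun i => Some (block_swap_fun n b i)) => [i j k [<-] [/esym h]|].
  by rewrite -(block_swap_funK nb i) h block_swap_funK.
exists (b + n)%N => i ni; congr Some; rewrite /block_swap_fun.
rewrite ltnNge (leq_trans (leq_addl b n) ni) /= [(i < _)%N]ltnNge ni andbF//.
Defined.

Lemma block_swap_inv n b (nb : (n <= b)%N) : rinverse (block_swap nb) (block_swap nb).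
Proof.
by move=> i j; split => /= -[<-]; rewrite block_swap_funK.
Qed.

Lemma block_swap_Sinf n b (nb : (n <= b)%N) : in_Sinf (block_swap nb).
Proof. by []. Qed.

(** * Factoriality and the trace *)

Section block_shifts.
Context (R : realType) (a : nat -> R) (m : probability (seqspace nat) R).
Hypothesis hm : product_measure a m.
Local Notation mu := (tail_measure m).
Local Notation T := tail_space.

Lemma prod_block (w : nat -> nat) b n : \prod_(b <= i < b + n) a (w i) = word_weight a n (fun i => w (i + b)%N).
Proof.
by rewrite -{1}[b]add0n big_addn addnC addnK big_mkord.
Qed.

(** Independence of the letters in two disjoint blocks; [measure_coords] takes care of the free
    positions around them. *)
Lemma measure_two_blocks n b c u u' : (b + n <= c)%N ->
  m [set x | forall r, (r < n)%N -> x (r + b)%N = u r /\ x (r + c)%N = u' r] =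
  (word_weight a n u * word_weight a n u')%:E.
Proof.
move=> bnc.
pose p i := ((b <= i < b + n) || (c <= i < c + n))%N.
pose w i := if (i < c)%N then u (i - b)%N else u' (i - c)%N.
have bc : (b <= c)%N := leq_trans (leq_addr n b) bnc.
rewrite [X in m X](_ : _ = [set x | forall i, (i < c + n)%N -> p i -> x i = w i]).
  rewrite (measure_coords hm); congr EFin.
  rewrite -(big_mkord p (fun i => a (w i))).
  have wc : \prod_(c <= i < c + n | p i) a (w i) = word_weight a n u'.
    rewrite big_nat_cond (eq_bigl (fun i => (c <= i < c + n)%N && true)); last first.
      by move=> i; rewrite andbT /p; case: (c <= i < c + n)%N; rewrite ?orbT.
    rewrite -big_nat_cond prod_block; apply: eq_bigr => i _.
    by rewrite /w ltnNge leq_addl /= addnK.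
  have wb : \prod_(b <= i < b + n | p i) a (w i) = word_weight a n u.
    rewrite big_nat_cond (eq_bigl (fun i => (b <= i < b + n)%N && true)); last first.
      by move=> i; rewrite andbT /p; case: (b <= i < b + n)%N.
    rewrite -big_nat_cond prod_block; apply: eq_bigr => i _.
    have : (i + b < c)%N by apply: leq_trans bnc; rewrite addnC ltn_add2l.
    by rewrite /w => ->; rewrite addnK.
  rewrite (@big_cat_nat _ _ _ c)//=; last exact: leq_addr.
  rewrite wc (@big_cat_nat _ _ _ (b + n)%N)//= (@big_cat_nat _ _ _ b)//=; last exact: leq_addr.
  rewrite wb [X in X * _ * _ * _]big_nat_cond big_pred0 ?mul1r; last first.
    move=> i; rewrite /p; case: (ltnP i b) => ib /=; rewrite ?andbF//.
    by rewrite [(c <= i)%N]leqNgt (leq_trans ib bc).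
  rewrite [X in _ * X * _]big_nat_cond big_pred0 ?mulr1//.
  move=> i; rewrite /p; case: (leqP (b + n) i) => bni /=; last by [].
  by rewrite andbF /=; case: (ltnP i c).
apply/seteqP; split => x /= h.
  move=> i _; rewrite /p /w => /orP[/andP[bi ib]|/andP[ci ic]].
    rewrite (leq_trans ib bnc); have rn : (i - b < n)%N by rewrite ltn_subLR.
    by have [<- _] := h _ rn; rewrite subnK.
  rewrite ltnNge ci /=; have rn : (i - c < n)%N by rewrite ltn_subLR.
  by have [_ <-] := h _ rn; rewrite subnK.
move=> r rn; have rc : (r + b < c)%N by apply: leq_trans bnc; rewrite addnC ltn_add2l.
split.
  rewrite h /w /p ?rc ?addnK//; first exact: leq_trans rc (leq_addr _ _).
  by rewrite leq_addl addnC ltn_add2l rn.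
rewrite h /w /p; first by rewrite ltnNge leq_addl /= addnK.
  by rewrite addnC ltn_add2l.
by rewrite [X in _ || X](_ : _ = true) ?orbT// leq_addl addnC ltn_add2l.
Qed.

Definition shifted n u v b (nb : (n <= b)%N) : set T :=
  [set q | pair_cyl n u v (right_pull (block_swap nb) (left_pull (block_swap nb) q))].

Lemma shiftedP n u v b (nb : (n <= b)%N) q : shifted u v nb q <->
  [/\ forall r, (r < n)%N -> (tail_val q).1 (r + b)%N = u r,
      forall r, (r < n)%N -> (tail_val q).2 (r + b)%N = v r &
      forall i, ~~ (b <= i < b + n)%N -> (tail_val q).1 i = (tail_val q).2 i].
Proof.
rewrite /shifted /=; split=> -[h1 h2 h3]; split => r.
- by move=> rn; rewrite -h1//= /pull /= /block_swap_fun rn.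
- by move=> rn; rewrite -h2//= /pull /= /block_swap_fun rn.
- move=> rb; have /= := h3 (block_swap_fun n b r).
  rewrite /pull /= block_swap_funK//; apply.
  rewrite /block_swap_fun; case: ltnP => rn; first exact: leq_trans nb (leq_addl _ _).
  by rewrite (negbTE rb).
- by move=> rn; rewrite /= /pull /= /block_swap_fun rn h1.
- by move=> rn; rewrite /= /pull /= /block_swap_fun rn h2.
- move=> nr; rewrite /= /pull /= h3//.
  rewrite /block_swap_fun ltnNge nr /=.
  have [/andP[br rb]|//] := boolP (b <= r < b + n)%N.
  by rewrite negb_and -ltnNge (leq_trans _ nb)// ltn_subLR.
Qed.

Lemma measurable_shift n b (nb : (n <= b)%N) A : measurable A ->
  measurable [set q | A (right_pull (block_swap nb) (left_pull (block_swap nb) q))].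
Proof.
move=> mA; have RI := right_iso hm (@block_swap_Sinf _ _ nb) (block_swap_inv nb).
have LI := left_iso hm (block_swap_inv nb).
have mR := piso_mF RI measurableT mA; rewrite setTI in mR.
by have := piso_mF LI measurableT mR; rewrite setTI.
Qed.

Lemma mu_shift n b (nb : (n <= b)%N) A : measurable A ->
  mu [set q | A (right_pull (block_swap nb) (left_pull (block_swap nb) q))] = mu A.
Proof.
move=> mA; have RI := right_iso hm (@block_swap_Sinf _ _ nb) (block_swap_inv nb).
have LI := left_iso hm (block_swap_inv nb).
have mR := piso_mF RI measurableT mA; rewrite setTI in mR.
have LT : left_dom (block_swap nb) = setT.
  by apply/seteqP; split => // q _; exact: Sinf_vanish.
have := piso_mu LI mR; rewrite LT !setTI => ->.
by have := piso_mu RI mA; rewrite !setTI.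
Qed.

Lemma measurable_shifted n u v b (nb : (n <= b)%N) : measurable (shifted u v nb).
Proof. by apply: measurable_shift; exact: measurable_pair_cyl. Qed.

Lemma mu_shifted n u v b (nb : (n <= b)%N) : mu (shifted u v nb) = (word_weight a n u)%:E.
Proof. by rewrite mu_shift ?(measure_pair_cyl hm)//; exact: measurable_pair_cyl. Qed.

(** The measure of [pair_cyl n u v] inside the diagonal, that is, the coefficient of xi in the
    projection of [cyl_vec n u v] to the line of xi. *)
Definition diag_weight n u v : R := if `[< cyl n u v >] then word_weight a n u else 0.

Lemma mu_pair_cyl_diag n u v : mu (pair_cyl n u v `&` diag) = (diag_weight n u v)%:E.
Proof.
rewrite /diag_weight; case: asboolP => uv.
  rewrite setIidl ?(measure_pair_cyl hm)// => q [q1 q2 q3]; apply/funext => i.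
  by case: (ltnP i n) => ni; [rewrite q1// q2// uv|rewrite q3].
rewrite (_ : _ `&` _ = set0) ?measure0//; apply/seteqP; split => // q [[q1 q2 _] E].
by apply: uv => i iN; rewrite -q1// -q2// E.
Qed.

Lemma mu_shifted_diag n u v b (nb : (n <= b)%N) :
  mu (shifted u v nb `&` diag) = (diag_weight n u v)%:E.
Proof.
rewrite -mu_pair_cyl_diag -[RHS](mu_shift nb); last first.
  by apply: measurableI; [exact: measurable_pair_cyl|exact: measurable_diag].
congr (mu _); apply/seteqP; split => q [q1 q2]; split => //.
  by rewrite /diag /= q2.
have E : pull (block_swap nb) (tail_val q).1 = pull (block_swap nb) (tail_val q).2 := q2.
rewrite /diag /=.
rewrite -[LHS](pullK (block_swap_inv nb)); last exact: Sinf_vanish.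
by rewrite E (pullK (block_swap_inv nb))//; exact: Sinf_vanish.
Qed.

(** A pair in the cylinder shifted to c has equal sequences on the block at b, so the intersection
    is empty unless u and v agree below n. If they do, the intersection lies on the diagonal, where
    the two blocks are independent. *)
Lemma mu_shifted2 n u v b c (nb : (n <= b)%N) (nc : (n <= c)%N) : (b + n <= c)%N ->
  mu (shifted u v nb `&` shifted u v nc) = (diag_weight n u v ^+ 2)%:E.
Proof.
move=> bc; rewrite /diag_weight; case: asboolP => uv; last first.
  rewrite expr0n /= (_ : _ `&` _ = set0) ?measure0//; apply/seteqP; split => // q.
  move=> [/shiftedP[b1 b2 _] /shiftedP[_ _ c3]]; apply: uv => r rn.
  rewrite -b1// -b2// c3// negb_and -ltnNge.
  by rewrite (leq_trans _ bc)// addnC ltn_add2l.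
rewrite -(measure_two_blocks u u bc).
rewrite -(tail_measure_graph m (@tail_eq_refl nat)); last first.
  rewrite (_ : [set _ | _] = [set x | forall r, (r < n)%N ->
      ([set x : seqspace nat | x (r + b)%N = u r] `&` [set x : seqspace nat | x (r + c)%N = u r]) x])//.
  by apply: measurable_forall => r; apply: measurableI; exact: measurable_coord.
congr (mu _); apply/seteqP; split => q.
  move=> [/shiftedP[b1 b2 b3] /shiftedP[c1 _ _]]; split.
    by move=> r rn; rewrite b1// c1.
  apply/funext => i /=; case: (boolP (b <= i < b + n)%N) => [/andP[bi ib]|ib]; last by rewrite b3.
  have rn : (i - b < n)%N by rewrite ltn_subLR.
  by have := b1 _ rn; have := b2 _ rn; rewrite subnK// => -> ->; rewrite uv.
move=> [h E]; split; apply/shiftedP; split => [r rn|r rn|i _]; rewrite ?E//.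
- by case: (h r rn).
- by case: (h r rn) => -> _; rewrite uv.
- by case: (h r rn).
- by case: (h r rn) => _ ->; rewrite uv.
Qed.

End block_shifts.

Section factor_and_trace.
Context (R : realType) (a : nat -> R) (m : probability (seqspace nat) R).
Hypothesis hm : product_measure a m.
Local Notation mu := (tail_measure m).
Local Notation T := tail_space.
Local Notation C := R[i].
Local Notation H := (L2tail m).
Local Notation dot := (@L2dot _ _ R mu).
Local Notation rep := (@rep R m).
Local Notation xi := (xi m).
Local Notation cyl_vec := (cyl_vec m).
Local Notation S := [set rep s | s in setT].
Local Notation N := (vNalg dot S).

(** T0 commutes with [rep s] because it lies in the commutant of N, and with the permutation of the
    second sequence because it lies in N. The composite of the two fixes xi. *)
Lemma diag_step_fixed (T0 : H -> H) s : N T0 -> commutant dot N T0 ->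
  in_Sinf s -> rinverse s s ->
  rep s (pull_op setT (right_pull s) (T0 xi)) = T0 xi.
Proof.
move=> [_ TN] [_ TN'] ss si.
have c1 := TN' _ (rep_in_vNalg hm s).
have c2 := TN _ (right_pull_commutant hm ss).
rewrite -[in RHS](diag_step_xi hm ss si).
have := congr1 (fun f => f (pull_op setT (right_pull s) xi)) c1; rewrite /= => ->.
by have := congr1 (fun f => f xi) c2; rewrite /= => ->.
Qed.

(** Blocks of length n start at the multiples (j + 1) n: they are disjoint from each other and from
    [0, n), as [block_swap] requires. *)
Lemma block_le n j : (n <= j.+1 * n)%N.
Proof. by rewrite mulSn leq_addr. Qed.

(* Once their projection to xi is removed, the translates of a cylinder to disjoint blocks
   are orthogonal vectors of equal norm; all have the same inner product with eta, which
   is therefore zero by Bessel's inequality. *)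
Lemma invariant_orthogonal (eta : H) n u v :
  (forall s, in_Sinf s -> rinverse s s -> rep s (pull_op setT (right_pull s) eta) = eta) ->
  dot eta (cyl_vec n u v) = dot eta xi * (diag_weight a n u v)%:C.
Proof.
move=> fix_eta; set k := diag_weight a n u v.
pose e j : H := L2indic m (shifted u v (block_le n j)).
have me j : measurable (shifted u v (block_le n j)) := measurable_shifted hm u v _.
have oo j : (mu (shifted u v (block_le n j)) < +oo)%E by rewrite (mu_shifted hm) ltry.
have md := measurable_diag; have doo := diag_lty hm.
have eta_e j : dot eta (e j) = dot eta (cyl_vec n u v).
  have ss := @block_swap_Sinf _ _ (block_le n j); have si := block_swap_inv (block_le n j).
  have := diag_step_cyl_vec hm ss si (measurable_pair_cyl n u v) (pair_cyl_lty hm n u v).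
  rewrite -/(shifted u v (block_le n j)) -/(e j) => <-.
  by rewrite (diag_step_dot hm ss si)//; exact: fix_eta.
have e_xi j : dot (e j) xi = k%:C by rewrite dot_L2indic// (mu_shifted_diag hm).
have xi_e j : dot xi (e j) = k%:C by rewrite L2dotC e_xi conjc_real.
have e_e j l : j != l -> dot (e j) (e l) = (k ^+ 2)%:C.
  wlog jl : j l / (j < l)%N.
    move=> W; rewrite neq_ltn => /orP[jl|lj]; first by apply: W => //; rewrite ltn_eqF.
    by rewrite L2dotC W ?conjc_real// ltn_eqF.
  move=> _; rewrite dot_L2indic// (mu_shifted2 hm)//.
  by rewrite addnC -mulSn leq_mul2r ltnS jl orbT.
have nsq_e j : dot (e j) (e j) = (word_weight a n u)%:C.
  by rewrite dot_L2indic// setIid (mu_shifted hm).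
have xixi := dot_xi hm.
pose f j := e j - k%:C *: xi.
have kc : conjc k%:C = k%:C :> C by rewrite conjc_real.
have fdot j l : dot (f j) (f l) = dot (e j) (e l) - (k ^+ 2)%:C.
  rewrite /f L2dotBl !L2dotBr !L2dotZl !L2dotZr kc e_xi xi_e xixi.
  rewrite [(k ^+ 2)%:C]rmorphXn /=; ring.
have eta_f j : dot eta (f j) = dot eta (cyl_vec n u v) - k%:C * dot eta xi.
  by rewrite /f L2dotBr L2dotZr kc eta_e.
apply/eqP; rewrite -subr_eq0 [dot eta xi * _]mulrC; apply/eqP.
apply: (orthogonal_sum_bound (f := f) (c := word_weight a n u - k ^+ 2) _ _ eta_f).
  by move=> j l jl; rewrite fdot e_e// subrr.
by move=> j; apply: complexI; rewrite -nsqE fdot nsq_e rmorphB.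
Qed.

Lemma dot_cyl_vec_xi n u v : dot xi (cyl_vec n u v) = (diag_weight a n u v)%:C.
Proof.
rewrite (dot_L2indic measurable_diag (measurable_pair_cyl n u v) (diag_lty hm) (pair_cyl_lty hm n u v)).
by rewrite setIC (mu_pair_cyl_diag hm).
Qed.

Lemma invariant_eq_xi (eta : H) :
  (forall s, in_Sinf s -> rinverse s s -> rep s (pull_op setT (right_pull s) eta) = eta) ->
  eta = dot eta xi *: xi.
Proof.
move=> fix_eta; pose zeta := eta - dot eta xi *: xi.
suff : zeta = 0 by move/eqP; rewrite subr_eq0 => /eqP.
apply: L2dot_eq0.
apply: (cyl_vec_total hm (Q := fun f => dot f zeta = 0)); last first.
  move=> n u v; rewrite L2dotC /zeta L2dotBl L2dotZl dot_cyl_vec_xi.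
  by rewrite invariant_orthogonal// subrr conjc0.
apply: (@closed_subspace_ker _ _ _ _ (C^o) (fun f => dot f zeta) (@sqnorm R) (nsq zeta)).
- by move=> c f g; exact: L2dotZDl.
- exact: sqnorm_ge0.
- move=> z /eqP; rewrite /sqnorm paddr_eq0 ?sqr_ge0// !sqrf_eq0.
  by case: z => x y /= /andP[/eqP-> /eqP->].
- by move=> f; rewrite mulrC; exact: CauchySchwarz.
Qed.

Lemma rep_factor : Defs.factor dot N.
Proof.
move=> T0 NT N'T; have [TN cT] := NT.
have [lT [k Tk]] := bounded_nsq TN.
set c := dot (T0 xi) xi.
have Txi : T0 xi = c *: xi.
  by apply: invariant_eq_xi => s ss si; exact: diag_step_fixed.
exists c; apply/funext => f; apply/eqP; rewrite -subr_eq0; apply/eqP.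
apply: (cyl_vec_total hm (Q := fun f => T0 f - c *: f = 0)); last first.
  move=> n u v; rewrite -(splice_xi hm).
  have := congr1 (fun g => g xi) (cT _ (right_splice_commutant hm n u v)); rewrite /= => ->.
  rewrite Txi -[X in pull_op _ _ X]addr0 (pull_op_linear (splice_iso hm n u v)).
  have -> : pull_op (right_cyl n v) (right_splice n u) (0 : H) = 0.
    have := pull_op_linear (splice_iso hm n u v) 1 0 0; rewrite !scale1r addr0 => h.
    by apply: (@addrI _ (pull_op (right_cyl n v) (right_splice n u) (0 : H))); rewrite addr0 -h.
  by rewrite addr0 subrr.
(* The constant comes from [nsqD], with the bounds k ^ 2 for T0 and [sqnorm c] for the scalar. *)
apply: (@closed_subspace_ker _ _ _ _ H (fun f => T0 f - c *: f) (@nsq _ _ _ mu)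
   (2 * k ^+ 2 + 2 * sqnorm c)).
- by move=> x g h; rewrite lT [c *: (_ + _)]scalerDr scalerA mulrC -scalerA scalerBr opprD addrACA.
- exact: nsq_ge0.
- exact: nsq_eq0.
- move=> g; apply: (le_trans (nsqD _ _)); rewrite -scaleN1r !nsqZ.
  have -> : sqnorm (-1 : C) = 1 by rewrite /sqnorm /=; ring.
  by have := Tk g; rewrite !mul1r; lra.
Qed.

(** * The vector state of xi is a trace *)

Definition trace (U : H -> H) : C := dot (U xi) xi.

Local Notation P := (pull_op balanced id : H -> H).
Local Notation W := (pull_op balanced tail_swap : H -> H).
(* On N xi, J is the modular conjugation U xi |-> U^* xi. *)
Let J (f : H) : H := L2conj (W f).

Lemma swap_conj f : W (L2conj f) = L2conj (W f).
Proof.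
have sI := swap_iso hm.
elim/L2ind: f => f fL; rewrite L2conj_of// !(pull_op_of sI)//; last exact: L2pred_conj.
rewrite L2conj_of; last exact: (L2pred_pull sI).
congr L2of; apply/funext => q; rewrite /extend0 /=.
by case: ifP => // _; rewrite conjc0.
Qed.

(** W is self-adjoint, the exchange being its own inverse, and commutes with conjugation, so the
    symmetry in [L2conj_dot] passes to J. *)
Lemma swap_conj_dot f g : dot f (J g) = dot g (J f).
Proof.
by rewrite /J L2conj_dot (pull_op_adjoint (swap_iso hm)) swap_conj.
Qed.

Lemma L2conj_L2indic A : measurable A -> (mu A < +oo)%E -> L2conj (L2indic m A) = L2indic m A.
Proof.
move=> mA Aoo; rewrite /L2indic /L2real L2conj_of; last exact: L2pred_indic.
by congr L2of; apply/funext => q; rewrite conjc_real.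
Qed.

Lemma linear0P (U : H -> H) : linear U -> U 0 = 0.
Proof.
move=> lU; have := lU 1 0 0; rewrite !scale1r addr0 => h.
by apply: (@addrI _ (U 0)); rewrite addr0 -h.
Qed.

Lemma L2conj_lin c f g : L2conj (c *: f + g) = conjc c *: L2conj f + L2conj g :> H.
Proof.
elim/L2ind: f => f fL; elim/L2ind: g => g gL.
rewrite -L2of_lin// !L2conj_of//; last exact: L2pred_lin.
rewrite -L2of_lin; try exact: L2pred_conj.
by congr L2of; apply/funext => q; rewrite rmorphD rmorphM.
Qed.

Lemma nsq_L2conj (f : H) : nsq (L2conj f) = nsq f.
Proof.
elim/L2ind: f => f fL; rewrite L2conj_of// !nsq_L2of//; last exact: L2pred_conj.
by apply: eq_Rintegral => q _; case: (f q) => x y; rewrite /sqnorm /= sqrrN.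
Qed.

(** Both sides are linear and continuous in f, so let f be a cylinder vector. For unbalanced words
    both vanish. Otherwise f = R xi for a [right_splice] operator R, which commutes with U, and the
    left side is the inner product of U xi with R^* xi. That vector is the cylinder with the two
    words exchanged, which is J f. *)
Lemma trace_swap U : N U -> forall f, dot (U (P f)) xi = dot (U xi) (J f).
Proof.
move=> NU; have [bU cU] := NU; have [lU [k Uk]] := bounded_nsq bU.
have bI := balanced_iso m; have sI := swap_iso hm.
suff Q f : dot (U (P f)) xi - dot (U xi) (J f) = 0.
  by move=> f; apply/eqP; rewrite -subr_eq0 Q.
apply: (cyl_vec_total hm (Q := fun f => dot (U (P f)) xi - dot (U xi) (J f) = 0)).
  apply: (@closed_subspace_ker _ _ _ _ (C^o) (fun f => dot (U (P f)) xi - dot (U xi) (J f))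
    (@sqnorm R) (2 * (k ^+ 2 * nsq xi) + 2 * nsq (U xi))).
  - move=> c g h; rewrite (pull_op_linear bI) lU L2dotZDl /J (pull_op_linear sI).
    rewrite L2conj_lin L2dotZDr conjcK.
    have alg (x y z w : C) : c * x + y - (c * z + w) = c * (x - z) + (y - w) by ring.
    exact: alg.
  - exact: sqnorm_ge0.
  - move=> z /eqP; rewrite /sqnorm paddr_eq0 ?sqr_ge0// !sqrf_eq0.
    by case: z => x y /= /andP[/eqP-> /eqP->].
  - move=> g.
    have sqB (z w : C) : sqnorm (z - w) <= 2 * sqnorm z + 2 * sqnorm w.
      case: z w => z1 z2 [w1 w2]; rewrite /sqnorm /=.
      have := sqr_ge0 (z1 + w1); have := sqr_ge0 (z2 + w2); rewrite !sqrrD !sqrrN; lra.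
    apply: (le_trans (sqB _ _)); rewrite [X in _ <= X]mulrDl; apply: lerD.
      rewrite -mulrA ler_pM2l//; apply: le_trans (CauchySchwarz _ _) _.
      rewrite mulrAC; apply: ler_wpM2r; first exact: nsq_ge0.
      apply: le_trans (Uk _) _; apply: ler_wpM2l; first exact: sqr_ge0.
      exact: nsq_pull_le bI _.
    rewrite -mulrA ler_pM2l//; apply: le_trans (CauchySchwarz _ _) _.
    rewrite nsq_L2conj; apply: ler_wpM2l; first exact: nsq_ge0.
    exact: nsq_pull_le sI _.
move=> n u v; have mB := measurable_pair_cyl n u v; have Boo := pair_cyl_lty hm n u v.
have swE : tail_swap @^-1` pair_cyl n u v = pair_cyl n v u.
  by apply/seteqP; split => q [q1 q2 q3]; split => // i /q3.
rewrite /J /cyl_vec (pull_op_L2indic bI)// (pull_op_L2indic sI)// swE preimage_id.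
have [uv|uv] := pselect (forall c, letter_count n c u = letter_count n c v).
  rewrite !(setIidr (A := balanced)).
  - have := congr1 (fun g => g xi) (cU _ (right_splice_commutant hm n u v)).
    rewrite /= (splice_xi hm) => ->; rewrite (pull_op_adjoint (splice_iso hm n u v)).
    rewrite (splice_xi hm) L2conj_L2indic ?subrr//; first exact: measurable_pair_cyl.
    exact: pair_cyl_lty hm _ _ _.
  - by move=> q qc; apply/(balanced_pair_cyl qc) => c; rewrite uv.
  - by move=> q qc; apply/(balanced_pair_cyl qc).
have E0 : balanced `&` pair_cyl n u v = set0.
  by apply/seteqP; split => // q [qb qc]; case: uv; exact: ((balanced_pair_cyl qc).1 qb).
have E1 : balanced `&` pair_cyl n v u = set0.
  apply/seteqP; split => // q [qb qc]; case: uv => c; symmetry.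
  exact: ((balanced_pair_cyl qc).1 qb).
rewrite E0 E1 L2indic_set0 linear0P// L2dot0l sub0r.
by rewrite -(L2indic_set0 m) L2conj_L2indic ?measure0// L2indic_set0 L2dot0r oppr0.
Qed.

Lemma vNalg_balanced U : N U -> P (U xi) = U xi.
Proof.
move=> [_ cU]; have := congr1 (fun g => g xi) (cU _ (balanced_commutant hm)).
rewrite /= => <-; congr U.
rewrite (pull_op_L2indic (balanced_iso m) measurable_diag (diag_lty hm)) preimage_id.
congr (L2indic m _); apply: setIidr => q; rewrite (diagE (fun=> 0%N)) => qc.
exact/(balanced_pair_cyl qc).
Qed.

(** With f = V xi, [trace_swap] turns the left side into the inner product of U xi with J (V xi);
    the symmetry of J exchanges U and V. *)
Lemma trace_comm U V : N U -> N V -> trace (U \o V) = trace (V \o U).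
Proof.
move=> NU NV; rewrite /trace /=.
have := trace_swap NU (V xi); rewrite (vNalg_balanced NV) => ->.
have := trace_swap NV (U xi); rewrite (vNalg_balanced NU) => ->.
exact: swap_conj_dot.
Qed.

Lemma trace_state : tracial_state dot N trace.
Proof.
split.
- by move=> c U V _ _; rewrite /trace L2dotZDl.
- exact: dot_xi hm.
- move=> U V _ _ UV; rewrite /trace /= L2dotC -UV.
  have := L2dot_ge0 (U xi); rewrite nsqE conjc_real; exact.
- exact: trace_comm.
Qed.

Lemma trace_rep s : trace (rep s) =
  (fine (m [set x | vanish s x /\ pull s x = x]))%:C.
Proof.
rewrite /trace -[rep s xi]/(pull_op (left_dom s) (left_pull s) (L2indic m diag)).
rewrite (pull_op_L2indic (left_iso hm (rinvP s)) measurable_diag (diag_lty hm)).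
have P := left_iso hm (rinvP s).
have mL : measurable (left_dom s `&` left_pull s @^-1` diag).
  apply: measurableI; first exact: measurable_left_dom.
  by have := piso_mF P measurableT measurable_diag; rewrite setTI.
rewrite dot_L2indic//; [|exact: measurable_diag| |exact: diag_lty hm]; last first.
  rewrite (piso_mu P measurable_diag); apply: le_lt_trans (diag_lty hm).
  apply: le_measure; rewrite ?inE//.
    by apply: measurableI; [exact: measurable_left_dom|exact: measurable_diag].
  exact: measurable_diag.
congr ((fine _)%:C).
(* Inside the diagonal the set is the graph of the identity over the fixed sequences. *)
rewrite -(tail_measure_graph m (@tail_eq_refl nat)).
  congr (mu _); apply/seteqP; split => q.
    move=> [[qv E] qd]; split; last exact: esym.
    by split => //; apply: etrans E (esym qd).
  move=> [[qv E] qd]; split; last exact: esym.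
  by split => //; apply: etrans E (esym qd).
rewrite (_ : [set _ | _] = [set x | forall j, (forall i, s i <> Some j) -> [set x : seqspace nat | x j = 0%N] x] `&`
   [set x : seqspace nat | forall i, True -> [set x : seqspace nat | pull s x i = x i] x]).
  apply: measurableI.
    by apply: (@measurable_forall (fun j => forall i, s i <> Some j)) => j; exact: measurable_coord.
  apply: (@measurable_forall (fun=> True)) => i.
  rewrite (_ : [set _ | _] = \bigcup_v ([set x : seqspace nat | pull s x i = v] `&` [set x | x i = v])).
    apply: bigcupT_measurable => v; apply: measurableI; last exact: measurable_coord.
    have [j [w [->|[->|->]]]] := pull_coord s i v; first exact: measurable_coord.
      exact: measurableT.
    exact: measurable0.
  by apply/seteqP; split => x /= => [E|[v _ /= [-> ->]]//]; exists (x i).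
apply/seteqP; split => x.
  by move=> [h1 h2]; split => // i _ /=; rewrite h2.
by move=> [h1 h2]; split => //; apply/funext => i; exact: h2.
Qed.

End factor_and_trace.

(** * Ergodic central measures on the Pascal graph *)

Section pascal.
Context (R : realType) (delta : R) (phi : nat * nat -> R).
Local Notation V := (nat * nat)%type.
Local Notation X := (seqspace V).
Variable M : probability X R.
Hypothesis M_central : central (0%N, 0%N) pascal_edge M phi.
Hypothesis M_limit : M [set t | (fun f => (t f).2%:R / f%:R : R) @ \oo --> delta] = 1%E.

Local Notation path t n := (path_upto (0%N, 0%N) pascal_edge t n).
Local Notation F := (path_cylinder (0%N, 0%N) pascal_edge).

Lemma measurable_coord_pred i (P : V -> Prop) : measurable [set t : X | P (t i)].
Proof.
rewrite (_ : [set _ | _] = \bigcup_k (if (choice.unpickle k : option V) is Some v then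
    (if `[< P v >] then [set t : X | t i = v] else set0) else set0)).
  apply: bigcupT_measurable => k; case: (choice.unpickle k) => [v|]; last exact: measurable0.
  case: asboolP => _; last exact: measurable0.
  by apply: sub_sigma_algebra; exists i, v.
apply/seteqP; split => t.
  by move=> /= Pt; exists (choice.pickle (t i)) => //; rewrite choice.pickleK asboolT.
by move=> [k _]; case: (choice.unpickle k) => [v|//]; case: asboolP => // Pv /= ->.
Qed.

Lemma measurable_coord_rel i j (P : V -> V -> Prop) : measurable [set t : X | P (t i) (t j)].
Proof.
rewrite (_ : [set _ | _] = \bigcup_k (if (choice.unpickle k : option V) is Some v then
    [set t : X | t i = v] `&` [set t : X | P v (t j)] else set0)).
  apply: bigcupT_measurable => k; case: (choice.unpickle k) => [v|]; last exact: measurable0.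
  by apply: measurableI; [exact: (@measurable_coord_pred i (fun x => x = v))|exact: measurable_coord_pred].
apply/seteqP; split => t.
  by move=> /= Pt; exists (choice.pickle (t i)) => //; rewrite choice.pickleK.
by move=> [k _]; case: (choice.unpickle k) => [v|//] [/= ->].
Qed.

Lemma measurable_coord_fun d (U : measurableType d) (g : V -> U) i :
  measurable_fun setT (fun t : X => g (t i)).
Proof.
by move=> _ B mB; rewrite setTI; exact: (@measurable_coord_pred i (fun v => B (g v))).
Qed.

Lemma measurable_path_cylinder t n : measurable (F t n).
Proof.
rewrite (_ : F t n = [set s : X | s 0%N = (0%N, 0%N)] `&`
  [set s : X | forall i, True -> [set s : X | pascal_edge (s i) (s i.+1)] s] `&`
  [set s : X | forall i, (i <= n)%N -> [set s : X | s i = t i] s]).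
  apply: measurableI; first apply: measurableI.
  - exact: (@measurable_coord_pred 0 (fun v => v = (0%N, 0%N))).
  - by apply: (@measurable_forall (fun=> True)) => i; exact: measurable_coord_rel.
  - apply: (@measurable_forall (fun i => (i <= n)%N)) => i.
    exact: (@measurable_coord_pred i (fun v => v = t i)).
apply/seteqP; split => s; first by move=> [sp st]; split => //; split; [case: (sp 0%N)|
  move=> i _; case: (sp i.+1) => _; exact].
by move=> [[s0 se] st]; split => // k; split => // i _; exact: se.
Qed.

Lemma path_height t n i : path t n -> (i <= n)%N -> ((t i).2 <= i)%N.
Proof.
move=> [t0 te]; elim: i => [|i ih] iN; first by rewrite t0.
have ti := ih (ltnW iN).
by have [_ [->|->]] := te i iN; [exact: leqW|].
Qed.

Definition extend_path (t : nat -> V) n (v : V) : nat -> V :=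
  fun i => if (i <= n)%N then t i else v.

Lemma path_extend t n v : path t n -> pascal_edge (t n) v -> path (extend_path t n v) n.+1.
Proof.
move=> [t0 te] e; split => [|i]; first by rewrite /extend_path leq0n.
rewrite ltnS leq_eqVlt => /orP[/eqP->|iN]; first by rewrite /extend_path leqnn ltnn.
by rewrite /extend_path (ltnW iN) iN; exact: te.
Qed.

Lemma extend_path_last t n v : extend_path t n v n.+1 = v.
Proof. by rewrite /extend_path ltnn. Qed.

Lemma cylinder_split t n : path t n ->
  let v0 := ((t n).1.+1, (t n).2) in let v1 := ((t n).1.+1, (t n).2.+1) in
  [/\ F t n = F (extend_path t n v0) n.+1 `|` F (extend_path t n v1) n.+1,
    [disjoint F (extend_path t n v0) n.+1 & F (extend_path t n v1) n.+1],
    path (extend_path t n v0) n.+1 & path (extend_path t n v1) n.+1].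
Proof.
move=> tp v0 v1; split.
- apply/seteqP; split => s.
    move=> [sp st]; have [_ /(_ n (ltnSn n))] := sp n.+1.
    rewrite (st n (leqnn n)) => -[e1 [e2|e2]]; [left|right]; split => // i iN;
      rewrite /extend_path; case: ifP => [/st//|/negbT]; rewrite -ltnNge => ni;
      have -> : i = n.+1 by [apply/eqP; rewrite eqn_leq iN ni];
      by apply/eqP; rewrite -pair_eqE /pair_eq e1 e2 !eqxx.
  by move=> [] [sp st]; split => // i iN; rewrite st ?leqW// /extend_path iN.
- apply/disj_setPS => s [[_ s0] [_ s1]].
  have := s0 n.+1 (leqnn _); rewrite s1// !extend_path_last => -[].
  by move/eqP; rewrite gtn_eqF.
- by apply: path_extend => //; split => //; left.
- by apply: path_extend => //; split => //; right.
Qed.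

Lemma phi_split t n : path t n ->
  phi (t n) = phi ((t n).1.+1, (t n).2) + phi ((t n).1.+1, (t n).2.+1).
Proof.
move=> tp; have [Fe dis p0 p1] := cylinder_split tp.
have [_ Mc] := M_central; apply: EFin_inj; rewrite EFinD -(Mc _ _ tp) Fe measureU.
- by apply: etrans (congr2 adde (Mc _ _ p0) (Mc _ _ p1)) _; rewrite !extend_path_last.
- exact: measurable_path_cylinder.
- exact: measurable_path_cylinder.
- exact/disj_set2P.
Qed.

(** Centrality makes the steps exchangeable: on the cylinder, each of the d further steps goes up
    with the same probability as the first one. *)
Lemma integral_height t n d : path t n ->
  (\int[M]_(s in F t n) ((s (n + d)%N).2%:R)%:E =
   ((t n).2%:R * phi (t n) + d%:R * phi ((t n).1.+1, (t n).2.+1))%:E)%E.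
Proof.
elim: d n t => [|d ih] n t tp.
  rewrite addn0 mul0r addr0 EFinM.
  transitivity (\int[M]_(s in F t n) (cst ((t n).2%:R)%:E s))%E.
    by apply: eq_integral => s /set_mem[_ st]; rewrite st.
  rewrite integral_cst; last exact: measurable_path_cylinder.
  by have [_ Mc] := M_central; congr (_ * _)%E; exact: Mc.
have [Fe dis p0 p1] := cylinder_split tp.
rewrite Fe ge0_integral_setU//=; last 3 first.
- exact: measurable_path_cylinder.
- exact: measurable_path_cylinder.
- apply: measurable_funTS; exact: (@measurable_coord_fun _ _ (fun v => (v.2%:R : R)%:E)).
rewrite addnS -addSn !ih// !extend_path_last -EFinD; congr EFin => /=.
(* The upper successor of v0 is also the level successor of v1. Since phi depends on the vertex
   alone, the two terms multiplied by d add up to phi v1. *)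
have := phi_split tp; have := phi_split p1; rewrite !extend_path_last /= => -> ->.
rewrite -!natr1; ring.
Qed.

(** The complement is null once the set of convergence is known to be measurable; the tolerances 1 /
    (k + 1) write it with countable operations. *)
Lemma frequency_limit_ae : {ae M, forall s, (fun f => (s f).2%:R / f%:R : R) @ \oo --> delta}.
Proof.
pose A := [set t : X | (fun f => (t f).2%:R / f%:R : R) @ \oo --> delta].
have mA : measurable A.
  pose B k n := [set s : X | `|delta - (s n).2%:R / n%:R| < k.+1%:R^-1].
  have mB k n : measurable (B k n).
    exact: (@measurable_coord_pred n (fun v => `|delta - v.2%:R / n%:R| < k.+1%:R^-1)).
  rewrite (_ : A = \bigcap_k \bigcup_n0 [set s | forall n, (n0 <= n)%N -> B k n s]).
    apply: bigcapT_measurable => k; apply: bigcupT_measurable => n0.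
    exact: (@measurable_forall (fun n => (n0 <= n)%N)).
  apply/seteqP; split => s.
    move=> /cvgrPdist_lt h k _.
    have [|n0 _ hn0] := h k.+1%:R^-1; first by rewrite invr_gt0.
    by exists n0 => // n nn; exact: hn0.
  move=> h; apply/cvgrPdist_lt => e e0.
  have [n0 _ hn0] := h (Num.truncn e^-1) I.
  exists n0 => // n nn; apply: lt_trans (hn0 n nn) _.
  rewrite -[ltRHS]invrK ltf_pV2 ?posrE ?invr_gt0 ?ltr0n//.
  exact: truncnS_gt.
exists (~` A); split => //; first exact: measurableC.
by rewrite probability_setC// M_limit -EFinB subrr.
Qed.

(* Given the path up to level n, the mean height at level n + d grows linearly in d with
   slope phi(up) / phi(t n); by dominated convergence this slope is the limit frequency. *)
Lemma phi_up t n : path t n -> phi ((t n).1.+1, (t n).2.+1) = delta * phi (t n).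
Proof.
move=> tp; have mF := measurable_path_cylinder t n.
have MF : M (F t n) = (phi (t n))%:E by case: M_central => _ ->.
(* The level n + k + 1 is positive, so g is a genuine frequency, bounded by 1. *)
pose g k (s : X) : \bar R := ((s (n + k.+1)%N).2%:R / (n + k.+1)%:R)%:E.
have mg k : measurable_fun (F t n) (g k).
  apply: measurable_funTS.
  exact: (@measurable_coord_fun _ _ (fun v => (v.2%:R / (n + k.+1)%:R)%:E)).
have [] := @dominated_convergence _ _ _ M (F t n) mF g (cst delta%:E) (cst 1%E) mg.
- exact: measurable_cst.
- have [A [mA A0 sub]] := frequency_limit_ae.
  exists A; split => // s /= ngs; apply: sub => /= sd; apply: ngs => _.
  apply: cvg_EFin; first exact: nearW.
  have := sd; rewrite -(cvg_shiftn n.+1) /=; apply: cvg_trans; apply: near_eq_cvg.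
  by apply: nearW => k /=; rewrite addnS [(k + n)%N]addnC -addnS.
- exact: finite_measure_integrable_cst.
- apply: aeW => s k [sp _]; rewrite /g /= lee_fin ger0_norm ?divr_ge0//.
  rewrite ler_pdivrMr ?ltr0n ?addnS// mul1r ler_nat.
  exact: path_height (sp _) (leqnn _).
have -> : (\int[M]_(x in F t n) cst delta%:E x)%E = (delta * phi (t n))%:E.
  by rewrite integral_cst// EFinM; congr (_ * _)%E; exact: MF.
move=> _ _ /fine_cvg /= lim1.
have gE k : fine (\int[M]_(s in F t n) g k s)%E =
    ((t n).2%:R * phi (t n) + k.+1%:R * phi ((t n).1.+1, (t n).2.+1)) / (n + k.+1)%:R.
  rewrite (_ : (\int[M]_(s in F t n) g k s)%E = (((n + k.+1)%:R^-1)%:E *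
      \int[M]_(s in F t n) ((s (n + k.+1)%N).2%:R)%:E)%E).
    by rewrite integral_height//= mulrC.
  rewrite -ge0_integralZl//.
  - by apply: eq_integral => s _; rewrite /g mulrC EFinM.
  - apply: measurable_funTS.
    exact: (@measurable_coord_fun _ _ (fun v => (v.2%:R : R)%:E)).
set p := phi (_, _) in gE *; set p0 := phi (t n) in gE lim1 *.
have lim2 : (fun k => fine (\int[M]_(s in F t n) g k s)%E) @ \oo --> p.
  under eq_fun do rewrite gE.
  have -> : (fun k => ((t n).2%:R * p0 + k.+1%:R * p) / (n + k.+1)%:R) =
      (fun k => ((t n).2%:R * p0 - n%:R * p) * (n + k.+1)%:R^-1 + p).
    apply/funext => k; have nz : (n + k.+1)%:R != 0 :> R by rewrite pnatr_eq0 addnS.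
    by rewrite natrD in nz *; field.
  set c := (_ - _).
  suff : (fun k => c * (n + k.+1)%:R^-1 + p) @ \oo --> c * 0 + p by rewrite mulr0 add0r.
  apply: cvgD; last exact: cvg_cst.
  apply: cvgM; first exact: cvg_cst.
  have := @cvg_harmonic R; rewrite -(cvg_shiftn n); apply: cvg_trans; apply: near_eq_cvg.
  by apply: nearW => k /=; rewrite /harmonic /= addnS addnC.
exact: (cvg_unique (@Rhausdorff _) lim2 lim1).
Qed.

(** Goes up k times and then stays level. It passes through (n, k) for every n >= k, so relations
    proved along paths become available at that vertex. *)
Definition straight_path (k i : nat) : V := (i, minn i k).

Lemma straight_pathP k n : path (straight_path k) n.
Proof.
split=> [|i iN]; first by rewrite /straight_path min0n.
split => //=; have [ik|ki] := ltnP i k.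
  by right; exact/minn_idPl.
by left; apply/minn_idPr; exact: leqW.
Qed.

(** Going up multiplies phi by delta ([phi_up]), and then [phi_split] leaves the factor 1 - delta
    for staying level. *)
Theorem pascal_weight n k : (k <= n)%N -> phi (n, k) = delta ^+ k * (1 - delta) ^+ (n - k).
Proof.
elim: n k => [|n ih] k.
  rewrite leqn0 => /eqP ->; rewrite !expr0 mulr1; case: M_central => M1 Mc.
  have := Mc _ _ (straight_pathP 0 0); rewrite /straight_path /= => h.
  apply: EFin_inj; rewrite -h -M1; congr (M _); apply/seteqP; split => s; first by case.
  by move=> sp; split => // i; rewrite leqn0 => /eqP ->; case: (sp 0%N).
have E j : (j <= n)%N -> straight_path j n = (n, j).
  by move=> jn; rewrite /straight_path (minn_idPr jn).
rewrite leq_eqVlt => /orP[/eqP->|kn].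
  have := phi_up (straight_pathP n n); rewrite E//= => ->.
  by rewrite ih// !subnn !expr0 !mulr1 exprS.
have := phi_split (straight_pathP k n); have := phi_up (straight_pathP k n).
rewrite E//= => -> h.
have -> : phi (n.+1, k) = (1 - delta) * phi (n, k) by rewrite mulrBl mul1r {1}h addrK.
by rewrite ih// subSn// exprS mulrCA.
Qed.

End pascal.

(** An invariant colouring is a choice of one colour for each cycle. Distributing the product on the
    right gives the choice functions on subsets of I, with default j0 off the cycles; h and h'
    translate between the two. *)
Lemma sum_cycle_invariant (R : comNzRingType) (I J : finType) (j0 : J) (t : {perm I}) (b : J -> R) :
  \sum_(g : {ffun I -> J} | [forall r, g (t r) == g r]) \prod_r b (g r) =
  \prod_(c in porbits t) \sum_j b j ^+ #|c|.
Proof.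
rewrite (big_distr_big j0) /=.
pose h (p : {ffun {set I} -> J}) : {ffun I -> J} := [ffun r => p (porbit t r)].
pose h' (g : {ffun I -> J}) : {ffun {set I} -> J} :=
  [ffun c : {set I} => if c \in porbits t then
     (if [pick r in c] is Some r then g r else j0) else j0].
have inv (g : {ffun I -> J}) : [forall r, g (t r) == g r] -> forall r r', r' \in porbit t r -> g r' = g r.
  move=> /forallP gt r r' /porbitP[i ->]; elim: i => [|i ih]; first by rewrite expg0 perm1.
  by rewrite expgSr permM (eqP (gt _)).
have hK (g : {ffun I -> J}) : [forall r, g (t r) == g r] -> h (h' g) = g.
  move=> gt; apply/ffunP => r; rewrite !ffunE imset_f//.
  case: pickP => [r' /(inv g gt)//|/(_ r)]; by rewrite porbit_id.
rewrite (reindex_onto h h')//.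
apply: eq_big => p.
  apply/andP/pffun_onP => [[_ /eqP <-]|[sp _]].
    split => //; apply/fintype.subsetP => c.
    by rewrite !inE ffunE; case: ifP => //; rewrite eqxx.
  split.
    apply/forallP => r; rewrite !ffunE; apply/eqP; congr (p _).
    by apply/eqP; rewrite eq_porbit_mem; have := mem_porbit t 1 r; rewrite expg1.
  apply/eqP/ffunP => c; rewrite !ffunE; case: ifP => [/imsetP[r _ ->]|pc].
    case: pickP => [r' /= rr'|/(_ r)]; last by rewrite porbit_id.
    rewrite ffunE; congr (p _); apply/eqP; by rewrite eq_porbit_mem.
  apply/esym/eqP; apply: contraFT pc => pc; exact: (fintype.subsetP sp).
move=> _; rewrite (partition_big (porbit t) (mem (porbits t))) /=; last first.
  by move=> r _; exact: imset_f.
apply: eq_bigr => c /imsetP[r _ ->].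
rewrite (eq_bigr (fun=> b (p (porbit t r)))); last by move=> r' /eqP E; rewrite ffunE E.
rewrite prodr_const; congr (_ ^+ _); apply: eq_card => r'.
by rewrite -[LHS]/(porbit t r' == porbit t r) eq_porbit_mem.
Qed.

(** * Words fixed by a partial injection *)

Section increasing_maps.
Variable n : nat.

Lemma increasing_lt k (f : {ffun 'I_k -> 'I_n}) : increasing f ->
  forall i j : 'I_k, (i < j)%N -> (f i < f j)%N.
Proof. by move=> /forallP h i j ij; have /forallP/(_ j)/implyP/(_ ij) := h i. Qed.

Lemma increasing_inj k (f : {ffun 'I_k -> 'I_n}) : increasing f -> injective f.
Proof.
move=> fi i j fij; apply/val_inj; case: (ltngtP (val i) (val j)) => // ij.
  by have := increasing_lt fi ij; rewrite fij ltnn.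
by have := increasing_lt fi ij; rewrite fij ltnn.
Qed.

Lemma sorted_increasing k (f : {ffun 'I_k -> 'I_n}) : increasing f ->
  sorted ltn (map (fun i => val (f i)) (enum 'I_k)).
Proof.
move=> fi; rewrite sorted_map.
have : sorted ltn (map val (enum 'I_k)) by rewrite val_enum_ord iota_ltn_sorted.
by rewrite sorted_map; apply: sub_sorted => i j /= ij; exact: increasing_lt.
Qed.

Lemma increasing_eq k (f g : {ffun 'I_k -> 'I_n}) : increasing f -> increasing g ->
  f @: 'I_k = g @: 'I_k -> f = g.
Proof.
move=> fi gi fg.
have : map (fun i => val (f i)) (enum 'I_k) = map (fun i => val (g i)) (enum 'I_k).
  apply: (irr_sorted_eq ltn_trans ltnn); try exact: sorted_increasing.
  have H (f' g' : {ffun 'I_k -> 'I_n}) : f' @: 'I_k = g' @: 'I_k ->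
      {subset map (fun i => val (f' i)) (enum 'I_k) <= map (fun i => val (g' i)) (enum 'I_k)}.
    move=> E x /mapP[i _ ->]; have : f' i \in g' @: 'I_k by rewrite -E imset_f.
    by move=> /imsetP[j _ ->]; apply/mapP; exists j; rewrite ?mem_enum.
  by move=> x; apply/idP/idP; apply: H.
move=> E; apply/ffunP => i; apply/val_inj.
have /eq_in_map : map (fun i => val (f i)) (enum 'I_k) = map (fun i => val (g i)) (enum 'I_k) := E.
by apply; rewrite mem_enum.
Qed.

Definition enum_increasing (A : {set 'I_n}) : {ffun 'I_#|A| -> 'I_n} := [ffun i => enum_val i].

Lemma enum_increasingP A : increasing (enum_increasing A).
Proof.
apply/forallP => i; apply/forallP => j; apply/implyP => ij; rewrite !ffunE.
have sA : sorted ltn (map val (enum A)).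
  rewrite sorted_map; apply: sorted_filter; first by move=> x y z /=; exact: ltn_trans.
  by rewrite -sorted_map -enumT val_enum_ord iota_ltn_sorted.
have sz : size (map val (enum A)) = #|A| by rewrite size_map -cardE.
have := @sorted_ltn_nth _ _ ltn_trans 0%N _ sA i j.
rewrite !inE sz => /(_ (ltn_ord i) (ltn_ord j) ij).
by rewrite !(nth_map (enum_val i)) -?cardE// -!enum_val_nth.
Qed.

Lemma enum_increasing_image A : enum_increasing A @: 'I_#|A| = A.
Proof.
apply/setP => x; apply/imsetP/idP => [[i _ ->]|xA].
  by rewrite ffunE; exact: enum_valP.
by exists (enum_rank_in xA x); rewrite ?inE// ffunE enum_rankK_in.
Qed.

(** Exactly one pair (k, f) has image A. Read from right to left, this inserts into a sum the
    increasing enumeration of the support of a word. *)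
Lemma sum_increasing_image (R : nmodType) (A : {set 'I_n}) (c : R) :
  \sum_(k < n.+1) \sum_(f : {ffun 'I_k -> 'I_n} | increasing f && (f @: 'I_k == A)) c = c.
Proof.
have An : (#|A| < n.+1)%N by rewrite ltnS -[n in (_ <= n)%N]card_ord max_card.
rewrite (bigD1 (Ordinal An)) //= [X in _ + X]big1 ?addr0; last first.
  move=> k kA; rewrite big_pred0// => f; apply/negbTE/andP => -[fi /eqP fA].
  case/eqP: kA; apply: val_inj => /=.
  by rewrite -fA card_imset ?card_ord//; exact: increasing_inj.
rewrite (big_pred1 (enum_increasing A))// => f /=.
apply/andP/eqP => [[fi /eqP fA]|->]; last by rewrite enum_increasingP enum_increasing_image.
by apply: increasing_eq => //; [exact: enum_increasingP|rewrite fA enum_increasing_image].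
Qed.

End increasing_maps.

Section fixed_words.
Variables (R : comNzRingType) (n : nat) (s : Rinf) (M : nat) (b : nat -> R).
Hypothesis sn : in_Rn n s.
(** The letter 0 and the letters 1, ..., M + 1: there is always a nonzero letter, which
    [sum_cycle_invariant] takes as its default. *)
Local Notation J := 'I_M.+2.

(** Padded with 0 past n; for s in R_n, being fixed depends on the positions below n only
    ([fixed_byP]). *)
Definition word (p : nat) (f : {ffun 'I_n -> 'I_p}) (i : nat) : nat :=
  if (insub i : option 'I_n) is Some o then val (f o) else 0%N.

Lemma word_ord p (f : {ffun 'I_n -> 'I_p}) (i : 'I_n) : word f i = f i.
Proof. by rewrite /word valK. Qed.

Definition fixed_by (x : nat -> nat) : Prop := vanish s x /\ pull s x = x.

Lemma fixed_byP x : fixed_by x <->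
  [/\ forall j, (j < n)%N -> (forall i, s i <> Some j) -> x j = 0%N,
      forall i j, (i < n)%N -> s i = Some j -> x j = x i &
      forall i, (i < n)%N -> s i = None -> x i = 0%N].
Proof.
split=> [[v p]|[h1 h2 h3]]; split.
- by move=> j _; exact: v.
- by move=> i j _ si; rewrite -{2}p /pull si.
- by move=> i _ si; rewrite -p /pull si.
- move=> j sj; have [jn|nj] := ltnP j n; first exact: h1.
  by case: (sj j); exact: sn.
- apply/funext => i; rewrite /pull; have [iN|ni] := ltnP i n; last by rewrite sn.
  by case si : (s i) => [j|]; [exact: h2|rewrite h3].
Qed.

Variables (k : nat) (a : {ffun 'I_k -> 'I_n}).
Hypothesis a_inj : injective a.

(** The condition under the sum in [munn_mx] for a = b: s preserves the image of a and acts on it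
    through t. *)
Definition follows (t : 'S_k) : bool := [forall i : 'I_k, s (a i) == Some (a (t i) : nat)].

Lemma follows_unique t t' : follows t -> follows t' -> t = t'.
Proof.
move=> /forallP h /forallP h'; apply/permP => i; apply: a_inj; apply/val_inj.
by have := h i; rewrite (eqP (h' i)) => /eqP[].
Qed.

Let supp (f : {ffun 'I_n -> J}) : {set 'I_n} := [set i | f i != ord0].

(** A word whose support is the image of a amounts to a word g in nonzero letters, placed along a.
    [lift ord0] shifts its letters past 0, and [contract] undoes this. *)
Let spread (g : {ffun 'I_k -> 'I_M.+1}) : {ffun 'I_n -> J} :=
  [ffun i => if [pick r | a r == i] is Some r then lift ord0 (g r) else ord0].

Let contract (f : {ffun 'I_n -> J}) : {ffun 'I_k -> 'I_M.+1} :=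
  [ffun r => odflt ord0 (unlift ord0 (f (a r)))].

Let spread_in g r : spread g (a r) = lift ord0 (g r).
Proof.
rewrite ffunE; case: pickP => [r' /eqP/a_inj->//|/(_ r)]; by rewrite eqxx.
Qed.

Let spread_out g i : i \notin a @: 'I_k -> spread g i = ord0.
Proof.
by move=> ia; rewrite ffunE; case: pickP => // r /eqP ri; case/negP: ia; rewrite -ri imset_f.
Qed.

Let supp_spread g : supp (spread g) = a @: 'I_k.
Proof.
apply/setP => i; rewrite inE; case: (boolP (i \in a @: 'I_k)) => [/imsetP[r _ ->]|/spread_out->].
  by rewrite spread_in eq_sym neq_lift.
by rewrite eqxx.
Qed.

Let contractK g : contract (spread g) = g.
Proof. by apply/ffunP => r; rewrite ffunE spread_in liftK. Qed.

Let spreadK f : supp f = a @: 'I_k -> spread (contract f) = f.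
Proof.
move=> sf; apply/ffunP => i; case: (boolP (i \in a @: 'I_k)) => [|ia].
  move=> /imsetP[r _ ->]; rewrite spread_in ffunE.
  have : a r \in supp f by rewrite sf imset_f.
  by rewrite inE eq_sym => /unlift_some[j -> ->].
rewrite spread_out//; move: ia; rewrite -sf inE negbK => /eqP->//.
Qed.

Let fixed_spread t g : follows t ->
  fixed_by (word (spread g)) <-> [forall r, g (t r) == g r].
Proof.
move=> /forallP at_; have sa r : s (a r) = Some (a (t r) : nat) by apply/eqP.
have wa r : word (spread g) (a r) = (g r).+1 by rewrite word_ord spread_in lift0.
have wo (i : 'I_n) : i \notin a @: 'I_k -> word (spread g) i = 0%N.
  by move=> ia; rewrite word_ord spread_out.
rewrite fixed_byP; split=> [[_ h _]|/forallP gt].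
  apply/forallP => r; apply/eqP/val_inj.
  by have := h _ _ (ltn_ord (a r)) (sa r); rewrite !wa => -[].
split.
- move=> j jn sj; apply: (wo (Ordinal jn)); apply/negP => /imsetP[r _ rj].
  by apply: (sj (a (t^-1%g r))); rewrite sa permKV -rj.
- move=> i j iN si; have jn := in_Rn_lt sn iN si.
  case: (boolP (Ordinal iN \in a @: 'I_k)) => [/imsetP[r _ ri]|ia].
    have Ei : i = a r by rewrite -ri.
    have Ej : j = a (t r) by move: si; rewrite Ei sa => -[].
    by rewrite Ei Ej !wa (eqP (gt r)).
  have -> := wo _ ia; apply: (wo (Ordinal jn)); apply/negP => /imsetP[r _ rj].
  case/negP: ia; apply/imsetP; exists (t^-1%g r) => //; apply/val_inj => /=.
  by apply: (@rmap_inj s _ _ j) => //; rewrite sa permKV -rj.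
- move=> i iN si; apply: (wo (Ordinal iN)); apply/negP => /imsetP[r _ ri].
  by have := sa r; rewrite -ri /= si.
Qed.

(** s is defined wherever a fixed word has a nonzero letter, and it preserves the letter; so it maps
    the support into itself, injectively, hence bijectively. *)
Let fixed_follows f : supp f = a @: 'I_k -> fixed_by (word f) -> exists t, follows t.
Proof.
move=> sf /fixed_byP[_ h2 h3].
have ex r : exists r', s (a r) == Some (a r' : nat).
  have : a r \in supp f by rewrite sf imset_f.
  rewrite inE; case sr : (s (a r)) => [j|]; last first.
    by have := h3 _ (ltn_ord (a r)) sr; rewrite word_ord => fr; rewrite -val_eqE /= fr.
  have jn := in_Rn_lt sn (ltn_ord (a r)) sr.
  have := h2 _ _ (ltn_ord (a r)) sr; rewrite word_ord -[j]/(val (Ordinal jn)) word_ord => fj fr.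
  have : Ordinal jn \in supp f by rewrite inE -val_eqE /= fj.
  by rewrite sf => /imsetP[r' _ E]; exists r'; rewrite -E.
pose u r := xchoose (ex r).
have uE r : s (a r) = Some (a (u r) : nat) := eqP (xchooseP (ex r)).
have u_inj : injective u.
  move=> r r' E; apply: a_inj; apply/val_inj.
  by apply: (@rmap_inj s _ _ (a (u r))); rewrite uE ?E.
by exists (perm u_inj); apply/forallP => r; rewrite permE uE.
Qed.

Let word_weight_spread g : \prod_(i < n) b (word (spread g) i) =
  b 0%N ^+ (n - k) * \prod_r b (g r).+1.
Proof.
rewrite (bigID (mem (a @: 'I_k))) /= mulrC; congr (_ * _).
  rewrite (eq_bigr (fun=> b 0%N)); last by move=> i ia; rewrite word_ord spread_out.
  rewrite prodr_const; congr (_ ^+ _).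
  have E : (k + #|[predC a @: 'I_k]| = n)%N.
    by rewrite -[X in _ = X]card_ord -(cardC (mem (a @: 'I_k))) card_imset// card_ord.
  by rewrite -[X in (X - _)%N]E addKn; apply: eq_card.
rewrite big_imset /=; last by move=> x y _ _; exact: a_inj.
by apply: eq_bigr => r _; rewrite word_ord spread_in lift0.
Qed.

(** The right side has at most one term. If it has none, no word with this support is fixed, by
    [fixed_follows]; otherwise [spread] matches the fixed words with the colourings constant on the
    cycles of t. *)
Lemma sum_fixed_support :
  \sum_(f : {ffun 'I_n -> J} | `[< fixed_by (word f) >] && (a @: 'I_k == [set i | f i != ord0]%SET))
     \prod_(i < n) b (word f i) =
  \sum_(t : 'S_k | follows t) b 0%N ^+ (n - k) *
     \prod_(c in porbits t) \sum_(j < M.+1) b j.+1 ^+ #|c|.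
Proof.
have [[t0 ft0]|no] := pselect (exists t, follows t); last first.
  rewrite big_pred0; last first.
    move=> f; apply/negbTE/andP => -[/asboolP ff /eqP fa]; apply: no.
    exact: fixed_follows (esym fa) ff.
  by rewrite big_pred0// => t; apply/negbTE/negP => ft; apply: no; exists t.
rewrite [RHS](big_pred1 t0); last first.
  by move=> t; apply/idP/eqP => [ft|-> //]; exact: follows_unique.
rewrite (reindex_onto spread contract) /=; last first.
  by move=> f /andP[_ /eqP fa]; apply: spreadK.
rewrite -(sum_cycle_invariant ord0 t0 (fun j : 'I_M.+1 => b j.+1)) mulr_sumr.
apply: eq_big => [g|g _]; last exact: word_weight_spread.
rewrite contractK eqxx andbT -/(supp _) supp_spread eqxx andbT.
by apply/asboolP/idP => /(fixed_spread g ft0).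
Qed.

End fixed_words.

Lemma sum_fixed_words (R : comNzRingType) n (s : Rinf) M (b : nat -> R) : in_Rn n s ->
  \sum_(f : {ffun 'I_n -> 'I_M.+2} | `[< fixed_by s (word f) >]) \prod_(i < n) b (word f i) =
  \sum_(k < n.+1) \sum_(a : {ffun 'I_k -> 'I_n} | increasing a)
    \sum_(t : 'S_k | follows s a t) b 0%N ^+ (n - k) *
     \prod_(c in porbits t) \sum_(j < M.+1) b j.+1 ^+ #|c|.
Proof.
move=> sn.
rewrite (eq_bigr (fun f : {ffun 'I_n -> 'I_M.+2} => \sum_(k < n.+1) \sum_(a : {ffun 'I_k -> 'I_n} |
    increasing a && (a @: 'I_k == [set i | f i != ord0]%SET)) \prod_(i < n) b (word f i))); last first.
  by move=> f _; rewrite sum_increasing_image.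
rewrite exchange_big /=; apply: eq_bigr => k _.
rewrite (exchange_big_dep (fun a : {ffun 'I_k -> 'I_n} => increasing a)) /=; last first.
  by move=> f a _ /andP[].
apply: eq_bigr => a ai; rewrite -(sum_fixed_support M b sn (increasing_inj ai)).
by apply: eq_bigl => f; rewrite ai.
Qed.

(** * Passage from finite alphabets to the probability of being fixed *)

Section fixed_measure.
Context (R : realType) (a : nat -> R) (m : probability (seqspace nat) R).
Hypothesis hm : product_measure a m.
Variables (n : nat) (s : Rinf).
Hypothesis sn : in_Rn n s.

Lemma fixed_by_ext x y : (forall i, (i < n)%N -> x i = y i) ->
  fixed_by s x -> fixed_by s y.
Proof.
move=> xy /(fixed_byP sn)[h1 h2 h3]; apply/(fixed_byP sn); split.
- by move=> j jn sj; rewrite -xy// h1.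
- by move=> i j iN si; rewrite -!xy ?(in_Rn_lt sn iN si)//; exact: h2.
- by move=> i iN si; rewrite -xy// h3.
Qed.

Definition bounded_fixed (M : nat) : set (seqspace nat) :=
  [set x | fixed_by s x /\ forall i, (i < n)%N -> (x i < M.+2)%N].

Lemma bounded_fixedE M : bounded_fixed M =
  \bigcup_(f in [set f : {ffun 'I_n -> 'I_M.+2} | fixed_by s (word f)]) cyl n (word f).
Proof.
apply/seteqP; split => x.
  move=> [fx xM]; pose f : {ffun 'I_n -> 'I_M.+2} := [ffun i : 'I_n => inord (x i)].
  have fE i : (i < n)%N -> x i = word f i.
    by move=> iN; rewrite (word_ord f (Ordinal iN)) ffunE inordK//; exact: xM.
  by exists f => //=; exact: fixed_by_ext fx.
move=> [f /= ff xf]; split.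
  by apply: fixed_by_ext ff => i iN; rewrite xf.
by move=> i iN; rewrite xf// (word_ord f (Ordinal iN)).
Qed.

Lemma measurable_bounded_fixed M : measurable (bounded_fixed M).
Proof.
rewrite bounded_fixedE; apply: fin_bigcup_measurable; first exact: finite_finset.
by move=> f _; exact: measurable_cyl.
Qed.

Lemma measure_bounded_fixed M : m (bounded_fixed M) =
  (\sum_(f : {ffun 'I_n -> 'I_M.+2} | `[< fixed_by s (word f) >]) word_weight a n (word f))%:E.
Proof.
rewrite bounded_fixedE.
transitivity (\sum_(f \in [set f : {ffun 'I_n -> 'I_M.+2} | fixed_by s (word f)]) (m (cyl n (word f))))%E.
  apply: measure_fin_bigcup; first exact: finite_finset.
    move=> f g _ _ [x [xf xg]]; apply/ffunP => i; apply/val_inj.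
    by rewrite -[LHS](word_ord f i) -[RHS](word_ord g i) -xf// xg.
  by move=> f _; exact: measurable_cyl.
rewrite (_ : [set f | _] = [set` [pred f : {ffun 'I_n -> 'I_M.+2} | `[< fixed_by s (word f) >]]]); last first.
  by apply/seteqP; split => f /= /asboolP.
rewrite -(@bigfs _ _ _ _ (index_enum _)); last 2 first.
- exact: index_enum_uniq.
- by move=> f _; rewrite mem_index_enum.
rewrite -sumEFin; apply: eq_bigr => f _.
exact: (measure_cyl hm).
Qed.

(** Continuity of m from below: finitely many letters are always bounded, so the sets
    [bounded_fixed M] exhaust the fixed sequences. *)
Lemma cvg_bounded_fixed :
  (fun M => \sum_(f : {ffun 'I_n -> 'I_M.+2} | `[< fixed_by s (word f) >]) word_weight a n (word f)) @ \oo -->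
  fine (m [set x | fixed_by s x]).
Proof.
have E : [set x | fixed_by s x] = \bigcup_M bounded_fixed M.
  apply/seteqP; split => x /= => [fx|[M _ []//]].
  exists (\max_(i < n) x i)%N => //; split => // i iN.
  by rewrite ltnS ltnW// ltnS (leq_bigmax (Ordinal iN)).
have mU : measurable (\bigcup_M bounded_fixed M).
  by apply: bigcupT_measurable; exact: measurable_bounded_fixed.
have nd : {homo bounded_fixed : p q / (p <= q)%N >-> (p <= q)%O}.
  move=> p q pq; apply/subsetPset => x [fx xp]; split => // i iN.
  by apply: leq_trans (xp i iN) _; rewrite !ltnS.
have := nondecreasing_cvg_mu (mu := m) measurable_bounded_fixed mU nd.
rewrite -E -[X in _ --> X -> _]fineK; last by rewrite E; exact: fin_num_measure.
move=> /fine_cvg; apply: cvg_trans; apply: near_eq_cvg; apply: nearW => M /=.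
have := measure_bounded_fixed M => h.
exact: (congr1 fine h).
Qed.

End fixed_measure.

Section thoma_limit.
Context (R : realType) (alpha : nat -> R).
Hypothesis alpha_ge0 : forall i, 0 <= alpha i.
Hypothesis alpha_sum : (\sum_(i <oo) (alpha i)%:E)%E = 1%E.

Lemma thoma_le1 i : alpha i <= 1.
Proof.
rewrite -lee_fin -alpha_sum.
apply: (@le_trans _ _ (\sum_(0 <= j < i.+1) (alpha j)%:E)%E).
  rewrite big_nat_recr//= leeDr// sume_ge0// => j _; rewrite lee_fin//.
by apply: nneseries_lim_ge => j _ _; rewrite lee_fin.
Qed.

Lemma cvg_power_sum p : (0 < p)%N ->
  (fun M => \sum_(j < M.+1) alpha j ^+ p) @ \oo --> power_sum alpha p.
Proof.
move=> p0; have ge0 : forall j, (0 <= (alpha j ^+ p)%:E)%E by move=> j; rewrite lee_fin exprn_ge0.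
(* Finiteness matters because [fine] sends infinity to 0; it follows from alpha j ^ p <= alpha j. *)
have fin : (\sum_(i <oo) (alpha i ^+ p)%:E)%E \is a fin_num.
  rewrite ge0_fin_numE; last by apply: nneseries_ge0 => j _ _; exact: ge0.
  apply: (@le_lt_trans _ _ 1%E); last exact: ltry.
  rewrite -alpha_sum; apply: lee_nneseries => j _ //.
  rewrite lee_fin; case: p p0 {ge0} => // p _.
  by rewrite exprS ler_piMr// exprn_ile1// thoma_le1.
have : (fun M => \sum_(0 <= j < M) (alpha j ^+ p)%:E)%E @ \oo --> (power_sum alpha p)%:E.
  rewrite /power_sum fineK//.
  by apply: is_cvg_nneseries => j _ _; exact: ge0.
move=> /fine_cvg h.
suff : (fun M => \sum_(0 <= j < M) alpha j ^+ p) @ \oo --> power_sum alpha p.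
  rewrite -cvg_shiftS; apply: cvg_trans; apply: near_eq_cvg; apply: nearW => M.
  by rewrite /= big_mkord.
move: h; apply: cvg_trans; apply: near_eq_cvg; apply: nearW => M /=.
by rewrite sumEFin.
Qed.

Lemma power_sum1 : power_sum alpha 1 = 1.
Proof. by rewrite /power_sum; under eq_eseriesr do rewrite expr1; rewrite alpha_sum. Qed.

(** [thoma_char] omits the cycles of length 1, which may be restored because [power_sum alpha 1] is
    1. The power of delta is distributed over the cycles, whose lengths add up to k. *)
Lemma cvg_cycle_product delta k (t : 'S_k) :
  (fun M => \prod_(c in porbits t) \sum_(j < M.+1) (delta * alpha j) ^+ #|c|) @ \oo -->
  delta ^+ k * thoma_char alpha t.
Proof.
have -> : delta ^+ k * thoma_char alpha t =
    \prod_(c in porbits t) (delta ^+ #|c| * power_sum alpha #|c|).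
  rewrite big_split/=; congr (_ * _).
    rewrite -{1}(card_ord k) -prodr_const (partition_big (porbit t) [in porbits t])/=; last first.
      by move=> i _; exact: imset_f.
    apply: eq_bigr => c /imsetP[i _ ->]; rewrite -prodr_const; apply: eq_bigl => j.
    by rewrite eq_porbit_mem.
  rewrite /thoma_char big_mkcondr/=; apply: eq_bigr => c /imsetP[i _ ->].
  case: ltnP => // c1; suff -> : #|porbit t i| = 1%N by rewrite power_sum1.
  by apply/eqP; rewrite eqn_leq c1 lt0n card_porbit_neq0.
apply: cvg_big => [|c /imsetP[i _ ->]]; first exact: mul_continuous.
apply: (@cvg_trans _ ((fun M => delta ^+ #|porbit t i| *
    \sum_(j < M.+1) alpha j ^+ #|porbit t i|) @ \oo)).
  apply: near_eq_cvg; apply: nearW => M; rewrite mulr_sumr.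
  by apply: eq_bigr => j _; rewrite exprMn.
by apply: cvgMl_tmp; apply: cvg_power_sum; rewrite lt0n card_porbit_neq0.
Qed.

Lemma measure_fixed delta (m : probability (seqspace nat) R) n (s : Rinf) :
  product_measure (extended_weights alpha delta) m -> in_Rn n s ->
  fine (m [set x | fixed_by s x]) =
  \sum_(k < n.+1) \sum_(a : {ffun 'I_k -> 'I_n} | increasing a)
    \sum_(t : 'S_k | follows s a t) (1 - delta) ^+ (n - k) * (delta ^+ k * thoma_char alpha t).
Proof.
move=> hm sn; have h1 := cvg_bounded_fixed hm sn.
apply: (cvg_unique (@Rhausdorff R) h1).
rewrite (_ : (fun M => _) = (fun M => \sum_(k < n.+1) \sum_(a : {ffun 'I_k -> 'I_n} | increasing a)
    \sum_(t : 'S_k | follows s a t) (1 - delta) ^+ (n - k) *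
    \prod_(c in porbits t) \sum_(j < M.+1) (delta * alpha j) ^+ #|c|)); last first.
  by apply/funext => M; rewrite /word_weight sum_fixed_words.
apply: cvg_big => [|k _]; first exact: add_continuous.
apply: cvg_big => [|a _]; first exact: add_continuous.
apply: cvg_big => [|t _]; first exact: add_continuous.
by apply: cvgMl_tmp; exact: cvg_cycle_product.
Qed.

End thoma_limit.

(** Rows are nonzero, so there are at most n of them, each at most n. This makes the sum over a
    level in [Rinf_character] an ordinary finite sum. *)
Lemma finite_young n : finite_set [set l | (cells l <= n)%N].
Proof.
pose decode (p : 'I_n.+1 * {ffun 'I_n -> 'I_n.+1}) : young :=
  insubd young0 (mkseq (word p.2) p.1).
apply: (@sub_finite_set _ _ (decode @` setT)); last by apply: finite_image; exact: finite_finset.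
have sumn_ge (w : seq nat) : (0%N \notin w -> size w <= sumn w)%N /\ forall i, (nth 0%N w i <= sumn w)%N.
  elim: w => [|x w [h1 h2]]; first by split=> // i; rewrite nth_nil.
  rewrite inE eq_sym negb_or -lt0n /=; split=> [/andP[x0 /h1 wn]|[|i]]; first by rewrite -add1n leq_add.
    exact: leq_addr.
  by rewrite (leq_trans (h2 i))// leq_addl.
move=> l /= ln; have [_ l0] := andP (valP l); have [sl nl] := sumn_ge (rows l).
have sn : (size (rows l) <= n)%N := leq_trans (sl l0) ln.
exists (inord (size (rows l)), [ffun i : 'I_n => inord (nth 0%N (rows l) i)]) => //.
rewrite /decode /= inordK//; apply/val_inj; rewrite -[RHS]/(rows l).
have -> : mkseq (word [ffun i : 'I_n => inord (nth 0%N (rows l) i) : 'I_n.+1]) (size (rows l)) = rows l.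
  rewrite -[RHS](mkseq_nth 0%N); apply/eq_in_map => i; rewrite mem_iota add0n => /andP[_ il].
  have iN := leq_trans il sn; rewrite (word_ord _ (Ordinal iN)) ffunE inordK//.
  by rewrite ltnS (leq_trans (nl i)).
by rewrite val_insubd (valP l).
Qed.

(** * The value of the character on R_n *)

Section character_value.
Context (R : realType) (alpha : nat -> R) (delta : R) (chi : Rinf -> R[i]).
Hypothesis chiP : Rinf_character alpha delta chi.

(** Group the level by k = [cells l]: the Pascal weight depends on k alone. After the exchange of
    sums, each t carries the sum over diagrams with k cells of [phiY l] times the trace of t, which
    is the Thoma character by [young_measure]. *)
Lemma character_value n (s : Rinf) : in_Rn n s ->
  chi s = (\sum_(k < n.+1) \sum_(a : {ffun 'I_k -> 'I_n} | increasing a)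
    \sum_(t : 'S_k | follows s a t) (1 - delta) ^+ (n - k) * (delta ^+ k * thoma_char alpha t))%:C.
Proof.
have [d [rho [phiY [phiP [phi [M [_ [MY _ thoma] [MP [cP _] limP] [_ _ phiE] chiE]]]]]]] := chiP.
move=> sn; rewrite (chiE _ _ sn).
rewrite fsbig_finite; last exact: finite_young.
have young_mem l : l \in fset_set [set l | (cells l <= n)%N] = (cells l <= n)%N.
  by rewrite in_fset_set; [apply/idP/idP; rewrite inE|exact: finite_young].
set r := enum_fset _.
have -> : \sum_(l <- r) (phi (n, l))%:C * munn_char n (rho (cells l) l) s =
    \sum_(k < n.+1) \sum_(l <- r | cells l == k)
      ((1 - delta) ^+ (n - k) * delta ^+ k * phiY l)%:C * munn_char n (rho k l) s.
  under [RHS]eq_bigr do rewrite big_mkcond.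
  rewrite exchange_big /= big_seq [RHS]big_seq; apply: eq_bigr => l; rewrite young_mem => ln.
  have ln' : (cells l < n.+1)%N by [].
  rewrite -big_mkcond (big_pred1 (Ordinal ln')) => [|k]; last exact: eq_sym.
  rewrite phiE// (pascal_weight cP limP ln); congr (_%:C * _); ring.
rewrite rmorph_sum; apply: eq_bigr => k _ /=.
transitivity (\sum_(l <- r | cells l == k) \sum_(a : {ffun 'I_k -> 'I_n} | increasing a)
   \sum_(t : 'S_k | follows s a t) ((1 - delta) ^+ (n - k) * delta ^+ k)%:C *
    ((phiY l)%:C * \tr (rho k l t))).
  apply: eq_bigr => l _; rewrite rmorphM -mulrA /munn_char /munn_mx !mulr_sumr.
  apply: eq_bigr => a _; rewrite raddf_sum !mulr_sumr; apply: eq_bigr => t _.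
  by [].
rewrite exchange_big rmorph_sum /=; apply: eq_bigr => a _.
rewrite exchange_big rmorph_sum /=; apply: eq_bigr => t _.
rewrite [in RHS]mulrA [RHS]rmorphM /= thoma -mulr_sumr; congr (_ * _).
rewrite (_ : [set l | _] = [set` [pred l : young | cells l == k]]); last first.
  by apply/seteqP; split => l /= /eqP.
apply: bigfs; first exact: fset_uniq.
by move=> l /= /eqP lk; rewrite young_mem lk -ltnS ltn_ord.
Qed.

End character_value.

Theorem theorem2p16 (R : realType) (alpha : nat -> R) (delta : R)
    (halpha_ge0 : forall i, 0 <= alpha i)
    (halpha_noninc : forall i, alpha i.+1 <= alpha i)
    (halpha_sum : (\sum_(i <oo) (alpha i)%:E)%E = 1%E)
    (hdelta0 : 0 <= delta) (hdelta1 : delta <= 1)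
    (m : probability (seqspace nat) R)
    (hm : product_measure (extended_weights alpha delta) m)
    (chi : Rinf -> R[i]) (hchi : Rinf_character alpha delta chi) :
  exists rep : Rinf -> L2tail m -> L2tail m,
    extends_permutation_action rep /\
    factor_representation_of (@L2dot _ _ R (tail_measure m)) chi rep.

Proof.
exists (@rep R m); split; first exact: (rep_extends hm).
split; [exact: (rep_star hm)|exact: (rep_factor hm)|].
exists (@trace R m); first exact: (trace_state hm).
move=> s; have [n sn] := rmap_fix s; rewrite (trace_rep hm).
by rewrite (character_value hchi sn) -(measure_fixed halpha_ge0 halpha_sum hm sn).
Qed.
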